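(* Let $d\ge2$ and $\kappa<0$. Then, for every $k\in\{1,\ldots,d-1\}$, the following assertions hold. (a) The Riemannian normal cone at any $k$-dimensional face of the ideal regular cube $\Box_\infty^d(\kappa)$ is isometric to the Riemannian normal cone at any $k$-dimensional face of the ideal regular simplex $\Delta_\infty^d(\kappa)$. More precisely, all these normal cones are isometric to $C_{d-k}(-d;1,\ldots,1;1,\ldots,1)$. (b) Likewise, the Riemannian tangent cones at such faces of the ideal regular cube and the ideal regular simplex are all isometric to $\mathbb R^k\oplus C_{d-k}(k;1,\ldots,1;1,\ldots,1)$. (c) Moreover, the normal cone at any $(k-1)$-dimensional face of a Euclidean regular $(d-1)$-simplex is isometric to $C_{d-k}(-d;1,\ldots,1;1,\ldots,1)$, whereas its tangent cone is isometric to $\mathbb R^{k-1}\oplus C_{d-k}(k;1,\ldots,1;1,\ldots,1)$. (d) Consequently, the external and internal angles at $k$-dimensional faces of $\Box_\infty^d(\kappa)$ and $\Delta_\infty^d(\kappa)$ coincide with the corresponding angles at $(k-1)$-dimensional faces of a Euclidean regular $(d-1)$-simplex. Their common external and internal angles are, respectively, $$\frac1{\sqrt{2\pi}}\int_{-\infty}^\infty\Phi\left(\frac y{\sqrt k}\right)^{d-k}e^{-y^2/2}\,dy\quad\text{and}\quad\frac1{\sqrt{2\pi}}\int_{-\infty}^\infty\Phi\left(\frac{\mathrm i y}{\sqrt d}\right)^{d-k}e^{-y^2/2}\,dy.$$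
   Context: Klein model. For $\kappa<0$, $\mathbb B^d(\kappa)=\{x\in\mathbb R^d:\|x\|<1/\sqrt{-\kappa}\}$, with closure $\bar{\mathbb B}^d(\kappa)$; for $\kappa=0$ both are $\mathbb R^d$. The tangent space at $x\in\mathbb B^d(\kappa)$ is identified with $\mathbb R^d$ and carries the inner product $$g_x(u,v)=\frac{\langle u,v\rangle}{1+\kappa\|x\|^2}-\frac{\kappa\langle x,u\rangle\langle x,v\rangle}{(1+\kappa\|x\|^2)^2}.$$ For $\kappa<0$, $\Box_\infty^d(\kappa)=[-\frac1{\sqrt{-\kappa d}},\frac1{\sqrt{-\kappa d}}]^d$, and $\Delta_\infty^d(\kappa)$ is a Euclidean regular $d$-simplex centred at the origin with all vertices on $\partial\mathbb B^d(\kappa)$. Cones and angles. Let $P=\{y\in\mathbb R^d:\langle a_r,y\rangle\le b_r,\ r=1,\ldots,m\}\subseteq\bar{\mathbb B}^d(\kappa)$ be a full-dimensional polytope with irredundant inequalities ($a_r\neq 0$), $F\ne P$ a (nonempty) face, $I(F)=\{r:\langle a_r,y\rangle=b_r\ \forall y\in F\}$. For $x\in\operatorname{relint}(F)\cap\mathbb B^d(\kappa)$, the Riemannian tangent cone is $T_x(F,P)=\{u\in\mathbb R^d:\langle a_r,u\rangle\le0\ \forall r\in I(F)\}$ and the Riemannian normal cone is $N_x(F,P)=\{v\in\mathbb R^d: g_x(v,u)\le0\ \forall u\in T_x(F,P)\}$, both regarded as cones in $(\mathbb R^d,g_x)$; their isometry types do not depend on $x$. For the Euclidean regular $(d-1)$-simplex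 in $\mathbb R^{d-1}$ the same definitions are used in dimension $d-1$ with $\kappa=0$, i.e. with the standard scalar product. For a polyhedral cone $K$ in a finite-dimensional inner product space with linear hull $L$, its solid angle is the ratio of the $(\dim L)$-dimensional volumes of $K\cap B$ and $L\cap B$, $B$ the unit ball. The internal (external) angle at $F$ is the solid angle of $T_x(F,P)$ (of $N_x(F,P)$) with respect to $g_x$. Two cones in inner product spaces are isometric if a linear isometry between their linear hulls maps one onto the other; $\oplus$ denotes direct orthogonal sum. Orthocentric cones. For $m\in\mathbb N$, $\lambda_0,\ldots,\lambda_m\in\mathbb R\setminus\{0\}$ and $\varepsilon_1,\ldots,\varepsilon_m\in\{\pm1\}$, $C_m(\lambda_0;\lambda_1,\ldots,\lambda_m;\varepsilon_1,\ldots,\varepsilon_m)$ denotes any cone $\operatorname{pos}\{\varepsilon_1v_1,\ldots,\varepsilon_mv_m\}$ (the set of nonnegative linear combinations) with linearly independent $v_1,\ldots,v_m\in\mathbb R^N$, $N\ge m$, satisfying $\langle v_i,v_j\rangle=\frac1{\lambda_0}+\frac{\delta_{ij}}{\lambda_i}$; it is unique up to isometry. $\Phi$ is the entire function $\Phi(z)=\frac12+\frac1{\sqrt{2\pi}}\int_0^z e^{-t^2/2}\,dt$, and $\mathrm i=\sqrt{-1}$. *)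

(* Defs.v *)
From HB Require Import structures.
From mathcomp Require Import all_boot all_order all_algebra.
From mathcomp Require Import all_classical all_reals all_analysis.
From mathcomp Require Import complex.

Set Implicit Arguments.
Unset Strict Implicit.
Unset Printing Implicit Defensive.
Import Order.TTheory GRing.Theory Num.Theory.
Import numFieldNormedType.Exports.
Local Open Scope classical_set_scope.
Local Open Scope ring_scope.

Section EuclideanSpace.
Context {R : realType}.

Definition dot n (u v : 'rV[R]_n) : R := \sum_(i < n) u 0 i * v 0 i.

(* The norm `|x| that the library puts on 'rV[R]_n is the sup norm. *)
Definition enorm n (u : 'rV[R]_n) : R := Num.sqrt (dot u u).

Definition lin_hull n (A : set 'rV[R]_n) : set 'rV[R]_n :=
  [set y | exists m (p : 'I_m -> 'rV[R]_n) (c : 'I_m -> R),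
    (forall i, A (p i)) /\ y = \sum_i c i *: p i].

Definition aff_hull n (A : set 'rV[R]_n) : set 'rV[R]_n :=
  [set y | exists m (p : 'I_m -> 'rV[R]_n) (c : 'I_m -> R),
    [/\ forall i, A (p i), \sum_i c i = 1 & y = \sum_i c i *: p i]].

Definition conv_hull n m (v : 'I_m -> 'rV[R]_n) : set 'rV[R]_n :=
  [set y | exists c : 'I_m -> R,
    [/\ forall i, 0 <= c i, \sum_i c i = 1 & y = \sum_i c i *: v i]].

Definition pos_hull n m (v : 'I_m -> 'rV[R]_n) : set 'rV[R]_n :=
  [set y | exists c : 'I_m -> R,
    (forall i, 0 <= c i) /\ y = \sum_i c i *: v i].

Definition aff_indep n m (v : 'I_m -> 'rV[R]_n) : Prop :=
  forall c : 'I_m -> R,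
    \sum_i c i = 0 -> \sum_i c i *: v i = 0 -> forall i, c i = 0.

Definition has_dim n (F : set 'rV[R]_n) (k : nat) : Prop :=
  exists v : 'I_k.+1 -> 'rV[R]_n,
    [/\ aff_indep v, forall i, F (v i) & F `<=` aff_hull (range v)].

Definition relint n (F : set 'rV[R]_n) : set 'rV[R]_n :=
  [set x | F x /\ exists2 e : R, 0 < e &
    forall y, aff_hull F y -> enorm (y - x) < e -> F y].

Definition polyhedron n m (a : 'I_m -> 'rV[R]_n) (b : 'I_m -> R) :
    set 'rV[R]_n :=
  [set y | forall r, dot (a r) y <= b r].

Definition irredundant n m (a : 'I_m -> 'rV[R]_n) (b : 'I_m -> R) : Prop :=
  (forall r, a r != 0) /\
  (forall r, [set y | forall s, s != r -> dot (a s) y <= b s]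
             <> polyhedron a b).

(* P itself is a face of P when nonempty (take c = 0 and beta = 0). *)
Definition is_face n (P F : set 'rV[R]_n) : Prop :=
  F !=set0 /\ exists (c : 'rV[R]_n) (beta : R),
    P `<=` [set y | dot c y <= beta] /\ F = P `&` [set y | dot c y = beta].

Definition regular_simplex_vertices n (v : 'I_n.+1 -> 'rV[R]_n) : Prop :=
  aff_indep v /\
  exists s : R, forall i j, i != j -> enorm (v i - v j) = s.

Definition regular_simplex n (S : set 'rV[R]_n) : Prop :=
  exists v : 'I_n.+1 -> 'rV[R]_n,
    regular_simplex_vertices v /\ S = conv_hull v.

End EuclideanSpace.

Section KleinModel.
Context {R : realType}.
Variables (n : nat) (kappa : R).

Definition klein_ball : set 'rV[R]_n :=
  [set x | kappa < 0 -> enorm x < (Num.sqrt (- kappa))^-1].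

Definition klein_metric (x u v : 'rV[R]_n) : R :=
  dot u v / (1 + kappa * enorm x ^+ 2)
  - kappa * dot x u * dot x v / (1 + kappa * enorm x ^+ 2) ^+ 2.

Definition ideal_cube : set 'rV[R]_n :=
  [set y | forall i, - (Num.sqrt (- kappa * n%:R))^-1 <= y 0 i
                     <= (Num.sqrt (- kappa * n%:R))^-1].

Definition ideal_regular_simplex (S : set 'rV[R]_n) : Prop :=
  exists v : 'I_n.+1 -> 'rV[R]_n,
    [/\ regular_simplex_vertices v, \sum_i v i = 0,
        forall i, enorm (v i) = (Num.sqrt (- kappa))^-1 & S = conv_hull v].

Definition ideal_regular_cube_or_simplex (P : set 'rV[R]_n) : Prop :=
  P = ideal_cube \/ ideal_regular_simplex P.

End KleinModel.

(* A subset (in practice a polyhedral cone) of R^amb, together with the form on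
   R^amb that serves as inner product. *)
Record ip_cone (R : realType) := IPCone {
  amb : nat;
  ip : 'rV[R]_amb -> 'rV[R]_amb -> R;
  carrier : set 'rV[R]_amb }.
Arguments IPCone {R amb}.
Arguments amb {R}.
Arguments ip {R} _ _ _.
Arguments carrier {R} _ _.

Section Cones.
Context {R : realType}.

(* A linear map between the linear hulls is given by a matrix on the ambient
   spaces, of which only the action on the linear hull matters. *)
Definition isometric (K L : ip_cone R) : Prop :=
  exists M : 'M[R]_(amb K, amb L),
    [/\ forall u v, lin_hull (carrier K) u -> lin_hull (carrier K) v ->
          ip L (u *m M) (v *m M) = ip K u v,
        [set u *m M | u in lin_hull (carrier K)] = lin_hull (carrier L) &
        [set u *m M | u in carrier K] = carrier L].

Definition oplus (K L : ip_cone R) : ip_cone R :=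
  IPCone
    (fun u v : 'rV[R]_(amb K + amb L) =>
       ip K (lsubmx u) (lsubmx v) + ip L (rsubmx u) (rsubmx v))
    [set u | carrier K (lsubmx u) /\ carrier L (rsubmx u)].

Definition euclidean_space (k : nat) : ip_cone R := IPCone (@dot R k) setT.

(* K is a representative of C_m(l0; l_1, ..., l_m; eps_1, ..., eps_m). *)
Definition orthocentric_cone m (l0 : R) (l eps : 'I_m -> R) (K : ip_cone R) :
    Prop :=
  [/\ l0 != 0, forall i, l i != 0, forall i, eps i = 1 \/ eps i = -1 &
    exists N (v : 'I_m -> 'rV[R]_N),
      [/\ row_free (\matrix_(i < m) v i),
          forall i j, dot (v i) (v j) = l0^-1 + (i == j)%:R / l i &
          K = IPCone (@dot R N) (pos_hull (fun i => eps i *: v i))]].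

(* Iterated integrals: by Tonelli this is n-dimensional Lebesgue measure on
   Borel sets, which are the only sets it is applied to. *)
Fixpoint vol n : set 'rV[R]_n -> \bar R :=
  match n with
  | 0 => fun A => (\1_A 0)%:E
  | n'.+1 => fun A => (\int[lebesgue_measure]_t
      vol [set v : 'rV[R]_n' | A (row_mx (t%:M : 'rV[R]_1) v)])%E
  end.

Definition orthonormal_basis (K : ip_cone R) p (E : 'M[R]_(p, amb K)) : Prop :=
  (forall i j, ip K (row i E) (row j E) = (i == j)%:R) /\
  lin_hull (carrier K) = range (fun t : 'rV[R]_p => t *m E).

Definition unit_ball (K : ip_cone R) : set 'rV[R]_(amb K) :=
  [set u | ip K u u <= 1].
Arguments unit_ball K _ : clear implicits.

Definition coord_vol (K : ip_cone R) p (E : 'M[R]_(p, amb K))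
    (A : set 'rV[R]_(amb K)) : R :=
  fine (vol [set t : 'rV[R]_p | A (t *m E)]).

(* Volumes in the linear hull are taken in orthonormal coordinates; the ratio
   does not depend on the orthonormal basis, so that the set below is a
   singleton as soon as ip K is an inner product on the linear hull. *)
Definition solid_angle (K : ip_cone R) : R :=
  xget 0 [set a | exists p (E : 'M[R]_(p, amb K)),
    orthonormal_basis E /\
    a = coord_vol E (carrier K `&` unit_ball K)
        / coord_vol E (lin_hull (carrier K) `&` unit_ball K)].

End Cones.

(* A k-dimensional face of P other than P, an irredundant description of P by
   inequalities, and a point of the Klein ball in the relative interior of the
   face. *)
Record face_point (R : realType) (n : nat) (kappa : R) (P : set 'rV[R]_n)
    (k : nat) := FacePoint {
  ineqs : nat;
  normal : 'I_ineqs -> 'rV[R]_n;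
  offset : 'I_ineqs -> R;
  face : set 'rV[R]_n;
  point : 'rV[R]_n;
  face_point_polyhedron : P = polyhedron normal offset;
  face_point_irredundant : irredundant normal offset;
  face_point_face : is_face P face;
  face_point_proper : face <> P;
  face_point_dim : has_dim face k;
  face_point_relint : relint face point;
  face_point_ball : klein_ball kappa point }.

Section FaceCones.
Context {R : realType} {n : nat} {kappa : R} {P : set 'rV[R]_n} {k : nat}.
Variable f : face_point kappa P k.

Definition active_ineqs : set 'I_(ineqs f) :=
  [set r | forall y, face f y -> dot (normal r) y = offset r].

Definition tangent_set : set 'rV[R]_n :=
  [set u | forall r, active_ineqs r -> dot (normal r) u <= 0].

Definition normal_set : set 'rV[R]_n :=
  [set v | forall u, tangent_set u -> klein_metric kappa (point f) v u <= 0].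

Definition tangent_cone : ip_cone R :=
  IPCone (klein_metric kappa (point f)) tangent_set.

Definition normal_cone : ip_cone R :=
  IPCone (klein_metric kappa (point f)) normal_set.

Definition internal_angle : R := solid_angle tangent_cone.

Definition external_angle : R := solid_angle normal_cone.

End FaceCones.

Section ComplexIntegrals.
Context {R : realType}.

Definition cexp (z : R[i]) : R[i] :=
  (expR (complex.Re z))%:C%C
  * (cos (complex.Im z) +i* sin (complex.Im z))%C.

Definition cintegrable (D : set R) (f : R -> R[i]) : Prop :=
  lebesgue_measure.-integrable D (fun y => (complex.Re (f y))%:E) /\
  lebesgue_measure.-integrable D (fun y => (complex.Im (f y))%:E).

Definition cintegral (D : set R) (f : R -> R[i]) : R[i] :=
  (\int[lebesgue_measure]_(y in D) complex.Re (f y)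
   +i* \int[lebesgue_measure]_(y in D) complex.Im (f y))%C.

(* The integral from 0 to z is taken along the segment t = s z, 0 <= s <= 1. *)
Definition Phi (z : R[i]) : R[i] :=
  1 / 2 + ((Num.sqrt (2 * pi))^-1)%:C%C
          * cintegral `[0, 1] (fun s => cexp (- (s%:C%C * z) ^+ 2 / 2) * z).

Definition gauss_integrand (f : R -> R[i]) (y : R) : R[i] :=
  f y * (expR (- y ^+ 2 / 2))%:C%C.

Definition external_integrand (k m : nat) : R -> R[i] :=
  gauss_integrand (fun y => Phi (y / Num.sqrt k%:R)%:C%C ^+ m).

Definition internal_integrand (d m : nat) : R -> R[i] :=
  gauss_integrand (fun y => Phi (0 +i* (y / Num.sqrt d%:R))%C ^+ m).

Definition gauss_integral (f : R -> R[i]) : R[i] :=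
  ((Num.sqrt (2 * pi))^-1)%:C%C * cintegral setT f.

End ComplexIntegrals.

(* Main.v *)
(* At a point x of the relative interior of F, the tangent cone is cut out by the
   inequalities active at x, in any description of P. The inverse of the Klein
   metric at x is w (I + kappa x x^T) with w = 1 + kappa |x|^2, so that the Gram
   matrix of the active outer normals, in the dual metric, is
   w (<a_i, a_j> + kappa <x, a_i> <x, a_j>). For the ideal cube, the ideal simplex
   and the Euclidean simplex of one dimension less, it is a positive multiple of
   I - J / d, with J the all-ones matrix and d - k active inequalities. Hence the
   normal cone is simplicial with this Gram matrix, and the tangent cone is the
   sum of its lineality space and of the dual simplicial cone, whose Gram matrix
   is I + J / k.

   A solid angle is the Gaussian measure of the cone, that is, after a linear
   change of variables, a ratio of integrals of exp (-(|s|^2 + c (sum s)^2) / 2)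
   over the positive orthant and over the whole space. Writing exp (-c S^2 / 2) as
   the Laplace (c < 0) or Fourier (c > 0) transform of a Gaussian variable y makes
   the coordinates of s independent given y, and each of them contributes a factor
   Phi at a real or at an imaginary argument. *)

Require Import Defs.
From HB Require Import structures.
From mathcomp Require Import all_boot all_order all_algebra.
From mathcomp Require Import all_classical all_reals all_analysis.
From mathcomp Require Import measurable_realfun.
From mathcomp Require Import complex ring lra.
Set Implicit Arguments.
Unset Strict Implicit.
Unset Printing Implicit Defensive.
Import Order.TTheory GRing.Theory Num.Theory.
Import numFieldNormedType.Exports.
Local Open Scope classical_set_scope.
Local Open Scope ring_scope.

(** * Iterated integrals and linear changes of variables *)

(** The same matrix has three sources. Active facets of an ideal polytope have equal offsets, so the
    Klein correction only adds a multiple of J: for the cube it is all of -J/d, for the ideal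
    simplex it completes the Euclidean part -J/(d+1), and the Euclidean simplex of dimension d-1 has
    -J/d by itself. Since J^2 = mJ, the inverse of I - J/d in size m = d-k is I + J/k; it exists
    because k > 0. Volumes are iterated integrals, so the linear substitution taking a cone to an
    orthant is proved for these directly, by elimination. [solid_angle] is a chosen value: an
    orthonormal basis must be exhibited, and every other one must give the same ratio. The half-line
    transforms of the exponential and the sine are not elementary. Each solves a linear differential
    equation in the frequency, whose solution is the integral in [Phi]. The power m uses up m/d of
    the Gaussian exponent, and rescaling the remaining k/d exchanges sqrt d and sqrt k in the
    argument of [Phi]. *)

Definition rV_display : measure_display.
Proof. exact: default_measure_display. Qed.

Section row_vector_measurable.
Context {R : realType} (n : nat).

Let coor (i : 'I_n) (u : 'rV[R]_n) : R := u 0 i.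

Let rV_measurable0 : g_sigma_preimage coor set0.
Proof. exact: sigma_algebra0. Qed.

Let rV_measurableC A : g_sigma_preimage coor A -> g_sigma_preimage coor (~` A).
Proof. exact: sigma_algebraC. Qed.

Let rV_measurable_bigcup (F : (set 'rV[R]_n)^nat) :
  (forall i, g_sigma_preimage coor (F i)) ->
  g_sigma_preimage coor (\bigcup_i (F i)).
Proof. exact: sigma_algebra_bigcup. Qed.

(** The sigma-algebra generated by the coordinates: a map into row vectors is measurable as soon as
    its coordinates are, which settles slices and matrix products. *)
HB.instance Definition _ := @isMeasurable.Build rV_display
  'rV[R]_n (g_sigma_preimage coor)
  rV_measurable0 rV_measurableC rV_measurable_bigcup.

Lemma measurable_coor (i : 'I_n) :
  measurable_fun [set: 'rV[R]_n] (fun u : 'rV[R]_n => u 0 i).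
Proof.
move=> _ Y mY; rewrite setTI; apply: sub_sigma_algebra => /=.
rewrite -bigcup_seq/=; exists i => /=; first by rewrite mem_index_enum.
by exists Y => //; rewrite setTI.
Qed.

Lemma measurable_rowP d (T : measurableType d) (f : T -> 'rV[R]_n) :
  measurable_fun setT f <-> forall i, measurable_fun setT (fun x => f x 0 i).
Proof.
split=> [mf i|mf].
  exact: (measurableT_comp (measurable_coor i)).
have : g_sigma_preimage (fun i => coor i \o f) `<=` measurable.
  apply: smallest_sub; first exact: sigma_algebra_measurable.
  move=> A; rewrite -bigcup_seq => -[i _ [B mB <-]].
  exact: mf.
by rewrite g_sigma_preimage_comp => prefS _ A mA; apply: prefS; exists A.
Qed.

End row_vector_measurable.

Lemma measurable_row_mx {R : realType} n d (T : measurableType d)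
    (f : T -> R) (g : T -> 'rV[R]_n) :
  measurable_fun setT f -> measurable_fun setT g ->
  measurable_fun setT
    (fun x => row_mx ((f x)%:M : 'rV[R]_1) (g x) : 'rV[R]_n.+1).
Proof.
move=> mf mg; apply/measurable_rowP => i.
case: (@split_ordP 1 n i) => j ->.
- rewrite (_ : (fun _ => _) = f) //; apply/funext => x.
  by rewrite [LHS](@row_mxEl R 1 1 n) mxE [j]ord1 eqxx mulr1n.
- rewrite (_ : (fun _ => _) = (fun x => g x 0 j)).
    exact: (measurableT_comp (@measurable_coor _ _ j)).
  by apply/funext => x; rewrite [LHS](@row_mxEr R 1 1 n).
Qed.

Lemma measurable_mulmx {R : realType} p q (M : 'M[R]_(p, q)) :
  measurable_fun setT (fun u : 'rV[R]_p => u *m M).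
Proof.
apply/measurable_rowP => i; under eq_fun do rewrite mxE.
apply: measurable_sum => j; apply: measurable_funM; last exact: measurable_cst.
exact: measurable_coor.
Qed.

Lemma measurable_rsubmx {R : realType} p q :
  measurable_fun setT (fun u : 'rV[R]_(p + q) => rsubmx u).
Proof.
apply/measurable_rowP => i; under eq_fun do rewrite mxE.
exact: measurable_coor.
Qed.

(** * Iterated integrals of functions and Tonelli's theorem *)

Section iterint.
Context {R : realType}.
Local Notation leb := (@lebesgue_measure R).
Local Open Scope ereal_scope.

(** Same recursion as [vol], but for functions, so that Gaussian weights can be integrated as well
    as indicators. *)
Fixpoint iterint n : ('rV[R]_n -> \bar R) -> \bar R :=
  match n with
  | 0 => fun f => f 0%R
  | n'.+1 => fun f =>
      \int[leb]_t iterint (fun v : 'rV[R]_n' => f (row_mx (t%:M : 'rV[R]_1) v))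
  end.

Lemma iterintS n (f : 'rV[R]_n.+1 -> \bar R) :
  iterint f =
  \int[leb]_t iterint (fun v : 'rV[R]_n => f (row_mx (t%:M : 'rV[R]_1) v)).
Proof. by []. Qed.

Lemma vol_iterint n (A : set 'rV[R]_n) :
  vol A = iterint (fun x => (\1_A x)%:E).
Proof. by elim: n A => //= n IH A; apply: eq_integral => t _; rewrite IH. Qed.

Lemma eq_iterint n (f g : 'rV[R]_n -> \bar R) :
  f =1 g -> iterint f = iterint g.
Proof. by move=> /funext ->. Qed.

Lemma iterint_ge0 n (f : 'rV[R]_n -> \bar R) :
  (forall x, 0 <= f x) -> 0 <= iterint f.
Proof.
elim: n f => [|n IH] f f0 /=; first exact: f0.
by apply: integral_ge0 => t _; apply: IH.
Qed.

(** The parameter space is arbitrary because the induction moves the coordinate just split off into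
    it: [X] becomes [X * R]. *)
Lemma measurable_iterint d (X : measurableType d) n
    (F : X * 'rV[R]_n -> \bar R) :
  measurable_fun setT F -> (forall z, 0 <= F z) ->
  measurable_fun setT (fun x => iterint (fun v => F (x, v))).
Proof.
elim: n d X F => [|n IH] d X F mF F0 /=.
  by apply: (measurableT_comp mF); apply: measurable_fun_pair.
pose G (z : X * R) := iterint (fun v => F (z.1, row_mx (z.2%:M : 'rV[R]_1) v)).
apply: (@measurable_fun_fubini_tonelli_F _ _ X (measurableTypeR R) _ leb G).
- apply: (IH _ _ (fun w : (X * R) * 'rV[R]_n =>
    F (w.1.1, row_mx (w.1.2%:M : 'rV[R]_1) w.2))) => //.
  apply: (measurableT_comp mF); apply: measurable_fun_pair.
    exact: measurableT_comp.
  by apply: measurable_row_mx => //; exact: measurableT_comp.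
- by move=> z; apply: iterint_ge0.
Qed.

Lemma measurable_cons_fun n (f : 'rV[R]_n.+1 -> \bar R) :
  measurable_fun setT f ->
  measurable_fun setT
    (fun z : R * 'rV[R]_n => f (row_mx (z.1%:M : 'rV[R]_1) z.2)).
Proof.
by move=> mf; apply: (measurableT_comp mf); exact: measurable_row_mx.
Qed.

Lemma measurable_slice n (f : 'rV[R]_n.+1 -> \bar R) (t : R) :
  measurable_fun setT f ->
  measurable_fun setT (fun v : 'rV[R]_n => f (row_mx (t%:M : 'rV[R]_1) v)).
Proof.
by move=> mf; apply: (measurableT_comp mf); exact: measurable_row_mx.
Qed.

Lemma measurable_iterint_slice n (f : 'rV[R]_n.+1 -> \bar R) :
  measurable_fun setT f -> (forall x, 0 <= f x) ->
  measurable_fun setT (fun t : R =>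
    iterint (fun v : 'rV[R]_n => f (row_mx (t%:M : 'rV[R]_1) v))).
Proof.
move=> mf f0; apply: (measurable_iterint (F := fun z : R * 'rV[R]_n =>
   f (row_mx (z.1%:M : 'rV[R]_1) z.2))) => //.
exact: measurable_cons_fun.
Qed.

(** Tonelli one coordinate at a time: the induction hypothesis is applied with the outer coordinate
    frozen, and the two remaining integrals are exchanged. *)
Lemma iterint_integral d (X : measurableType d)
    (mu : {sigma_finite_measure set X -> \bar R}) n
    (F : X * 'rV[R]_n -> \bar R) :
  measurable_fun setT F -> (forall z, 0 <= F z) ->
  iterint (fun v => \int[mu]_x F (x, v)) =
  \int[mu]_x iterint (fun v => F (x, v)).
Proof.
elim: n F => [//|n IH] F mF F0 /=.
pose H (w : (X * R) * 'rV[R]_n) := F (w.1.1, row_mx (w.1.2%:M : 'rV[R]_1) w.2).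
have mH : measurable_fun setT H.
  apply: (measurableT_comp mF); apply: measurable_fun_pair.
    exact: measurableT_comp.
  by apply: measurable_row_mx => //; exact: measurableT_comp.
transitivity (\int[leb]_t \int[mu]_x iterint (fun v => H ((x, t), v))).
  apply: eq_integral => t _.
  rewrite -(IH (fun z : X * 'rV[R]_n => H ((z.1, t), z.2))) //; last first.
    by move=> z; exact: F0.
  apply: (measurableT_comp mH); apply: measurable_fun_pair => //.
  by apply: measurable_fun_pair.
apply: (@fubini_tonelli _ _ (measurableTypeR R) X _ leb mu
  (fun z => iterint (fun v => H ((z.2, z.1), v)))).
- apply: (measurable_iterint (F := fun w : (R * X) * 'rV[R]_n =>
    H ((w.1.2, w.1.1), w.2))); last by move=> z; exact: F0.
  apply: (measurableT_comp mH); apply: measurable_fun_pair => //.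
  by apply: measurable_fun_pair; exact: measurableT_comp.
- by move=> z; apply: iterint_ge0 => v; exact: F0.
Qed.

Lemma iterintZl n (c : R) (f : 'rV[R]_n -> \bar R) : (0 <= c)%R ->
  measurable_fun setT f -> (forall x, 0 <= f x) ->
  iterint (fun x => c%:E * f x) = c%:E * iterint f.
Proof.
move=> c0; elim: n f => [//|n IH] f mf f0 /=.
transitivity (\int[leb]_t (c%:E *
   iterint (fun v : 'rV[R]_n => f (row_mx (t%:M : 'rV[R]_1) v)))).
  by apply: eq_integral => t _; rewrite IH //; exact: measurable_slice.
rewrite ge0_integralZl_EFin //.
- by move=> t _; apply: iterint_ge0.
- exact: measurable_iterint_slice.
Qed.

End iterint.

(** * Affine substitutions and block triangular matrices *)

Section change_of_variables.
Context {R : realType}.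
Local Notation leb := (@lebesgue_measure R).
Local Open Scope ereal_scope.

Lemma measurable_affine (a b : R) :
  measurable_fun setT (fun t : R => a * t + b)%R.
Proof.
by apply: measurable_funD; [apply: measurable_funM|];
  do ?[exact: measurable_cst|exact: measurable_id].
Qed.

(** Uniqueness of Lebesgue measure: the image measure scaled by [|a|] agrees with length on
    intervals []x, y]]. A negative [a] moves the closed end of the preimage, which does not change
    its length. *)
Lemma lebesgue_measure_affine (a b : R) (A : set R) :
  a != 0%R -> measurable A ->
  leb A = `|a|%:E * leb ((fun t : R => a * t + b)%R @^-1` A).
Proof.
move=> a0 mA.
pose h : measurableTypeR R -> measurableTypeR R := (fun t : R => a * t + b)%R.
have mh : measurable_fun setT h by exact: measurable_affine.
pose nu : {measure set (measurableTypeR R) -> \bar R} :=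
  mscale (NngNum (normr_ge0 a)) (pushforward leb h).
rewrite (@lebesgue_measure_unique _ (nu mh)) // => X [[x y] /= xy <-].
rewrite /nu /mscale /= /pushforward.
have [a_gt0|] := ltP 0%R a.
  have -> : h @^-1` `]x, y] = [set` `](x - b) / a, (y - b) / a]%R].
    apply/seteqP; split => t; rewrite /h /= !in_itv /= ltr_pdivrMr // ler_pdivlMr //.
      by move=> /andP[? ?]; apply/andP; split; lra.
    by move=> /andP[? ?]; apply/andP; split; lra.
  rewrite !lebesgue_measure_itv /= !lte_fin ltr_pM2r ?invr_gt0 //.
  rewrite ltrD2r; case: ifP => _; last by rewrite mule0.
  rewrite -!EFinB -EFinM gtr0_norm //; congr EFin; field.
  by rewrite gt_eqF.
rewrite le_eqVlt (negbTE a0) /= => a_lt0.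
have -> : h @^-1` `]x, y] = [set` `[(y - b) / a, (x - b) / a[%R].
  apply/seteqP; split => t; rewrite /h /= !in_itv /= ltr_ndivlMr // ler_ndivrMr //.
    by move=> /andP[? ?]; apply/andP; split; lra.
  by move=> /andP[? ?]; apply/andP; split; lra.
rewrite !lebesgue_measure_itv /= !lte_fin ltr_nM2r ?invr_lt0 //.
rewrite ltrD2r; case: ifP => _; last by rewrite mule0.
rewrite -!EFinB -EFinM ltr0_norm //; congr EFin; field.
by rewrite lt_eqF.
Qed.

Lemma ge0_integral_affine (a b : R) (f : R -> \bar R) : a != 0%R ->
  measurable_fun setT f -> (forall t, 0 <= f t) ->
  \int[leb]_t f t = `|a|%:E * \int[leb]_t f (a * t + b)%R.
Proof.
move=> a0 mf f0.
pose h : measurableTypeR R -> measurableTypeR R := (fun t : R => a * t + b)%R.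
have mh : measurable_fun setT h by exact: measurable_affine.
pose nu : {measure set (measurableTypeR R) -> \bar R} :=
  mscale (NngNum (normr_ge0 a)) (pushforward leb h).
transitivity (\int[nu mh]_t f t).
  apply: eq_measure_integral => A mA _.
  exact: lebesgue_measure_affine.
by rewrite ge0_integral_mscale //= ge0_integral_pushforward.
Qed.

Let row_mxDr n (t : R) (v : 'rV[R]_n) (b : 'rV[R]_(1 + n)) :
  (row_mx (t%:M : 'rV_1) v + b = row_mx (t + b 0 0)%:M (v + rsubmx b))%R.
Proof.
rewrite -[in LHS](hsubmxK b) add_row_mx [lsubmx b]mx11_scalar -raddfD /= mxE.
by rewrite lshift0.
Qed.

Lemma iterint_translate n (b : 'rV[R]_n) (f : 'rV[R]_n -> \bar R) :
  measurable_fun setT f -> (forall x, 0 <= f x) ->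
  iterint (fun v => f (v + b)%R) = iterint f.
Proof.
elim: n b f => [|n IH] b f mf f0 /=; first by rewrite [b]thinmx0 addr0.
pose g (t : R) := iterint (fun v : 'rV[R]_n => f (row_mx (t%:M : 'rV[R]_1) v)).
rewrite [RHS](@ge0_integral_affine 1 (b 0 0)%R g) ?oner_neq0 //; first last.
- by move=> t; apply: iterint_ge0.
- exact: measurable_iterint_slice.
rewrite normr1 mul1e; apply: eq_integral => t _; rewrite mul1r /g.
rewrite -[RHS](IH (@rsubmx R 1 1 n b)) //; last exact: measurable_slice.
apply: eq_iterint => v; congr (f _).
exact: row_mxDr.
Qed.

(** Kept as a property of the matrix because it passes to products, so that a factorization
    suffices. *)
Definition change_of_variables n (M : 'M[R]_n) :=
  forall f : 'rV[R]_n -> \bar R, measurable_fun setT f -> (forall x, 0 <= f x) ->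
    iterint f = `|\det M|%:E * iterint (fun v => f (v *m M)).

Lemma change_of_variablesM n (M N : 'M[R]_n) :
  change_of_variables M -> change_of_variables N ->
  change_of_variables (M *m N).
Proof.
move=> cM cN f mf f0.
rewrite cN // (cM (fun v => f (v *m N))) //; last first.
  exact: (measurableT_comp mf (measurable_mulmx N)).
rewrite muleA -EFinM -normrM mulrC det_mulmx; congr (_ * _).
by apply: eq_iterint => v; rewrite mulmxA.
Qed.

(* With the lower triangular step that follows, the only place where the iterated
   integral is really computed. *)
Lemma change_of_variables_ublock n (a : R) (b : 'rV[R]_n) (D : 'M[R]_n) :
  a != 0%R -> change_of_variables D ->
  change_of_variables (block_mx (a%:M : 'rV_1) b 0 D : 'M[R]_(1 + n)).
Proof.
move=> a0 cD f mf f0; rewrite det_ublock det_scalar1.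
pose g (t : R) := iterint (fun v : 'rV[R]_n => f (row_mx (t%:M : 'rV[R]_1) v)).
have mg : measurable_fun setT g by exact: measurable_iterint_slice.
have g0 t : 0 <= g t by exact: iterint_ge0.
pose h (t : R) := iterint (fun v : 'rV[R]_n =>
  f (row_mx (t%:M : 'rV[R]_1) v *m block_mx a%:M b 0 D)).
transitivity (\int[leb]_t g t) => //.
transitivity (`|a * \det D|%:E * \int[leb]_t h t) => //.
rewrite (ge0_integral_affine 0 a0) // normrM EFinM -muleA; congr (_ * _).
have fM : measurable_fun setT (fun w => f (w *m block_mx (a%:M : 'rV_1) b 0 D)).
  exact: (measurableT_comp mf (measurable_mulmx _)).
rewrite -ge0_integralZl_EFin //; first last.
- exact: (measurable_iterint_slice fM).
- by move=> t _; apply: iterint_ge0.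
apply: eq_integral => t _; rewrite addr0 /g /h.
rewrite -(iterint_translate (t *: b)); [|exact: measurable_slice|by []].
rewrite (cD (fun v => f (row_mx _ (v + _)%R))) //; last first.
  apply: (measurableT_comp mf); apply: measurable_row_mx => //.
  apply/measurable_rowP => i; under eq_fun do rewrite mxE.
  by apply: measurable_funD => //; exact: measurable_coor.
congr (_ * _); apply: eq_iterint => v; congr (f _).
rewrite mul_row_block mulmx0 addr0 mul_scalar_mx mul_scalar_mx scale_scalar_mx.
by rewrite mulrC addrC.
Qed.

(** A row vector [(t, v)] goes to [(a t + v c, v D)]: the first coordinate is shifted by an amount
    depending on the others, so it has to be integrated innermost, by Tonelli. *)
Lemma change_of_variables_lblock n (a : R) (c : 'cV[R]_n) (D : 'M[R]_n) :
  a != 0%R -> change_of_variables D ->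
  change_of_variables (block_mx (a%:M : 'rV_1) 0 c D : 'M[R]_(1 + n)).
Proof.
move=> a0 cD f mf f0; rewrite det_lblock det_scalar1.
have inner_first (g : 'rV[R]_(1 + n) -> \bar R) : measurable_fun setT g ->
    (forall x, 0 <= g x) ->
    iterint g = iterint (fun v => \int[leb]_t g (row_mx (t%:M : 'rV_1) v)).
  move=> mg g0; rewrite (@iterint_integral _ _ _ leb n
    (fun z => g (row_mx (z.1%:M : 'rV_1) z.2))) //.
  exact: measurable_cons_fun.
rewrite !inner_first //; last first.
  exact: (measurableT_comp mf (measurable_mulmx _)).
have mint : measurable_fun setT
    (fun v : 'rV[R]_n => \int[leb]_t f (row_mx (t%:M : 'rV_1) v)).
  apply: (@measurable_fun_fubini_tonelli_F _ _ _ (measurableTypeR R) _ leb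
     (fun z : 'rV[R]_n * R => f (row_mx (z.2%:M : 'rV_1) z.1))) => //.
  by apply: (measurableT_comp mf); exact: measurable_row_mx.
have int0 (v : 'rV[R]_n) : 0 <= \int[leb]_t f (row_mx (t%:M : 'rV_1) v).
  exact: integral_ge0.
rewrite (cD (fun v => \int[leb]_t f (row_mx (t%:M : 'rV_1) v))) //.
rewrite normrM EFinM [`|a|%:E * _]muleC -muleA; congr (_ * _).
rewrite -iterintZl //; first last.
- by move=> v; exact: integral_ge0.
- apply: (@measurable_fun_fubini_tonelli_F _ _ _ (measurableTypeR R) _ leb
     (fun z : 'rV[R]_n * R =>
        f (row_mx (z.2%:M : 'rV_1) z.1 *m block_mx a%:M 0 c D))) => //.
  apply: (measurableT_comp mf); apply: (measurableT_comp (measurable_mulmx _)).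
  exact: measurable_row_mx.
apply: eq_iterint => v.
rewrite (@ge0_integral_affine a ((v *m c) 0 0)%R) //; last exact: measurableT_comp
   (measurable_cons_fun mf) (measurable_fun_pair _ _).
congr (_ * _); apply: eq_integral => t _; congr (f _).
rewrite mul_row_block mulmx0 add0r; congr row_mx.
rewrite [in RHS](mx11_scalar (v *m c)) mul_scalar_mx scale_scalar_mx -raddfD /=.
by rewrite mulrC.
Qed.

End change_of_variables.

Section linear_change_of_variables.
Context {R : realType}.
Local Notation leb := (@lebesgue_measure R).

Lemma change_of_variables1 n : change_of_variables (1%:M : 'M[R]_n).
Proof.
move=> f mf f0; rewrite det1 normr1 mul1e.
by apply: eq_iterint => v; rewrite mulmx1.
Qed.

Let pivot_change n (a : R) (b : 'rV[R]_n) (c : 'cV[R]_n) (D : 'M[R]_n) :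
  (forall N : 'M[R]_n, N \in unitmx -> change_of_variables N) ->
  a != 0 -> block_mx (a%:M : 'rV_1) b c D \in unitmx ->
  change_of_variables (block_mx (a%:M : 'rV_1) b c D : 'M[R]_(1 + n)).
Proof.
move=> IH a0.
(* Elimination with pivot [a]; the lower right block of the second factor is the Schur
   complement. *)
have -> : block_mx (a%:M : 'rV_1) b c D =
  block_mx ((1%R : R)%:M : 'rV_1) 0 (a^-1 *: c) 1%:M
    *m block_mx (a%:M : 'rV_1) b 0 (D - a^-1 *: (c *m b)).
  rewrite mulmx_block !mul1mx !mul0mx ?mulmx0 !addr0 -!scalemxAl mul_mx_scalar.
  by rewrite scalerA mulVf // scale1r addrC subrK.
rewrite unitmx_mul => /andP[_]; rewrite unitmxE det_ublock unitrM => /andP[_].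
rewrite -unitmxE => /IH cD; apply: change_of_variablesM.
- by apply: change_of_variables_lblock; rewrite ?oner_neq0//; exact: change_of_variables1.
- exact: change_of_variables_ublock.
Qed.

Lemma unitmx_change_of_variables n (M : 'M[R]_n) :
  M \in unitmx -> change_of_variables M.
Proof.
elim: n M => [|n IH] M uM.
  move=> f mf f0; rewrite det_mx00 normr1 mul1e /=; congr f.
  by rewrite [RHS]thinmx0.
change 'M[R]_(1 + n) in M.
have pivot (N : 'M[R]_(1 + n)) : N \in unitmx -> N 0 0 != 0 -> change_of_variables N.
  move=> uN N00; have -> : N = block_mx ((N 0 0)%:M : 'rV_1) (ursubmx N) (dlsubmx N) (drsubmx N).
    rewrite -[LHS]submxK; congr block_mx; rewrite [LHS]mx11_scalar; congr (_%:M).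
    by rewrite !mxE !lshift0.
  apply: pivot_change => //.
  rewrite (_ : block_mx _ _ _ _ = N) // -[RHS]submxK; congr block_mx.
  rewrite [RHS]mx11_scalar; congr (_%:M); by rewrite !mxE !lshift0.
have [M00|] := eqVneq (M 0 0) 0; last exact: pivot.
(* An invertible matrix cannot kill the first basis vector, so its first column has a nonzero
   entry. *)
have [i Mi0] : exists i : 'I_n, M (rshift 1 i) 0 != 0.
  apply: contrapT => /forallNP M0.
  have Me : M *m delta_mx 0 0 = 0 :> 'cV_(1 + n).
    apply/matrixP => j k; rewrite -colE !mxE.
    case: (split_ordP j) => j' ->; first by rewrite [j']ord1 lshift0.
    by apply/eqP/negP => /negP; exact: M0.
  have := mulKmx uM (delta_mx 0 0 : 'cV_(1 + n)); rewrite Me mulmx0.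
  by move=> /matrixP/(_ 0 0); rewrite !mxE eqxx => /eqP; rewrite eq_sym oner_eq0.
(* [S 1] adds the row with the nonzero entry to the first row, which creates a pivot; [S (-1)]
   undoes it. *)
pose S (s : R) : 'M[R]_(1 + n) := block_mx ((1%R : R)%:M : 'rV_1) (s *: delta_mx 0 i) 0 1%:M.
have SS : S (-1) *m S 1 = 1%:M.
  rewrite mulmx_block !mul1mx !mulmx0 !mulmx1 !mul0mx !addr0 add0r.
  by rewrite -scalerDl subrr scale0r -scalar_mx_block.
have cS : change_of_variables (S (-1)).
  by apply: change_of_variables_ublock; rewrite ?oner_neq0//; exact: change_of_variables1.
have uS : S 1 \in unitmx by have [] := mulmx1_unit SS.
rewrite -[M]mul1mx -SS -mulmxA; apply: change_of_variablesM => //.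
apply: pivot; first by rewrite unitmx_mul uS.
rewrite -[M in S 1 *m M]submxK mulmx_block mul1mx.
rewrite (_ : (0 : 'I_(1 + n)) = lshift n 0); last exact/val_inj.
rewrite block_mxEul !mxE big_ord1 !mxE.
rewrite !lshift0 M00 mulr0 add0r (bigD1 i) //= big1 ?addr0; last first.
  by move=> j ji; rewrite !mxE (negbTE ji) andbF mulr0 mul0r.
by rewrite !mxE !eqxx mulr1 mul1r lshift0.
Qed.

Lemma iterint_scale n (a : R) (f : 'rV[R]_n -> \bar R) : a != 0 ->
  measurable_fun setT f -> (forall x, 0 <= f x)%E ->
  iterint f = (`|a ^+ n|%:E * iterint (fun v => f (a *: v)))%E.
Proof.
move=> a0 mf f0; rewrite (@unitmx_change_of_variables _ a%:M _ f) //.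
  rewrite det_scalar; congr (_ * _)%E; apply: eq_iterint => v.
  by rewrite mul_mx_scalar.
by rewrite unitmxE det_scalar unitrX // unitfE.
Qed.

End linear_change_of_variables.

(** * Rules for derivatives *)

Section pointwise_derivatives.
Context {R : realType}.
Implicit Types (f g : R -> R) (x df dg : R).

(** The rules below build a derivative by unification; this lemma then replaces the resulting
    expression by the expected one. *)
Lemma der_eq f x df dg : is_derive x 1 f df -> df = dg -> is_derive x 1 f dg.
Proof. by move=> ? <-. Qed.

Lemma der_id x : is_derive x 1 (fun y : R => y) 1.
Proof. exact: is_derive_id. Qed.

Lemma der_cst (c x : R) : is_derive x 1 (fun=> c) 0.
Proof. exact: is_derive_cst. Qed.

Lemma derN f x df : is_derive x 1 f df -> is_derive x 1 (fun y => - f y) (- df).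
Proof. by move=> ?; exact: is_deriveN. Qed.

Lemma derD f g x df dg : is_derive x 1 f df -> is_derive x 1 g dg ->
  is_derive x 1 (fun y => f y + g y) (df + dg).
Proof. by move=> ? ?; exact: is_deriveD. Qed.

Lemma derM f g x df dg : is_derive x 1 f df -> is_derive x 1 g dg ->
  is_derive x 1 (fun y => f y * g y) (f x * dg + df * g x).
Proof.
move=> ? ?; apply: (der_eq (is_deriveM _ _)).
by rewrite [df * _]mulrC.
Qed.

Lemma derMl (c : R) f x df : is_derive x 1 f df ->
  is_derive x 1 (fun y => c * f y) (c * df).
Proof.
by move=> ?; apply: der_eq (derM (der_cst c x) _) _; rewrite mul0r addr0.
Qed.

Lemma derMr (c : R) f x df : is_derive x 1 f df ->
  is_derive x 1 (fun y => f y * c) (df * c).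
Proof.
by move=> ?; apply: der_eq (derM _ (der_cst c x)) _; rewrite mulr0 add0r.
Qed.

Lemma derX2 f x df : is_derive x 1 f df ->
  is_derive x 1 (fun y => f y ^+ 2) (2 * f x * df).
Proof.
move=> ?; rewrite (_ : (fun y => f y ^+ 2) = (fun y => f y * f y)); last first.
  by apply/funext => y; rewrite expr2.
by apply: der_eq (derM _ _) _; rewrite mulr2n; ring.
Qed.

Lemma der_expR f x df : is_derive x 1 f df ->
  is_derive x 1 (fun y => expR (f y)) (expR (f x) * df).
Proof. by move=> ?; exact: is_derive1_comp. Qed.

Lemma der_cos f x df : is_derive x 1 f df ->
  is_derive x 1 (fun y => cos (f y)) (- sin (f x) * df).
Proof. by move=> ?; exact: is_derive1_comp. Qed.

Lemma der_continuous f :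
  (forall x, exists df : R, is_derive x 1 f df) -> continuous f.
Proof.
move=> fd x; apply: differentiable_continuous; apply/derivable1_diffP.
by have [df []] := fd x.
Qed.

Lemma continuous_measurable f : continuous f -> measurable_fun setT f.
Proof. by move=> cf; exact: continuous_measurable_fun. Qed.

End pointwise_derivatives.

Lemma measurable_le_set {R : realType} d (T : measurableType d) (f g : T -> R) :
  measurable_fun setT f -> measurable_fun setT g ->
  measurable [set x | f x <= g x].
Proof.
move=> mf mg; rewrite -[X in measurable X]setTI.
rewrite (_ : [set x | _] = (fun x => f x <= g x) @^-1` [set true]); last first.
  by apply/seteqP; split=> x /=.
exact: measurable_fun_ler.
Qed.

(** * Solid angles as Gaussian measures *)

Section gaussian_cone_measure.
Context {R : realType}.
Local Notation leb := (@lebesgue_measure R).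

Definition gauss (t : R) : R := expR (- t ^+ 2 / 2).

Lemma gauss_ge0 t : 0 <= gauss t. Proof. exact: expR_ge0. Qed.

Lemma der_gauss (t : R) : is_derive t 1 gauss (- t * gauss t).
Proof.
apply: der_eq (der_expR (derMr _ (derN (derX2 (der_id _))))) _.
by rewrite /gauss; field.
Qed.

Lemma continuous_gauss : continuous gauss.
Proof. by apply: der_continuous => t; eexists; exact: der_gauss. Qed.

Lemma measurable_gauss : measurable_fun setT gauss.
Proof. by apply: continuous_measurable; exact: continuous_gauss. Qed.

Lemma integral_gauss :
  (\int[leb]_t (gauss t)%:E = (Num.sqrt (2 * pi))%:E)%E.
Proof.
have s2 : Num.sqrt (2 : R) != 0 by rewrite gt_eqF // sqrtr_gt0.
(* The substitution by sqrt 2 turns [gauss] into exp(-t^2), whose integral is sqrt pi. *)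
rewrite (ge0_integral_affine 0 s2) //.
- under eq_integral => t _.
    rewrite addr0 /gauss exprMn sqr_sqrtr // -mulrN mulrC mulrA mulVf //.
    rewrite mul1r -/(gauss_fun t); over.
  rewrite integralT_gauss -EFinM; congr EFin.
  by rewrite ger0_norm ?sqrtr_ge0 // -sqrtrM.
- by apply/measurable_EFinP; exact: measurable_gauss.
- by move=> t; rewrite lee_fin gauss_ge0.
Qed.

Lemma integral_expR_tail (q : R) :
  (\int[leb]_(r in `[q, +oo[) (expR (- (r / 2)) / 2)%:E = (expR (- (q / 2)))%:E)%E.
Proof.
have dF (x : R) : is_derive x 1 (fun r : R => - expR (- (r / 2))) (expR (- (x / 2)) / 2).
  apply: der_eq (derN (der_expR (derN (derMr _ (der_id _))))) _.
  by rewrite mul1r mulrN opprK.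
have cF : continuous (fun r : R => - expR (- (r / 2))).
  by apply: der_continuous => x; eexists; exact: dF.
have cf : continuous (fun r : R => expR (- (r / 2)) / 2).
  apply: der_continuous => x; eexists.
  exact: derMr (der_expR (derN (derMr _ (der_id _)))).
rewrite (@ge0_continuous_FTC2y _ _ (fun r : R => - expR (- (r / 2))) q 0).
- by rewrite sub0e EFinN oppeK.
- by move=> x _; rewrite divr_ge0 // expR_ge0.
- exact: continuous_subspaceT.
- rewrite -oppr0; apply: cvgN.
  apply: (@cvg_comp _ _ _ (fun r : R => r / 2) (fun r => expR (- r)) _ +oo%R);
    last exact: cvgr_expR.
  exact: gt0_cvgMly.
- by move=> x _; have [] := dF x.
- by apply: cvg_at_right_filter; exact: cF.
- by move=> x _; rewrite derive1E derive_val.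
Qed.

Lemma measurable_dot n : measurable_fun setT (fun x : 'rV[R]_n => dot x x).
Proof.
apply: measurable_sum => i; apply: measurable_funM; exact: measurable_coor.
Qed.

Lemma dot_ge0 n (x : 'rV[R]_n) : 0 <= dot x x.
Proof. by apply: sumr_ge0 => i _; rewrite -expr2 sqr_ge0. Qed.

Lemma dotZZ n (a : R) (x : 'rV[R]_n) : dot (a *: x) (a *: x) = a ^+ 2 * dot x x.
Proof.
by rewrite /dot mulr_sumr; apply: eq_bigr => i _; rewrite !mxE; ring.
Qed.

(* Layer cake: [exp (- q / 2)] is the mass above [q] of an exponential variable,
   so the Gaussian measure of a cone is a mixture of the volumes of its
   intersections with balls, which scale with the radius. *)
Lemma gauss_measure_cone n : exists w : R -> R,
  [/\ measurable_fun setT w, forall r, 0 <= w r &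
   forall K : set 'rV[R]_n, measurable K ->
    (forall (a : R) x, 0 < a -> K (a *: x) <-> K x) ->
    iterint (fun x => (\1_K x * expR (- (dot x x / 2)))%:E) =
    (\int[leb]_(r in `]0%R, +oo[) (w r)%:E * vol (K `&` [set x | (dot x x <= 1)%R]))%E].
Proof.
(* [r] is a squared radius: exp(-r/2)/2 is the exponential density and [Num.sqrt r ^+ n] the
   Jacobian of the dilation from the unit ball. *)
exists (fun r => Num.sqrt r ^+ n * (expR (- (r / 2)) / 2)).
have mexp : measurable_fun setT (fun r : R => expR (- (r / 2)) / 2).
  apply: continuous_measurable; apply: der_continuous => x; eexists.
  exact: derMr (der_expR (derN (derMr _ (der_id _)))).
have msqrt : measurable_fun setT (fun r : R => Num.sqrt r).
  by apply: continuous_measurable; exact: sqrt_continuous.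
have mw : measurable_fun setT (fun r : R => Num.sqrt r ^+ n * (expR (- (r / 2)) / 2)).
  by apply: measurable_funM => //; exact: measurable_funX.
split=> // K mK coneK.
pose C := [set z : R * 'rV[R]_n | dot z.2 z.2 <= z.1].
have mC : measurable C.
  apply: measurable_le_set; last by [].
  exact: (measurableT_comp (@measurable_dot n)).
pose G (z : R * 'rV[R]_n) : \bar R := (\1_K z.2 * (\1_`]0%R, +oo[%classic z.1 *
  (\1_C z * (expR (- (z.1 / 2)) / 2))))%:E.
have mpos : measurable_fun setT (\1_`]0%R, +oo[%classic : R -> R).
  exact: measurable_indic.
have mG : measurable_fun setT G.
  apply/measurable_EFinP; apply: measurable_funM.
    by apply: (measurableT_comp (measurable_indic mK)).
  apply: measurable_funM.
    exact: (measurableT_comp mpos).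
  apply: measurable_funM; first exact: measurable_indic.
  exact: (measurableT_comp mexp).
have G0 z : (0 <= G z)%E.
  by rewrite lee_fin !mulr_ge0 ?divr_ge0 ?expR_ge0.
have CE r x : \1_C (r, x) = (dot x x <= r)%R%:R :> R.
  rewrite indicE; congr (_ : bool)%:R; apply/idP/idP => [/set_mem//|rx].
  exact/mem_set.
have mem_pos (r : R) : (r \in `]0%R, +oo[%classic) = (0 < r).
  by apply/idP/idP; rewrite in_setE /= in_itv /= andbT.
have GE r x : G (r, x) =
    (\1_K x * ((0 < r)%R%:R * ((dot x x <= r)%R%:R * (expR (- (r / 2)) / 2))))%:E.
  by rewrite /G /= CE; congr (_ * (_ * _))%:E; rewrite indicE mem_pos.
transitivity (iterint (fun x => \int[leb]_r G (r, x))%E).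
  apply: eq_iterint => x; rewrite EFinM -integral_expR_tail.
  rewrite -ge0_integralZl_EFin //; last first.
    by apply/measurable_funTS/measurable_EFinP.
  rewrite [RHS](_ : _ = \int[leb]_r
      ((fun r => G (r, x)) \_ `]0%R, +oo[%classic) r)%E; last first.
    apply: eq_integral => r _; rewrite patchE; case: ifPn => //.
    by rewrite mem_pos GE => /negbTE ->; rewrite mul0r mulr0.
  rewrite -integral_mkcond.
  have [q0|] := ltP 0 (dot x x).
    rewrite [LHS]integral_mkcond [RHS]integral_mkcond.
    apply: eq_integral => r _; rewrite !patchE GE mem_pos.
    have -> : (r \in `[dot x x, +oo[%classic) = (dot x x <= r).
      by apply/idP/idP; rewrite in_setE /= in_itv /= andbT.
    case: ifPn => qr.
      by rewrite (lt_le_trans q0 qr) !mul1r EFinM.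
    by rewrite !mul0r !mulr0; case: ifP.
  (* At x = 0 the tail is the closed half-line, while the mixture runs over r > 0 so that dilations
     are invertible; one point has measure 0. *)
  rewrite le_eqVlt ltNge dot_ge0 orbF => /eqP q0; rewrite q0.
  rewrite -integral_itv_obnd_cbnd; last first.
    by apply/measurable_funTS/measurable_EFinP/measurable_funM.
  apply: eq_integral => r; rewrite mem_pos GE q0 => r0.
  by rewrite r0 ltW // !mul1r EFinM.
rewrite iterint_integral // -ge0_integralZr //; first last.
- by rewrite vol_iterint; apply: iterint_ge0 => x; rewrite lee_fin.
- by apply: measurable_funTS; exact/measurable_EFinP.
rewrite [RHS]integral_mkcond; apply: eq_integral => r _; rewrite patchE.
rewrite mem_pos; case: ifPn => [r0|/negbTE r0].
  rewrite (@iterint_scale _ _ (Num.sqrt r)) //; first last.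
  - apply: (measurableT_comp mG); exact: measurable_fun_pair.
  - by rewrite gt_eqF // sqrtr_gt0.
  rewrite ger0_norm ?exprn_ge0 ?sqrtr_ge0 // vol_iterint EFinM -muleA; congr (_ * _)%E.
  rewrite -iterintZl ?divr_ge0 ?expR_ge0 //; last first.
    apply/measurable_EFinP; apply: measurable_indic; apply: measurableI => //.
    apply: measurable_le_set => //; exact: measurable_dot.
  apply: eq_iterint => x; rewrite -EFinM GE; congr EFin.
  have -> : (dot (Num.sqrt r *: x) (Num.sqrt r *: x) <= r)%R = (dot x x <= 1)%R.
    by rewrite dotZZ (sqr_sqrtr (ltW r0)) ger_pMr.
  rewrite r0 mul1r indicI /= !indicE.
  have -> : (Num.sqrt r *: x \in K) = (x \in K).
    by apply/idP/idP => /set_mem Kx; apply/mem_set;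
      apply/(@coneK (Num.sqrt r)); rewrite ?sqrtr_gt0.
  have -> : (x \in [set x | dot x x <= 1]) = (dot x x <= 1).
    by apply/idP/idP; rewrite in_setE.
  by ring.
rewrite (eq_iterint (g := fun=> 0%E)); last first.
  by move=> x; rewrite GE r0 mul0r mulr0.
rewrite (_ : (fun=> 0%E) = (fun x : 'rV[R]_n => 0%:E * 0)%E); last first.
  by apply/funext => x; rewrite mul0e.
by rewrite iterintZl // mul0e.
Qed.

End gaussian_cone_measure.

(** * Gaussian weights on orthants and their masses *)

Section orthant_weights.
Context {R : realType}.
Local Notation leb := (@lebesgue_measure R).

(* Gaussian density with precision matrix [1 + c J], [J] the all-ones matrix,
   times [chi] in every coordinate; the shift [b] makes the recursion on the
   dimension go through. *)
Definition wgt (chi : R -> R) (c b : R) n (s : 'rV[R]_n) : R :=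
  (\prod_(i < n) (chi (s 0 i) * gauss (s 0 i)))
  * expR (- (c * (b + \sum_(i < n) s 0 i) ^+ 2 / 2)).

Definition wgt_mass (chi : R -> R) (c : R) n (b : R) : \bar R :=
  iterint (fun s : 'rV[R]_n => (wgt chi c b s)%:E).

Lemma row_cons0 n (t : R) (v : 'rV[R]_n) :
  (row_mx (t%:M : 'rV_1) v : 'rV_n.+1) 0 ord0 = t.
Proof.
rewrite (_ : ord0 = lshift n (0 : 'I_1)); last exact/val_inj.
by rewrite [LHS](@row_mxEl R 1 1 n) mxE eqxx.
Qed.

Lemma row_consS n (t : R) (v : 'rV[R]_n) (i : 'I_n) :
  (row_mx (t%:M : 'rV_1) v : 'rV_n.+1) 0 (lift ord0 i) = v 0 i.
Proof.
rewrite (_ : lift ord0 i = rshift 1 i); last exact/val_inj.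
by rewrite [LHS](@row_mxEr R 1 1 n).
Qed.

(** As [chi] it confines every coordinate to the orthant and yields the numerator of an angle; the
    constant 1 yields the denominator. *)
Definition half_line (t : R) : R := (0 <= t)%R%:R.

Lemma measurable_half_line : measurable_fun setT half_line.
Proof.
rewrite (_ : half_line = \1_[set t : R | 0 <= t]); last first.
  apply/funext => t; rewrite indicE /half_line; congr (_ : bool)%:R.
  by apply/idP/idP => [t0|/set_mem//]; exact/mem_set.
by apply: measurable_indic; apply: measurable_le_set.
Qed.

Lemma half_line_ge0 t : 0 <= half_line t. Proof. exact: ler0n. Qed.

Lemma half_line_le1 t : half_line t <= 1.
Proof. by rewrite /half_line lern1 leq_b1. Qed.

Section fixed_chi.
Variables (chi : R -> R) (c : R).
Hypotheses (mchi : measurable_fun setT chi) (chi0 : forall t, 0 <= chi t).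

Lemma wgt_ge0 b n (s : 'rV[R]_n) : 0 <= wgt chi c b s.
Proof.
rewrite mulr_ge0 ?expR_ge0 // prodr_ge0 // => i _.
by rewrite mulr_ge0 // gauss_ge0.
Qed.

Lemma measurable_wgt d (T : measurableType d) n (b : T -> R)
    (s : T -> 'rV[R]_n) :
  measurable_fun setT b -> measurable_fun setT s ->
  measurable_fun setT (fun x => wgt chi c (b x) (s x)).
Proof.
move=> mb /measurable_rowP ms; apply: measurable_funM.
  apply: measurable_prod => i _; apply: measurable_funM.
    exact: (measurableT_comp mchi (ms i)).
  exact: (measurableT_comp measurable_gauss (ms i)).
apply: (measurableT_comp (@measurable_expR R)).
apply: measurable_funN; apply: measurable_funM => //.
apply: measurable_funM => //; apply: measurable_funX.
by apply: measurable_funD => //; exact: measurable_sum.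
Qed.

Lemma wgt_cons b n (t : R) (v : 'rV[R]_n) :
  wgt chi c b (row_mx (t%:M : 'rV_1) v : 'rV_n.+1) =
  chi t * gauss t * wgt chi c (b + t) v.
Proof.
rewrite /wgt !big_ord_recl.
rewrite (eq_bigr (fun i => chi (v 0 i) * gauss (v 0 i))); last first.
  by move=> i _; rewrite row_consS.
rewrite [\sum_i _](eq_bigr (fun i => v 0 i)); last by move=> i _; rewrite row_consS.
by rewrite row_cons0 addrA !mulrA.
Qed.

Lemma wgt_mass0 b : wgt_mass chi c 0 b = (expR (- (c * b ^+ 2 / 2)))%:E.
Proof. by rewrite /wgt_mass /= /wgt !big_ord0 mul1r addr0. Qed.

Lemma wgt_massS n b : wgt_mass chi c n.+1 b =
  (\int[leb]_t ((chi t * gauss t)%:E * wgt_mass chi c n (b + t)))%E.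
Proof.
rewrite /wgt_mass iterintS; apply: eq_integral => t _.
rewrite -iterintZl ?mulr_ge0 ?gauss_ge0 //; first last.
- by move=> x; rewrite lee_fin wgt_ge0.
- by apply/measurable_EFinP; exact: measurable_wgt.
by apply: eq_iterint => v; rewrite wgt_cons EFinM.
Qed.

End fixed_chi.

Lemma total_mass n b : wgt_mass (fun=> 1) 0 n b = (Num.sqrt (2 * pi) ^+ n)%:E.
Proof.
elim: n b => [|n IH] b; first by rewrite wgt_mass0 !mul0r oppr0 expR0.
rewrite wgt_massS //; under eq_integral do rewrite IH mul1r.
rewrite ge0_integralZr //.
- by rewrite integral_gauss -EFinM exprS.
- by apply/measurable_EFinP; exact: measurable_gauss.
- by move=> t _; rewrite lee_fin gauss_ge0.
Qed.

Lemma iterint_gauss n :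
  iterint (fun x : 'rV[R]_n => (expR (- (dot x x / 2)))%:E) =
  (Num.sqrt (2 * pi) ^+ n)%:E.
Proof.
rewrite -(total_mass n 0); apply: eq_iterint => x; congr EFin.
rewrite /wgt !mul0r oppr0 expR0 mulr1 /gauss /dot.
under [RHS]eq_bigr do rewrite mul1r.
rewrite -expR_sum; congr expR.
by rewrite mulr_suml -sumrN; apply: eq_bigr => i _; rewrite expr2 mulNr.
Qed.

(** Integrates out the lineality space, which contributes the same factor to the mass of the cone
    and to that of the whole space; hence angles do not depend on [l]. *)
Lemma iterint_peel l m (h : 'rV[R]_m -> \bar R) :
  measurable_fun setT h -> (forall x, 0 <= h x)%E ->
  iterint (fun x : 'rV[R]_(l + m) =>
    (expR (- (dot (lsubmx x) (lsubmx x) / 2)))%:E * h (rsubmx x))%E =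
  ((Num.sqrt (2 * pi) ^+ l)%:E * iterint h)%E.
Proof.
move=> mh h0; elim: l => [|l IH].
  rewrite mul1e; apply: eq_iterint => x.
  rewrite /dot big_ord0 mul0r oppr0 expR0 mul1e; congr h.
  by apply/matrixP => i j; rewrite !mxE ord1; congr (x _ _); exact/val_inj.
have mF : measurable_fun setT (fun x : 'rV[R]_(l + m) =>
    (expR (- (dot (lsubmx x) (lsubmx x) / 2)))%:E * h (rsubmx x))%E.
  apply: emeasurable_funM.
    apply/measurable_EFinP; apply: (measurableT_comp (@measurable_expR R)).
    apply: measurable_funN; apply: measurable_funM => //.
    apply: measurable_sum => i; apply: measurable_funM;
      under eq_fun do rewrite mxE; exact: measurable_coor.
  by apply: (measurableT_comp mh); exact: measurable_rsubmx.
transitivity (\int[leb]_t ((gauss t)%:E * ((Num.sqrt (2 * pi) ^+ l)%:E * iterint h)))%E.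
  rewrite [LHS]/iterint -/iterint; apply: eq_integral => t _.
  rewrite -IH -iterintZl ?gauss_ge0 //; last first.
    by move=> x; rewrite mule_ge0 // lee_fin expR_ge0.
  apply: eq_iterint => v.
  have rE (X : 'rV[R]_(l.+1 + m)) k : rsubmx X 0 k = X 0 (rshift l.+1 k).
    by rewrite mxE.
  have lE (X : 'rV[R]_(l.+1 + m)) k : lsubmx X 0 k = X 0 (lshift m k).
    by rewrite mxE.
  have hr : @rsubmx R 1 l.+1 m (row_mx (t%:M : 'rV_1) v) = rsubmx v.
    apply/matrixP => i j; rewrite !ord1 rE [RHS]mxE.
    rewrite (_ : rshift l.+1 j = lift ord0 (rshift l j)); last exact/val_inj.
    by rewrite [LHS]row_consS.
  have hl : dot (@lsubmx R 1 l.+1 m (row_mx (t%:M : 'rV_1) v))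
      (@lsubmx R 1 l.+1 m (row_mx (t%:M : 'rV_1) v)) = t ^+ 2 + dot (lsubmx v) (lsubmx v).
    rewrite /dot big_ord_recl lE; congr (_ + _).
      rewrite (_ : lshift m ord0 = ord0); last exact/val_inj.
      by rewrite [X in X * X]row_cons0 expr2.
    apply: eq_bigr => i _; rewrite lE [lsubmx v 0 i]mxE.
    rewrite (_ : lshift m (lift ord0 i) = lift ord0 (lshift m i)); last exact/val_inj.
    by rewrite [X in X * X = _]row_consS.
  rewrite hr hl muleA -EFinM /gauss -expRD; congr ((expR _)%:E * _)%E.
  by rewrite mulrDl opprD mulNr.
rewrite ge0_integralZr //.
- by rewrite integral_gauss muleA -EFinM exprS.
- by apply/measurable_EFinP; exact: measurable_gauss.
- by move=> t _; rewrite lee_fin gauss_ge0.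
- by rewrite mule_ge0 ?iterint_ge0 // lee_fin exprn_ge0 // sqrtr_ge0.
Qed.

End orthant_weights.

(** * Ratios of volumes as ratios of masses *)

Section angle_of_simplicial_cone.
Context {R : realType}.
Local Notation leb := (@lebesgue_measure R).

(** Finiteness of the volume of the unit ball is read off the Gaussian mass through this lemma, so
    that the volume itself is never computed. *)
Lemma ge0_fin_factor (x y : \bar R) (r : R) : (0 <= x)%E -> (0 <= y)%E ->
  (x * y = r%:E)%E -> 0 < r -> exists2 x' : R, x = x'%:E & 0 < x'.
Proof.
case: x => [x| |] // x0 y0 xy r0.
  exists x => //; rewrite lt_neqAle -lee_fin x0 andbT; apply/eqP => x_eq0.
  by move: xy; rewrite -x_eq0 mul0e => -[r_eq0]; rewrite -r_eq0 ltxx in r0.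
have [y_eq0|y_neq0] := eqVneq y 0%E.
  by move: xy; rewrite y_eq0 mule0 => -[r_eq0]; rewrite -r_eq0 ltxx in r0.
by move: xy; rewrite gt0_mulye // lt_neqAle eq_sym y_neq0.
Qed.

Lemma dotE n (x y : 'rV[R]_n) : dot x y = (x *m y^T) 0 0.
Proof. by rewrite mxE; apply: eq_bigr => i _; rewrite mxE. Qed.

Lemma mul_const_mx m (c : R) (s : 'rV[R]_m) :
  (s *m const_mx c *m s^T) 0 0 = c * (\sum_i s 0 i) ^+ 2.
Proof.
rewrite mxE expr2 mulrA mulr_sumr; apply: eq_bigr => j _.
rewrite !mxE mulr_sumr; congr (_ * _).
by apply: eq_bigr => i _; rewrite mxE mulrC.
Qed.

Lemma dot_gram l m (c : R) (W : 'M[R]_(l + m)) (s : 'rV[R]_(l + m)) :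
  W *m W^T = block_mx 1%:M 0 0 (1%:M + const_mx c) ->
  dot (s *m W) (s *m W) =
  dot (lsubmx s) (lsubmx s) +
  (dot (rsubmx s) (rsubmx s) + c * (\sum_i rsubmx s 0 i) ^+ 2).
Proof.
move=> gramW; rewrite dotE trmx_mul mulmxA -[s *m W *m _]mulmxA gramW.
rewrite -{1 2}[s]hsubmxK mul_row_block tr_row_mx mul_row_col.
rewrite !mulmx0 addr0 add0r mulmx1 mulmxDr mulmx1 mulmxDl !mxE.
by rewrite -mul_const_mx !dotE !mxE.
Qed.

Definition halfspaces l m : set 'rV[R]_(l + m) :=
  [set s | forall j, 0 <= rsubmx s 0 j].

Lemma indic_halfspaces l m (s : 'rV[R]_(l + m)) :
  \1_(@halfspaces l m) s = \prod_(i < m) half_line (rsubmx s 0 i).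
Proof.
rewrite indicE; case: (boolP (s \in _)) => [/set_mem/= hs|].
  by rewrite big1 // => i _; rewrite /half_line hs.
rewrite notin_setE /halfspaces /= => /existsNP[j /negP hj].
by rewrite (bigD1 j) //= /half_line (negbTE hj) mul0r.
Qed.

Lemma measurable_halfspaces l m : measurable (@halfspaces l m).
Proof.
apply/(@measurable_indicP _ _ R).
rewrite (_ : \1__ = fun s => \prod_(i < m) half_line (rsubmx s 0 i)); last first.
  by apply/funext => s; exact: indic_halfspaces.
apply: measurable_prod => i _; apply: (measurableT_comp measurable_half_line).
exact: (measurableT_comp (@measurable_coor _ _ i) (@measurable_rsubmx _ l m)).
Qed.

(** The layer cake writes both Gaussian masses as one common factor times a volume, so volumes and
    masses have equal ratios. Pulled back along [W] the masses become those of [wgt]; the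
    determinant and the factor from the [l] free coordinates cancel. *)
Lemma solid_angle_gauss l m (c : R) (W : 'M[R]_(l + m)) (a b : R) :
  W \in unitmx -> W *m W^T = block_mx 1%:M 0 0 (1%:M + const_mx c) ->
  wgt_mass half_line c m 0 = a%:E -> wgt_mass (fun=> 1) c m 0 = b%:E ->
  fine (vol ([set t | @halfspaces l m (t *m invmx W)] `&` [set t | dot t t <= 1])) /
  fine (vol [set t : 'rV[R]_(l + m) | dot t t <= 1]) = a / b.
Proof.
move=> uW gramW ma mb.
set K := [set t | _]; set B := [set t | _].
have mK : measurable K.
  rewrite -[K]setTI; apply: (measurable_mulmx (invmx W)) => //.
  exact: measurable_halfspaces.
have coneK (r : R) x : 0 < r -> K (r *: x) <-> K x.
  move=> r0; rewrite /K /halfspaces /=; split=> hx j; move: (hx j);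
    by rewrite -scalemxAl !mxE pmulr_rge0.
have [w [mw w0 /[dup]/(_ K mK coneK)]] := @gauss_measure_cone R (l + m).
set cw := (\int[leb]_(r in _) _)%E => volK.
move=> /(_ setT measurableT (fun _ _ _ => iff_refl _)); rewrite setTI -/B -/cw => volB.
pose detW : R := `|\det W|; pose s2pi : R := Num.sqrt (2 * pi : R).
have s2pi0 : 0 < s2pi by rewrite sqrtr_gt0 mulr_gt0 // pi_gt0.
have detW0 : 0 < detW by rewrite normr_gt0 -unitfE -unitmxE.
have change (chi : R -> R) (chi0 : forall t, 0 <= chi t) (mchi : measurable_fun setT chi)
  (A : set 'rV[R]_(l + m)) :
    measurable A -> (forall s, \1_A (s *m W) = \prod_(i < m) chi (rsubmx s 0 i)) ->
    iterint (fun x => (\1_A x * expR (- (dot x x / 2)))%:E) =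
    (detW%:E * ((s2pi ^+ l)%:E * wgt_mass chi c m 0))%E.
  move=> mA Achi; rewrite (unitmx_change_of_variables uW); first last.
  - by move=> x; rewrite lee_fin mulr_ge0 // expR_ge0.
  - apply/measurable_EFinP; apply: measurable_funM; first exact: measurable_indic.
    apply: (measurableT_comp (@measurable_expR R)); apply: measurable_funN.
    by apply: measurable_funM => //; exact: measurable_dot.
  congr (_ * _)%E; rewrite /wgt_mass -iterint_peel; first last.
  - by move=> x; rewrite lee_fin wgt_ge0.
  - by apply/measurable_EFinP; exact: measurable_wgt.
  apply: eq_iterint => s; rewrite Achi -EFinM (dot_gram _ gramW); congr EFin.
  rewrite /wgt big_split /= -!mulrA [RHS]mulrCA; congr (_ * _).
  rewrite add0r /gauss -expR_sum -!expRD; congr expR.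
  rewrite -mulr_suml sumrN.
  rewrite (_ : \sum_i rsubmx s 0 i ^+ 2 = dot (rsubmx s) (rsubmx s)) //.
  by field.
have IK : (cw * vol (K `&` B) = (detW * (s2pi ^+ l * a))%:E)%E.
  rewrite -volK (change half_line) //.
  - by rewrite ma -!EFinM.
  - exact: measurable_half_line.
  - by move=> s; rewrite -indic_halfspaces !indicE; congr (_ : bool)%:R;
      apply/idP/idP => /set_mem sK; apply/mem_set; move: sK; rewrite /K /= mulmxK.
have IB : (cw * vol B = (detW * (s2pi ^+ l * b))%:E)%E.
  rewrite -volB (change (fun=> 1)) //.
  - by rewrite mb -!EFinM.
  - by move=> s; rewrite indicE mem_setT big1.
(* The mass of the whole space computed a second time, without [W]; the comparison yields
   [0 < b]. *)
have IB' : (cw * vol B = (s2pi ^+ (l + m))%:E)%E.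
  by rewrite -volB -iterint_gauss; apply: eq_iterint => x; rewrite indicE mem_setT mul1r.
have b0 : 0 < b.
  have : 0 < detW * (s2pi ^+ l * b).
    by move: IB; rewrite IB' => -[<-]; rewrite exprn_gt0.
  by rewrite pmulr_rgt0 // pmulr_rgt0 // exprn_gt0.
have cw0 : (0 <= cw)%E by apply: integral_ge0 => r _; rewrite lee_fin.
have vB0 : (0 <= vol B)%E.
  by rewrite vol_iterint; apply: iterint_ge0 => x; rewrite lee_fin.
have vK0 : (0 <= vol (K `&` B))%E.
  by rewrite vol_iterint; apply: iterint_ge0 => x; rewrite lee_fin.
have D0 : 0 < detW * s2pi ^+ l by rewrite mulr_gt0 // exprn_gt0.
have Db0 : 0 < detW * (s2pi ^+ l * b) by rewrite mulrA mulr_gt0.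
have [c' cwE c'0] := ge0_fin_factor cw0 vB0 IB Db0.
have [vB vBE _] : exists2 v : R, vol B = v%:E & 0 < v.
  by apply: (ge0_fin_factor vB0 cw0 _ Db0); rewrite muleC.
move: IK IB; rewrite cwE vBE.
case: (vol (K `&` B)) vK0 => [vK| |] // _; last by rewrite gt0_muley ?lte_fin.
move=> [IK] [IB] /=.
have c'n : c' != 0 by rewrite gt_eqF.
have -> : vK = detW * (s2pi ^+ l * a) / c' by rewrite -IK mulrC mulKf.
have -> : vB = detW * (s2pi ^+ l * b) / c' by rewrite -IB mulrC mulKf.
have dn : detW != 0 by rewrite gt_eqF.
have sn : s2pi ^+ l != 0 by rewrite gt_eqF ?exprn_gt0.
have bn : b != 0 by rewrite gt_eqF.
by field; rewrite c'n bn dn sn.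
Qed.

End angle_of_simplicial_cone.

(** * Gaussian transforms and Phi *)

Section real_gaussian_trick.
Context {R : realType}.
Local Notation leb := (@lebesgue_measure R).
Local Notation s2pi := (Num.sqrt (2 * pi) : R).

Lemma gaussN (t : R) : gauss (- t) = gauss t.
Proof. by rewrite /gauss sqrrN. Qed.

Lemma s2pi_gt0 : 0 < s2pi.
Proof. by rewrite sqrtr_gt0 mulr_gt0 // pi_gt0. Qed.

Lemma gauss_expR (a t : R) : gauss t * expR (a * t) = expR (a ^+ 2 / 2) * gauss (t - a).
Proof. by rewrite /gauss -!expRD; congr expR; field. Qed.

Lemma integral_gauss_expR (a : R) :
  (\int[leb]_t (gauss t * expR (a * t))%:E = (s2pi * expR (a ^+ 2 / 2))%:E)%E.
Proof.
under eq_integral do rewrite gauss_expR EFinM.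
rewrite ge0_integralZl_EFin ?expR_ge0 //; first last.
- apply/measurable_EFinP; apply: (measurableT_comp measurable_gauss).
  exact: measurable_funD.
- by move=> t _; rewrite lee_fin gauss_ge0.
rewrite [s2pi * _]mulrC [RHS]EFinM; congr (_ * _)%E.
have m1 : measurable_fun setT (fun t : R => (gauss t)%:E).
  by apply/measurable_EFinP; exact: measurable_gauss.
rewrite -integral_gauss (ge0_integral_affine (- a) (@oner_neq0 R) m1); last first.
  by move=> t; rewrite lee_fin gauss_ge0.
by rewrite normr1 mul1e; apply: eq_integral => t _; rewrite mul1r.
Qed.

Lemma integrable_gauss : leb.-integrable setT (EFin \o gauss).
Proof.
apply/integrableP; split.
  by apply/measurable_EFinP; exact: measurable_gauss.
under eq_integral do rewrite /= ger0_norm ?gauss_ge0 //.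
by rewrite integral_gauss ltry.
Qed.

Lemma integrable_gauss_bound (f : R -> R) (c : R) : measurable_fun setT f ->
  (forall t, `|f t| <= c * gauss t) -> leb.-integrable setT (EFin \o f).
Proof.
move=> mf fc; have := integrableZl measurableT c integrable_gauss.
apply: le_integrable => //; first exact/measurable_EFinP.
by move=> t _ /=; rewrite lee_fin (le_trans (fc t)) // ler_norm.
Qed.

Variables (chi : R -> R) (k : R) (Z : R -> R).
Hypotheses (mchi : measurable_fun setT chi) (chi0 : forall t, 0 <= chi t).
Hypothesis mZ : measurable_fun setT Z.
Hypothesis ZE : forall y,
  (\int[leb]_t (chi t * gauss t * expR (k * y * t))%:E = (Z y)%:E)%E.

(* [exp (k^2 S^2 / 2)] is the Laplace transform of a standard Gaussian variable,
   which makes the coordinates independent. *)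
Lemma wgt_mass_neg n (b : R) :
  (s2pi%:E * wgt_mass chi (- k ^+ 2) n b =
   \int[leb]_y (gauss y * expR (k * y * b) * Z y ^+ n)%:E)%E.
Proof.
have cg0 t : 0 <= chi t * gauss t := mulr_ge0 (chi0 t) (gauss_ge0 t).
have cge0 y t : 0 <= chi t * gauss t * expR (k * y * t).
  exact: mulr_ge0 (cg0 t) (expR_ge0 _).
have Z0 y : 0 <= Z y.
  rewrite -lee_fin -ZE; apply: integral_ge0 => t _.
  by rewrite lee_fin; exact: cge0.
have gZ0 y u j : 0 <= gauss y * expR u * Z y ^+ j.
  exact: mulr_ge0 (mulr_ge0 (gauss_ge0 y) (expR_ge0 u)) (exprn_ge0 j (Z0 y)).
have mexp (c : R) : measurable_fun setT (fun y : R => expR (c * y)).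
  by apply: (measurableT_comp (@measurable_expR R)); exact: measurable_funM.
elim: n b => [|n IH] b.
  under eq_integral do rewrite mulr1 -mulrA [_ * b]mulrC mulrA.
  rewrite integral_gauss_expR wgt_mass0 -EFinM; congr (_ * expR _)%:E.
  by field.
rewrite wgt_massS //.
have mm : measurable_fun setT (fun t => (chi t * gauss t)%:E * wgt_mass chi (- k ^+ 2) n (b + t))%E.
  apply: emeasurable_funM.
    by apply/measurable_EFinP; apply: measurable_funM => //; exact: measurable_gauss.
  apply: (measurable_iterint (F := fun z : R * 'rV[R]_n => (wgt chi (- k ^+ 2) (b + z.1) z.2)%:E)).
    apply/measurable_EFinP; apply: measurable_wgt => //.
    exact: measurable_funD.
  by move=> z; rewrite lee_fin wgt_ge0.
rewrite -ge0_integralZl_EFin ?sqrtr_ge0 //; last first.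
  move=> t _; rewrite mule_ge0 ?lee_fin ?cg0 //.
  by apply: iterint_ge0 => s; rewrite lee_fin wgt_ge0.
pose H (z : R * R) := (chi z.1 * gauss z.1 *
  (gauss z.2 * expR (k * z.2 * (b + z.1)) * Z z.2 ^+ n))%:E.
have H0 z : (0 <= H z)%E by rewrite lee_fin mulr_ge0 ?cg0 ?gZ0.
have mgZ d (T : measurableType d) (f g : T -> R) :
    measurable_fun setT f -> measurable_fun setT g ->
    measurable_fun setT (fun z => gauss (g z) * expR (k * g z * f z) * Z (g z) ^+ n).
  move=> mf mg; apply: measurable_funM; last first.
    by apply: measurable_funX; exact: (measurableT_comp mZ).
  apply: measurable_funM; first exact: (measurableT_comp measurable_gauss).
  apply: (measurableT_comp (@measurable_expR R)).
  by apply: measurable_funM => //; exact: measurable_funM.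
have mH : measurable_fun setT H.
  apply/measurable_EFinP; apply: measurable_funM.
    apply: measurable_funM; first exact: (measurableT_comp mchi).
    exact: (measurableT_comp measurable_gauss).
  by apply: mgZ => //; exact: measurable_funD.
transitivity (\int[leb]_t \int[leb]_y H (t, y))%E.
  apply: eq_integral => t _.
  rewrite muleCA IH -ge0_integralZl_EFin ?cg0 //.
  - by move=> y _; rewrite lee_fin gZ0.
  - apply/measurable_EFinP.
    exact: mgZ.
transitivity (\int[leb]_y \int[leb]_t H (t, y))%E.
  exact: (@fubini_tonelli _ _ (measurableTypeR R) (measurableTypeR R) R leb leb H).
apply: eq_integral => y _.
(* For fixed y the factor exp(k y (b + t)) splits, and the integral over t supplies one more
   [Z y]. *)
transitivity (\int[leb]_t ((gauss y * expR (k * y * b) * Z y ^+ n)%:E *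
   (chi t * gauss t * expR (k * y * t))%:E))%E.
  apply: eq_integral => t _; rewrite /H /= -EFinM; congr EFin.
  by rewrite mulrDr expRD; ring.
rewrite ge0_integralZl_EFin ?gZ0 //.
- by rewrite ZE -EFinM exprSr !mulrA.
- by move=> t _; rewrite lee_fin cge0.
- apply/measurable_EFinP; apply: measurable_funM; last exact: mexp.
  by apply: measurable_funM => //; exact: measurable_gauss.
Qed.
End real_gaussian_trick.

(** * Gaussian transforms on the half-line *)

Section half_line_transforms.
Context {R : realType}.
Local Notation leb := (@lebesgue_measure R).
Local Notation s2pi := (Num.sqrt (2 * pi) : R).
Local Notation hline := (`[0%R, +oo[%classic : set R).

Let mH : measurable (hline : set (measurableTypeR R)).
Proof. exact: measurable_itv. Qed.

Lemma mem_hline (t : R) : (t \in hline) = (0 <= t).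
Proof. by apply/idP/idP; rewrite in_setE /= in_itv /= andbT. Qed.

Lemma der_expRN (t : R) : is_derive t 1 (fun t : R => - expR (- t)) (expR (- t)).
Proof.
by apply: der_eq (derN (der_expR (derN (der_id _)))) _; rewrite mulrN1 opprK.
Qed.

Lemma continuous_expRN : continuous (fun t : R => expR (- t)).
Proof.
by apply: der_continuous => x; eexists; exact: der_expR (derN (der_id _)).
Qed.

Lemma integral_expRN : (\int[leb]_(t in hline) (expR (- t))%:E = 1)%E.
Proof.
rewrite (@ge0_continuous_FTC2y _ _ (fun t : R => - expR (- t)) 0 0).
- by rewrite oppr0 expR0 sub0e EFinN oppeK.
- by move=> x _; exact: expR_ge0.
- by apply: continuous_subspaceT; exact: continuous_expRN.
- by rewrite -oppr0; apply: cvgN; exact: cvgr_expR.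
- by move=> x _; have [] := der_expRN x.
- by apply: cvg_at_right_filter; apply: cvgN; exact: continuous_expRN.
- by move=> x _; rewrite derive1E; have [_ ->] := der_expRN x.
Qed.

Lemma integrable_expRN1 :
  leb.-integrable hline (EFin \o (fun t : R => expR (- t))).
Proof.
apply/integrableP; split.
  apply/measurable_EFinP/measurable_funTS; apply: continuous_measurable.
  exact: continuous_expRN.
under eq_integral do rewrite /= ger0_norm ?expR_ge0 //.
by rewrite integral_expRN ltry.
Qed.

Lemma integrable_expRN (c : R) :
  leb.-integrable hline (EFin \o (fun t : R => c * expR (- t))).
Proof. by have i := integrable_expRN1; apply: (integrableZl _ c i). Qed.

Lemma integrable_hline_bound (f : R -> R) (c : R) : measurable_fun setT f ->
  (forall t, 0 <= t -> `|f t| <= c * expR (- t)) ->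
  leb.-integrable hline (EFin \o f).
Proof.
move=> mf fc; apply: le_integrable (integrable_expRN c) => //.
  by apply/measurable_funTS/measurable_EFinP.
move=> t /=; rewrite in_itv /= andbT => t0.
by rewrite lee_fin (le_trans (fc t t0)) // ler_norm.
Qed.

(* Adding a multiple of [exp (- t)] makes [f] nonnegative, the only case of the
   fundamental theorem on a half-line that the library covers. *)
Lemma integral_hline_derivative (F f : R -> R) (c : R) :
  (forall t : R, is_derive t 1 F (f t)) -> continuous f ->
  F t @[t --> +oo] --> (0 : R) ->
  (forall t, 0 <= t -> `|f t| <= c * expR (- t)) ->
  \int[leb]_(t in hline) f t = - F 0.
Proof.
move=> dF cf F0 fc.
have dG (t : R) : is_derive t 1 (fun t => F t + c * - expR (- t)) (f t + c * expR (- t)).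
  exact: derD (dF t) (derMl c (der_expRN t)).
have cF : continuous F by apply: der_continuous => t; exists (f t).
have mf := continuous_measurable cf.
have iF : leb.-integrable hline (EFin \o f) by exact: integrable_hline_bound fc.
have : (\int[leb]_(t in hline) (f t + c * expR (- t))%:E = (- F 0 + c)%:E)%E.
  rewrite (@ge0_continuous_FTC2y _ _ (fun t => F t + c * - expR (- t)) 0 0).
  - by rewrite oppr0 expR0 sub0e -EFinN; congr EFin; ring.
  - move=> x x0; have := fc x x0; rewrite ler_norml => /andP[+ _].
    by rewrite -subr_ge0 opprK.
  - apply: continuous_subspaceT => x; apply: cvgD; first exact: cf.
    by apply: cvgM; [exact: cvg_cst|exact: continuous_expRN].
  - rewrite (_ : 0 = 0 + c * - 0); last by rewrite oppr0 mulr0 addr0.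
    apply: cvgD => //; apply: cvgM; first exact: cvg_cst.
    by apply: cvgN; exact: cvgr_expR.
  - by move=> x _; have [] := dG x.
  - apply: cvg_at_right_filter; apply: cvgD; first exact: cF.
    by apply: cvgM; [exact: cvg_cst|apply: cvgN; exact: continuous_expRN].
  - by move=> x _; rewrite derive1E; have [_ ->] := dG x.
have iE := integrable_expRN c.
have i1 := integrable_expRN1.
move=> /(congr1 fine) /=; rewrite -/(Rintegral _ _ _) RintegralD // RintegralZl //.
by rewrite [X in _ + _ * X = _](_ : _ = 1) ?mulr1 => [/addIr//|]; rewrite /Rintegral integral_expRN.
Qed.

Lemma cvg0_expRN_bound (F : R -> R) (c : R) :
  (forall t, 0 <= t -> `|F t| <= c * expR (- t)) -> F t @[t --> +oo] --> (0 : R).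
Proof.
move=> Fc.
have ce : c * expR (- t) @[t --> +oo] --> (0 : R).
  by rewrite -(mulr0 c); apply: cvgM; [exact: cvg_cst|exact: cvgr_expR].
apply: (@squeeze_cvgr _ _ _ _ (fun t => - (c * expR (- t))) (fun t => c * expR (- t))) => //.
- near=> t; have t0 : 0 <= t by near: t; exact: nbhs_pinfty_ge.
  by rewrite -ler_norml Fc.
- by rewrite -oppr0; exact: cvgN.
Unshelve. all: by end_near. Qed.

(** Completing the square with slope [b + 1] leaves a spare factor exp(-t); multiples of exp(-t)
    dominate the half-line integrands below. *)
Lemma gauss_expR_bound (b t : R) :
  gauss t * expR (b * t) <= expR ((b + 1) ^+ 2 / 2) * expR (- t).
Proof.
rewrite /gauss -!expRD ler_expR -subr_ge0.
rewrite (_ : _ - _ = (t - (b + 1)) ^+ 2 / 2); last by field.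
by rewrite divr_ge0 // sqr_ge0.
Qed.

Lemma le_expR_self (t : R) : t <= expR t.
Proof. by apply: le_trans (expR_ge1Dx t); rewrite lerDr ler01. Qed.

Section transform.
Variables h g h2 : R -> R.
Hypotheses (dh : forall x : R, is_derive x 1 h (g x)) (dg : forall x : R, is_derive x 1 g (h2 x)).
Hypothesis ch2 : continuous h2.
Hypotheses (hb : forall x, `|h x| <= expR `|x|) (gb : forall x, `|g x| <= expR `|x|).
Hypothesis h2b : forall x, `|h2 x| <= expR `|x|.

(** For [u] the exponential, cosine or sine these are the half-line Laplace and Fourier transforms
    of the Gaussian. In all three cases the function and its first two derivatives [g] and [h2]
    satisfy the bounds assumed above. *)
Definition transform (u : R -> R) (a : R) := \int[leb]_(t in hline) (gauss t * u (a * t)).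

Let bound0 u (a b t : R) : (forall x, `|u x| <= expR `|x|) -> `|a| <= b -> 0 <= t ->
  `|gauss t * u (a * t)| <= expR ((b + 1) ^+ 2 / 2) * expR (- t).
Proof.
move=> ub ab t0; apply: le_trans (gauss_expR_bound b t).
rewrite normrM (ger0_norm (gauss_ge0 t)) ler_wpM2l ?gauss_ge0 //.
apply: le_trans (ub _) _; rewrite ler_expR normrM (ger0_norm t0).
by rewrite ler_wpM2r.
Qed.

Let bound1 u (a b t : R) : (forall x, `|u x| <= expR `|x|) -> `|a| <= b -> 0 <= t ->
  `|t * (gauss t * u (a * t))| <= expR ((b + 2) ^+ 2 / 2) * expR (- t).
Proof.
move=> ub ab t0.
(* The factor t is absorbed by [t <= expR t], at the price of one more unit of slope. *)
have -> : b + 2 = (b + 1) + 1 by ring.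
apply: le_trans (gauss_expR_bound (b + 1) t).
rewrite !normrM (ger0_norm t0) (ger0_norm (gauss_ge0 t)) mulrCA ler_wpM2l ?gauss_ge0 //.
rewrite mulrDl mul1r addrC expRD ler_pM // ?le_expR_self //.
apply: le_trans (ub _) _; rewrite ler_expR normrM (ger0_norm t0).
by rewrite ler_wpM2r.
Qed.

Let contM (u : R -> R) a : continuous u -> continuous (fun t : R => gauss t * u (a * t)).
Proof.
move=> cu t; apply: cvgM; first exact: continuous_gauss.
apply: (@continuous_comp _ _ _ (fun t => a * t) u); last exact: cu.
by apply: cvgM; [exact: cvg_cst|exact: cvg_id].
Qed.

Let cg : continuous g. Proof. by apply: der_continuous => x; eexists; exact: dg. Qed.
Let ch : continuous h. Proof. by apply: der_continuous => x; eexists; exact: dh. Qed.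

Lemma integrable_transform a : leb.-integrable hline (EFin \o (fun t => gauss t * h (a * t))).
Proof.
apply: (@integrable_hline_bound _ (expR ((`|a| + 1) ^+ 2 / 2))).
  by apply: continuous_measurable; exact: contM.
by move=> t t0; exact: bound0.
Qed.

Let der_arg (u : R -> R) (a t : R) (du : R) : is_derive (a * t) 1 u du ->
  is_derive t 1 (fun t => u (a * t)) (du * a).
Proof.
move=> ud; apply: (@is_derive1_comp _ u (fun t => a * t)) => //.
by apply: der_eq (derMl a (der_id _)) _; rewrite mulr1.
Qed.

(** [t * gauss t] is minus the derivative of [gauss]; the boundary term at 0 is [g 0], and
    differentiating [g (a * t)] brings out [a]. *)
Let by_parts a : \int[leb]_(t in hline) (t * (gauss t * g (a * t))) = g 0 + a * transform h2 a.
Proof.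
pose f t := a * (gauss t * h2 (a * t)) - t * (gauss t * g (a * t)).
have dF (t : R) : is_derive t 1 (fun t => gauss t * g (a * t)) (f t).
  apply: der_eq (derM (der_gauss t) (der_arg (dg _))) _.
  by rewrite /f; ring.
have cf : continuous f.
  move=> t; apply: cvgB.
    by apply: cvgM; [exact: cvg_cst|exact: contM].
  by apply: cvgM; [exact: cvg_id|exact: (contM cg)].
have i1 : leb.-integrable hline (EFin \o (fun t => t * (gauss t * g (a * t)))).
  apply: (@integrable_hline_bound _ (expR ((`|a| + 2) ^+ 2 / 2))).
    apply: continuous_measurable => t.
    by apply: cvgM; [exact: cvg_id|exact: (contM cg)].
  by move=> t t0; exact: bound1.
have i2 : leb.-integrable hline (EFin \o (fun t => gauss t * h2 (a * t))).
  apply: (@integrable_hline_bound _ (expR ((`|a| + 1) ^+ 2 / 2))).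
    by apply: continuous_measurable; exact: contM.
  by move=> t t0; exact: bound0.
have : \int[leb]_(t in hline) f t = - (gauss 0 * g (a * 0)).
  apply: (@integral_hline_derivative (fun t => gauss t * g (a * t)) f
     (`|a| * expR ((`|a| + 1) ^+ 2 / 2) + expR ((`|a| + 2) ^+ 2 / 2))) => //.
    apply: (@cvg0_expRN_bound _ (expR ((`|a| + 1) ^+ 2 / 2))) => t t0.
    exact: bound0.
  move=> t t0; rewrite /f; apply: le_trans (ler_normB _ _) _; rewrite mulrDl.
  apply: lerD; last exact: bound1.
  by rewrite normrM -mulrA ler_wpM2l // bound0.
rewrite mulr0 {1}/gauss expr0n /= oppr0 mul0r expR0 mul1r.
have i3 := integrableZl mH a i2.
rewrite /f RintegralB // RintegralZl // -/(transform h2 a) => /eqP.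
by rewrite subr_eq addrC -subr_eq opprK addrC => /eqP <-.
Qed.

(** Differentiation under the integral produces a factor t, removed by [by_parts]. For the
    exponential, cosine and sine [h2] is [h] up to sign, so this is a first-order linear
    differential equation. *)
Lemma der_transform (a : R) : is_derive a 1 (transform h) (g 0 + a * transform h2 a).
Proof.
have d1 (x t : R) : is_derive x 1 (fun x => gauss t * h (x * t)) (gauss t * (g (x * t) * t)).
  apply: derMl; under eq_fun do rewrite mulrC.
  rewrite [x * t]mulrC; apply: der_arg; exact: dh.
have p1 x t : partial1of2 (fun x t => gauss t * h (x * t)) x t = t * (gauss t * g (x * t)).
  by rewrite /partial1of2 derive1E; have [_ ->] := d1 x t; ring.
(* Domination uniform over the parameters within distance 1 of [a], hence the slope [|a| + 1]. *)
pose G t := expR ((`|a| + 1 + 2) ^+ 2 / 2) * expR (- t).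
have Ia : `]a - 1, a + 1[%classic a by rewrite /= in_itv /=; apply/andP; split; lra.
have intf (x : R) : `]a - 1, a + 1[%classic x ->
  leb.-integrable hline (EFin \o (fun t => gauss t * h (x * t))).
  by move=> _; exact: integrable_transform.
have derf (x t : R) : `]a - 1, a + 1[%classic x -> hline t ->
  derivable (fun x : R => gauss t * h (x * t)) x 1.
  by move=> _ _; have [] := d1 x t.
have G0 t : 0 <= G t by rewrite mulr_ge0 ?expR_ge0.
have Gb (x t : R) : `]a - 1, a + 1[%classic x -> hline t ->
    `|partial1of2 (fun x t => gauss t * h (x * t)) x t| <= G t.
  rewrite /= !in_itv /= andbT => /andP[x1 x2] t0; rewrite p1; apply: bound1 => //.
  have := ler_norm a; have := ler_norm (- a); rewrite normrN => ? ?.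
  by rewrite ler_norml; apply/andP; split; lra.
have iG := integrable_expRN (expR ((`|a| + 1 + 2) ^+ 2 / 2)).
have D := derivable_under_integral mH Ia intf derf G0 iG Gb.
have := differentiation_under_integral mH Ia intf derf G0 iG Gb.
under [X in _ = X -> _]eq_Rintegral do rewrite p1.
rewrite by_parts derive1E => <-.
exact: DeriveDef.
Qed.

End transform.
End half_line_transforms.

(** * Closed forms and the segment integrals in Phi *)

Section half_line_closed_forms.
Context {R : realType}.
Local Notation leb := (@lebesgue_measure R).
Local Notation s2pi := (Num.sqrt (2 * pi) : R).
Local Notation hline := (`[0%R, +oo[%classic : set R).

Let mH : measurable (hline : set (measurableTypeR R)).
Proof. exact: measurable_itv. Qed.

Lemma integral_half_line (f : R -> R) :
  (\int[leb]_t (half_line t * f t)%:E = \int[leb]_(t in hline) (f t)%:E)%E.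
Proof.
rewrite [RHS]integral_mkcond; apply: eq_integral => t _.
rewrite patchE mem_hline /half_line; case: ifPn => t0; first by rewrite mul1r.
by rewrite mul0r.
Qed.

Lemma transformE (u : R -> R) (a : R) :
  leb.-integrable hline (EFin \o (fun t => gauss t * u (a * t))) ->
  (\int[leb]_t (half_line t * gauss t * u (a * t))%:E = (transform u a)%:E)%E.
Proof.
move=> i; under eq_integral do rewrite -mulrA.
by rewrite integral_half_line /transform /Rintegral fineK //; exact: integrable_fin_num.
Qed.

Lemma le_expR_norm (x y : R) : `|y| <= 1 -> `|y| <= expR `|x|.
Proof. by move=> /le_trans; apply; rewrite -expR0 ler_expR. Qed.

Lemma norm_cos_le1 (x : R) : `|cos x| <= 1.
Proof. by rewrite ler_norml cos_geN1 cos_le1. Qed.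

Lemma norm_sin_le1 (x : R) : `|sin x| <= 1.
Proof. by rewrite ler_norml sin_geN1 sin_le1. Qed.

Lemma norm_expR_le (x : R) : `|expR x| <= expR `|x|.
Proof. by rewrite ger0_norm ?expR_ge0 // ler_expR ler_norm. Qed.

Let d_exp (x : R) : is_derive x 1 expR (expR x). Proof. exact: is_derive_expR. Qed.
Let d_cos (x : R) : is_derive x 1 cos (- sin x). Proof. exact: is_derive_cos. Qed.
Let d_sin (x : R) : is_derive x 1 sin (cos x). Proof. exact: is_derive_sin. Qed.
Let d_Nsin (x : R) : is_derive x 1 (fun x => - sin x) (- cos x). Proof. exact: derN. Qed.

Lemma integrable_transform_cos (a : R) :
  leb.-integrable hline (EFin \o (fun t => gauss t * cos (a * t))).
Proof.
apply: (integrable_transform d_cos).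
by move=> x; apply: le_expR_norm; exact: norm_cos_le1.
Qed.

Lemma integrable_transform_sin (a : R) :
  leb.-integrable hline (EFin \o (fun t => gauss t * sin (a * t))).
Proof.
apply: (integrable_transform d_sin).
by move=> x; apply: le_expR_norm; exact: norm_sin_le1.
Qed.

Lemma integrable_transform_expR (a : R) :
  leb.-integrable hline (EFin \o (fun t => gauss t * expR (a * t))).
Proof. exact: (integrable_transform d_exp norm_expR_le). Qed.

Let transformN u a : leb.-integrable hline (EFin \o (fun t => gauss t * u (a * t))) ->
  transform (fun x => - u x) a = - transform u a.
Proof.
move=> i; rewrite -mulN1r /transform -RintegralZl //.
by apply: eq_Rintegral => t _; rewrite mulN1r mulrN.
Qed.

Lemma der_transform_cos (a : R) : is_derive a 1 (transform cos) (- (a * transform cos a)).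
Proof.
apply: der_eq (der_transform d_cos d_Nsin _ _ _ _ a) _.
- by move=> x; apply: cvgN; exact: continuous_cos.
- by move=> x; apply: le_expR_norm; exact: norm_cos_le1.
- by move=> x; rewrite normrN; apply: le_expR_norm; exact: norm_sin_le1.
- by move=> x; rewrite normrN; apply: le_expR_norm; exact: norm_cos_le1.
by rewrite sin0 oppr0 add0r transformN ?mulrN //; exact: integrable_transform_cos.
Qed.

Lemma der_transform_sin (a : R) : is_derive a 1 (transform sin) (1 - a * transform sin a).
Proof.
apply: der_eq (der_transform d_sin d_cos _ _ _ _ a) _.
- by move=> x; apply: cvgN; exact: continuous_sin.
- by move=> x; apply: le_expR_norm; exact: norm_sin_le1.
- by move=> x; apply: le_expR_norm; exact: norm_cos_le1.
- by move=> x; rewrite normrN; apply: le_expR_norm; exact: norm_sin_le1.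
by rewrite cos0 transformN ?mulrN //; exact: integrable_transform_sin.
Qed.

Lemma der_transform_expR (a : R) : is_derive a 1 (transform expR) (1 + a * transform expR a).
Proof.
apply: der_eq (der_transform d_exp d_exp _ _ _ _ a) _.
- exact: continuous_expR.
- exact: norm_expR_le.
- exact: norm_expR_le.
- exact: norm_expR_le.
by rewrite expR0.
Qed.

Lemma integrable_hline_gauss : leb.-integrable hline (EFin \o gauss).
Proof.
have := integrable_transform_cos 0.
by apply: eq_integrable => // t _ /=; rewrite mul0r cos0 mulr1.
Qed.

Lemma integral_hline_gauss : (\int[leb]_(t in hline) (gauss t)%:E = (s2pi / 2)%:E)%E.
Proof.
have := @ge0_symfun_integralT R gauss gauss_ge0 continuous_gauss
  (fun t => esym (gaussN t)).
rewrite integral_gauss (_ : [set x : R | (0 <= x)%R] = hline); last first.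
  by apply/seteqP; split=> x /=; rewrite in_itv /= andbT.
have [r rE] : exists r : R, (\int[leb]_(t in hline) (gauss t)%:E = r%:E)%E.
  exists (\int[leb]_(t in hline) gauss t); rewrite /Rintegral fineK //.
  exact: integrable_fin_num integrable_hline_gauss.
by rewrite rE -EFinM => -[->]; congr EFin; field.
Qed.

Lemma transform0 (u : R -> R) : transform u 0 = u 0 * (s2pi / 2).
Proof.
rewrite /transform; under eq_Rintegral do rewrite mul0r mulrC.
rewrite RintegralZl //; last exact: integrable_hline_gauss.
by rewrite /Rintegral integral_hline_gauss.
Qed.

Let der_half_sqr (s a : R) :
  is_derive a 1 (fun a => expR (s * a ^+ 2 / 2)) (expR (s * a ^+ 2 / 2) * (s * a)).
Proof.
apply: der_eq (der_expR (derMr _ (derMl s (derX2 (der_id _))))) _.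
by congr (_ * _); field.
Qed.

(** The equation is T' = -aT, so T exp(a^2/2) is constant. *)
Lemma transform_cos (a : R) : transform cos a = s2pi / 2 * expR (- (a ^+ 2 / 2)).
Proof.
have D (x : R) : is_derive x 1 (fun a => transform cos a * expR (1 * a ^+ 2 / 2)) 0.
  by apply: der_eq (derM (der_transform_cos x) (der_half_sqr 1 x)) _; ring.
have := is_derive_0_is_cst a 0 D.
rewrite transform0 cos0 expr0n /= mulr0 mul0r expR0 mulr1 !mul1r => <-.
by rewrite -mulrA -expRD subrr expR0 mulr1.
Qed.

Lemma integral_gauss_cos (a : R) :
  (\int[leb]_t (gauss t * cos (a * t))%:E = (s2pi * expR (- (a ^+ 2 / 2)))%:E)%E.
Proof.
(* Adding 1 makes the even integrand nonnegative, so that it folds onto the half-line; the Gaussian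
   mass is cancelled at the end. *)
pose f t := gauss t * (1 + cos (a * t)).
have f0 t : 0 <= f t.
  by rewrite mulr_ge0 ?gauss_ge0 // -lerBlDl sub0r cos_geN1.
have cca : continuous (fun t : R => cos (a * t)).
  by apply: der_continuous => t; eexists; exact: der_cos (derMl a (der_id _)).
have cf : continuous f.
  move=> t; apply: cvgM; first exact: continuous_gauss.
  by apply: cvgD; [exact: cvg_cst|exact: cca].
have fN : f =1 f \o -%R by move=> t; rewrite /f /= gaussN mulrN cosN.
have i1 := @integrable_gauss R.
have i2 : leb.-integrable setT (EFin \o (fun t => gauss t * cos (a * t))).
  apply: (integrable_gauss_bound (c := 1)).
    by apply: measurable_funM; [exact: measurable_gauss|exact: continuous_measurable].
  move=> t; rewrite mul1r normrM (ger0_norm (gauss_ge0 t)).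
  by rewrite ler_piMr ?gauss_ge0 // norm_cos_le1.
have := ge0_symfun_integralT f0 cf fN.
rewrite (_ : [set x : R | (0 <= x)%R] = hline); last first.
  by apply/seteqP; split=> x /=; rewrite in_itv /= andbT.
under eq_integral do rewrite /f mulrDr mulr1 EFinD.
rewrite (integralD measurableT i1 i2) integral_gauss.
have -> : (\int[leb]_(x in hline) (f x)%:E = (s2pi / 2 + transform cos a)%:E)%E.
  under eq_integral do rewrite /f mulrDr mulr1 EFinD.
  rewrite (integralD mH integrable_hline_gauss (integrable_transform_cos a)).
  rewrite integral_hline_gauss EFinD; congr (_ + _)%E.
  rewrite /transform /Rintegral fineK //.
  exact: integrable_fin_num (integrable_transform_cos a).
have [r rE] : exists r : R, (\int[leb]_t (gauss t * cos (a * t))%:E = r%:E)%E.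
  exists (\int[leb]_t (gauss t * cos (a * t))); rewrite /Rintegral fineK //.
  exact: integrable_fin_num i2.
rewrite /= rE -EFinD -EFinM transform_cos => -[e].
by congr EFin; apply: (@addrI _ s2pi); rewrite [LHS]e; field.
Qed.

(** The shape of the integral in [Phi] once the segment is parametrized: [s] is -1 for real
    arguments and 1 for imaginary ones. *)
Lemma antiderivative_segment (Psi : R -> R) (s a : R) :
  (forall x : R, is_derive x 1 Psi (expR (s * x ^+ 2 / 2))) ->
  (\int[leb]_(t in `[0%R, 1%R]) (a * expR (s * (t * a) ^+ 2 / 2))%:E = (Psi a - Psi 0)%:E)%E.
Proof.
move=> dPsi.
have dF (t : R) : is_derive t 1 (fun t => Psi (t * a)) (a * expR (s * (t * a) ^+ 2 / 2)).
  apply: der_eq (@is_derive1_comp _ Psi (fun t => t * a) _ _ _ (dPsi _) (derMr a (der_id _))) _.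
  by rewrite mul1r mulrC.
have cF : continuous (fun t : R => Psi (t * a)) by apply: der_continuous => t; eexists; exact: dF.
have cf : continuous (fun t : R => a * expR (s * (t * a) ^+ 2 / 2)).
  apply: der_continuous => t; eexists.
  apply: derMl; apply: der_expR; apply: derMr; apply: derMl; apply: derX2.
rewrite (@continuous_FTC2 _ _ (fun t => Psi (t * a))) //.
- by rewrite mul1r mul0r.
- exact: continuous_subspaceT cf.
- split.
  + by move=> x _; have [] := dF x.
  + by apply: cvg_at_right_filter; exact: cF.
  + by apply: cvg_at_left_filter; exact: cF.
- by move=> x _; rewrite derive1E; have [_ ->] := dF x.
Qed.

(** The equation T' = 1 - aT says that T exp(a^2/2) is an antiderivative of exp(a^2/2). *)
Lemma integral_segment_sin (a : R) :
  (\int[leb]_(t in `[0%R, 1%R]) (a * expR ((t * a) ^+ 2 / 2))%:E =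
   (transform sin a * expR (a ^+ 2 / 2))%:E)%E.
Proof.
rewrite -[a ^+ 2]mul1r; under eq_integral do rewrite -[(_ * a) ^+ 2]mul1r.
have D (x : R) : is_derive x 1 (fun a => transform sin a * expR (1 * a ^+ 2 / 2))
    (expR (1 * x ^+ 2 / 2)).
  by apply: der_eq (derM (der_transform_sin x) (der_half_sqr 1 x)) _; ring.
by rewrite (antiderivative_segment a D) transform0 sin0 !mul0r subr0.
Qed.

Lemma integral_segment_expR (a : R) :
  (\int[leb]_(t in `[0%R, 1%R]) (a * expR (- (t * a) ^+ 2 / 2))%:E =
   (transform expR a * expR (- a ^+ 2 / 2) - s2pi / 2)%:E)%E.
Proof.
rewrite -[- a ^+ 2]mulN1r; under eq_integral do rewrite -[- _ ^+ 2]mulN1r.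
have D (x : R) : is_derive x 1 (fun a => transform expR a * expR (-1 * a ^+ 2 / 2))
    (expR (-1 * x ^+ 2 / 2)).
  by apply: der_eq (derM (der_transform_expR x) (der_half_sqr (-1) x)) _; ring.
rewrite (antiderivative_segment a D) transform0 expR0 expr0n /= mulr0 mul0r.
by rewrite expR0 mulr1 mul1r.
Qed.

End half_line_closed_forms.

(** * Independence through the Fourier transform *)

Section complex_gaussian_trick.
Context {R : realType}.
Local Notation leb := (@lebesgue_measure R).
Local Notation s2pi := (Num.sqrt (2 * pi) : R).

(** [X + iY] will be the Fourier transform of the weight of one coordinate; its power is used
    through real and imaginary parts because all integrals involved are real. *)
Definition cpow (X Y : R -> R) n (y : R) : R[i] := (X y +i* Y y)%C ^+ n.

Lemma Re_cpowS X Y n y : complex.Re (cpow X Y n.+1 y) =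
  X y * complex.Re (cpow X Y n y) - Y y * complex.Im (cpow X Y n y).
Proof. by rewrite /cpow exprS; case: (_ ^+ n). Qed.

Lemma Im_cpowS X Y n y : complex.Im (cpow X Y n.+1 y) =
  X y * complex.Im (cpow X Y n y) + Y y * complex.Re (cpow X Y n y).
Proof. by rewrite /cpow exprS; case: (_ ^+ n). Qed.

Lemma measurable_cpow X Y n : measurable_fun setT X -> measurable_fun setT Y ->
  measurable_fun setT (fun y => complex.Re (cpow X Y n y)) /\
  measurable_fun setT (fun y => complex.Im (cpow X Y n y)).
Proof.
move=> mX mY; elim: n => [|n [mRe mIm]]; first by split; exact: measurable_cst.
split.
- under eq_fun do rewrite Re_cpowS.
  by apply: measurable_funB; exact: measurable_funM.
- under eq_fun do rewrite Im_cpowS.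
  by apply: measurable_funD; exact: measurable_funM.
Qed.

(** The bound only serves as a constant in front of a Gaussian, so a factor 2 per multiplication is
    harmless. *)
Lemma cpow_bound X Y n (B y : R) : `|X y| <= B -> `|Y y| <= B ->
  `|complex.Re (cpow X Y n y)| <= (2 * B) ^+ n /\
  `|complex.Im (cpow X Y n y)| <= (2 * B) ^+ n.
Proof.
move=> XB YB; have B0 : 0 <= B by rewrite (le_trans _ XB).
elim: n => [|n [IHr IHi]]; first by rewrite /cpow !expr0 /= normr1 normr0 ler01.
rewrite Re_cpowS Im_cpowS exprS.
have -> : 2 * B * (2 * B) ^+ n = B * (2 * B) ^+ n + B * (2 * B) ^+ n by ring.
split.
- by apply: le_trans (ler_normB _ _) _; rewrite !normrM lerD // ler_pM.
- by apply: le_trans (ler_normD _ _) _; rewrite !normrM lerD // ler_pM.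
Qed.

Variables (chi : R -> R) (k : R) (X Y : R -> R).
Hypotheses (mchi : measurable_fun setT chi) (chi0 : forall t, 0 <= chi t).
Hypothesis chi1 : forall t, chi t <= 1.
Hypotheses (mX : measurable_fun setT X) (mY : measurable_fun setT Y).
Hypothesis XE : forall y,
  (\int[leb]_t (chi t * gauss t * cos (k * y * t))%:E = (X y)%:E)%E.
Hypothesis YE : forall y,
  (\int[leb]_t (chi t * gauss t * sin (k * y * t))%:E = (Y y)%:E)%E.

Let mcos d (T : measurableType d) (f : T -> R) : measurable_fun setT f ->
  measurable_fun setT (fun x => cos (f x)).
Proof.
move=> mf; apply: (@measurableT_comp _ _ _ _ _ _ (@cos R)) => //.
by apply: continuous_measurable; exact: continuous_cos.
Qed.

Let msin d (T : measurableType d) (f : T -> R) : measurable_fun setT f ->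
  measurable_fun setT (fun x => sin (f x)).
Proof.
move=> mf; apply: (@measurableT_comp _ _ _ _ _ _ (@sin R)) => //.
by apply: continuous_measurable; exact: continuous_sin.
Qed.

Let mchig : measurable_fun setT (fun t => chi t * gauss t).
Proof. by apply: measurable_funM => //; exact: measurable_gauss. Qed.

Let chig_bound (u : R) t : `|u| <= 1 -> `|chi t * gauss t * u| <= 1 * gauss t.
Proof.
move=> u1; rewrite normrM -[leRHS]mulr1 ler_pM // normrM.
by rewrite (ger0_norm (gauss_ge0 t)) (ger0_norm (chi0 t)) ler_wpM2r // gauss_ge0.
Qed.

Let icos y : leb.-integrable setT (fun t => (chi t * gauss t * cos (k * y * t))%:E).
Proof.
apply: (integrable_gauss_bound (c := 1));
  last by move=> t; rewrite chig_bound // ler_norml cos_geN1 cos_le1.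
by apply: measurable_funM => //; apply: mcos; exact: measurable_funM.
Qed.

Let isin y : leb.-integrable setT (fun t => (chi t * gauss t * sin (k * y * t))%:E).
Proof.
apply: (integrable_gauss_bound (c := 1));
  last by move=> t; rewrite chig_bound // ler_norml sin_geN1 sin_le1.
by apply: measurable_funM => //; apply: msin; exact: measurable_funM.
Qed.

Lemma cos_moment_bound y : `|X y| <= s2pi.
Proof.
rewrite -lee_fin -integral_gauss.
rewrite (_ : `|X y|%:E = `| \int[leb]_t (chi t * gauss t * cos (k * y * t))%:E |)%E;
  last by rewrite XE.
apply: le_trans (le_abse_integral _ _ _) _ => //; first by have /integrableP[] := icos y.
apply: ge0_le_integral => //=.
- apply/measurable_EFinP; apply: (measurableT_comp (@normr_measurable _ _)).
  by have /integrableP[/measurable_EFinP] := icos y.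
- by apply/measurable_EFinP; exact: measurable_gauss.
- move=> t _; rewrite lee_fin; have := @chig_bound (cos (k * y * t)) t.
  by rewrite mul1r; apply; rewrite ler_norml cos_geN1 cos_le1.
Qed.

Lemma sin_moment_bound y : `|Y y| <= s2pi.
Proof.
rewrite -lee_fin -integral_gauss.
rewrite (_ : `|Y y|%:E = `| \int[leb]_t (chi t * gauss t * sin (k * y * t))%:E |)%E;
  last by rewrite YE.
apply: le_trans (le_abse_integral _ _ _) _ => //; first by have /integrableP[] := isin y.
apply: ge0_le_integral => //=.
- apply/measurable_EFinP; apply: (measurableT_comp (@normr_measurable _ _)).
  by have /integrableP[/measurable_EFinP] := isin y.
- by apply/measurable_EFinP; exact: measurable_gauss.
- move=> t _; rewrite lee_fin; have := @chig_bound (sin (k * y * t)) t.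
  by rewrite mul1r; apply; rewrite ler_norml sin_geN1 sin_le1.
Qed.

(* [exp (- k^2 S^2 / 2)] is the Fourier transform of a standard Gaussian
   variable, which makes the coordinates independent. *)
Lemma wgt_mass_pos n (b : R) :
  (s2pi%:E * wgt_mass chi (k ^+ 2) n b =
   \int[leb]_y (gauss y * (cos (k * y * b) * complex.Re (cpow X Y n y)
                           - sin (k * y * b) * complex.Im (cpow X Y n y)))%:E)%E.
Proof.
elim: n b => [|n IH] b.
  under eq_integral do
    rewrite /cpow expr0 /= mulr0 subr0 mulr1 -mulrA [_ * b]mulrC mulrA.
  rewrite integral_gauss_cos wgt_mass0 -EFinM; congr (_ * expR _)%:E.
  by field.
rewrite wgt_massS //.
pose g (b y : R) := gauss y * (cos (k * y * b) * complex.Re (cpow X Y n y)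
                           - sin (k * y * b) * complex.Im (cpow X Y n y)).
have [mRe mIm] := measurable_cpow n mX mY.
have mg d (T : measurableType d) (u v : T -> R) : measurable_fun setT u -> measurable_fun setT v ->
    measurable_fun setT (fun x => g (u x) (v x)).
  move=> mu mv; apply: measurable_funM; first exact: (measurableT_comp measurable_gauss).
  apply: measurable_funB; apply: measurable_funM.
  - by apply: mcos; do 2?apply: measurable_funM.
  - exact: (measurableT_comp mRe).
  - by apply: msin; do 2?apply: measurable_funM.
  - exact: (measurableT_comp mIm).
pose M := 2 * (2 * s2pi) ^+ n.
have gM (u y : R) : `|g u y| <= M * gauss y.
  rewrite /g normrM (ger0_norm (gauss_ge0 y)) mulrC ler_wpM2r ?gauss_ge0 //.
  have [Pb Qb] := cpow_bound n (cos_moment_bound y) (sin_moment_bound y).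
  apply: le_trans (ler_normB _ _) _; rewrite !normrM /M mulr2n mulrDl !mul1r.
  apply: lerD; rewrite -[leRHS]mul1r; apply: ler_pM => //; rewrite ler_norml.
    by rewrite cos_geN1 cos_le1.
  by rewrite sin_geN1 sin_le1.
have ig u : leb.-integrable setT (fun y => (g u y)%:E).
  by apply: (integrable_gauss_bound (c := M)) => //; exact: mg.
pose H (z : R * R) := (chi z.1 * gauss z.1 * g (b + z.1) z.2)%:E.
have mH : measurable_fun setT H.
  apply/measurable_EFinP; apply: measurable_funM.
    exact: (measurableT_comp mchig).
  by apply: mg => //; exact: measurable_funD.
have mm : measurable_fun setT (fun t => (chi t * gauss t)%:E * wgt_mass chi (k ^+ 2) n (b + t))%E.
  apply: emeasurable_funM; first exact/measurable_EFinP.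
  apply: (measurable_iterint (F := fun z : R * 'rV[R]_n => (wgt chi (k ^+ 2) (b + z.1) z.2)%:E)).
    apply/measurable_EFinP; apply: measurable_wgt => //.
    exact: measurable_funD.
  by move=> z; rewrite lee_fin wgt_ge0.
have cg0 t : 0 <= chi t * gauss t := mulr_ge0 (chi0 t) (gauss_ge0 t).
rewrite -ge0_integralZl_EFin ?sqrtr_ge0 //; last first.
  move=> t _; rewrite mule_ge0 ?lee_fin ?cg0 //.
  by apply: iterint_ge0 => s; rewrite lee_fin wgt_ge0.
have M0 : 0 <= M by rewrite mulr_ge0 // exprn_ge0 // mulr_ge0 // sqrtr_ge0.
have mgauss : measurable_fun setT (EFin \o @gauss R).
  by apply/measurable_EFinP; exact: measurable_gauss.
(* The integrand changes sign, so the exchange of integrals needs Fubini; a multiple of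
   [gauss t * gauss y] dominates it. *)
have iH : (leb \x leb)%E.-integrable setT H.
  apply/(integrable12ltyP leb leb mH).
  apply: (@le_lt_trans _ _ (\int[leb]_t ((M * s2pi)%:E * (gauss t)%:E))%E); last first.
    rewrite ge0_integralZl_EFin ?mulr_ge0 ?sqrtr_ge0 //.
    - by rewrite integral_gauss -EFinM ltry.
    - by move=> t _; rewrite lee_fin gauss_ge0.
  have mabsH : measurable_fun setT (fun z => `|H z|)%E by exact: measurableT_comp.
  apply: ge0_le_integral => //.
  - by move=> t _; exact: integral_ge0.
  - exact: (@measurable_fun_fubini_tonelli_F _ _ (measurableTypeR R) (measurableTypeR R)
    R leb _ mabsH).
  - exact: emeasurable_funM.
  move=> t _; rewrite -EFinM [leRHS](_ : _ = \int[leb]_y ((M * gauss t)%:E * (gauss y)%:E))%E;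
    last first.
    rewrite ge0_integralZl_EFin ?(mulr_ge0 M0 (gauss_ge0 t)) //.
    - by rewrite integral_gauss -EFinM; congr EFin; ring.
    - by move=> y _; rewrite lee_fin gauss_ge0.
  apply: ge0_le_integral => //.
  - by apply: (measurableT_comp mabsH); exact: measurable_fun_pair.
  - exact: emeasurable_funM.
  move=> y _; rewrite /H /= lee_fin.
  apply: le_trans (_ : _ <= 1 * gauss t * (M * gauss y)) _;
    last by rewrite le_eqVlt; apply/orP; left; apply/eqP; ring.
  rewrite normrM ler_pM //.
  by have := @chig_bound 1 t; rewrite mulr1; apply; rewrite normr1.
transitivity (\int[leb]_t \int[leb]_y H (t, y))%E.
  apply: eq_integral => t _; rewrite muleCA IH.
  by rewrite -(integralZl measurableT (ig (b + t))).
transitivity (\int[leb]_y \int[leb]_t H (t, y))%E.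
  exact: (@Fubini _ _ (measurableTypeR R) (measurableTypeR R) R leb leb H).
apply: eq_integral => y _.
(* [A] and [B] are the coefficients of cos(kyt) and sin(kyt) given by the addition formulas at
   [b + t]. Integrating over t replaces these by [X y] and [Y y], which amounts to one more complex
   multiplication. *)
pose A : R := gauss y * (cos (k * y * b) * complex.Re (cpow X Y n y)
                           - sin (k * y * b) * complex.Im (cpow X Y n y)).
pose B : R := - gauss y * (sin (k * y * b) * complex.Re (cpow X Y n y)
                           + cos (k * y * b) * complex.Im (cpow X Y n y)).
transitivity (\int[leb]_t (A%:E * (chi t * gauss t * cos (k * y * t))%:E +
    B%:E * (chi t * gauss t * sin (k * y * t))%:E))%E.
  apply: eq_integral => t _; rewrite /H /g /A /B /= -!EFinM -EFinD; congr EFin.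
  by rewrite [k * y * (b + t)]mulrDr cosD sinD; ring.
rewrite integralD //; [|exact: integrableZl|exact: integrableZl].
rewrite !integralZl // XE YE -!EFinM -EFinD Re_cpowS Im_cpowS; congr EFin.
by rewrite /A /B; ring.
Qed.
End complex_gaussian_trick.

(** * Substitution in signed integrals and total masses *)

Section gaussian_integrals.
Context {R : realType}.
Local Notation leb := (@lebesgue_measure R).
Local Notation s2pi := (Num.sqrt (2 * pi) : R).

Lemma integrable_affine (a b : R) (f : R -> R) : a != 0 ->
  leb.-integrable setT (EFin \o f) ->
  leb.-integrable setT (EFin \o (fun t => f (a * t + b))).
Proof.
move=> a0 /integrableP[mf fy]; apply/integrableP; split.
  exact: (measurableT_comp mf (measurable_affine a b)).
have mabs : measurable_fun setT (fun t => `|(EFin \o f) t|)%E.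
  exact: measurableT_comp.
move: fy; rewrite (ge0_integral_affine b a0 mabs) //.
have lt_y (x : \bar R) : (0 <= x -> `|a|%:E * x < +oo -> x < +oo)%E.
  by case: x => // [x _ _|_]; [exact: ltry|rewrite gt0_muley // lte_fin normr_gt0].
by apply: lt_y; exact: integral_ge0.
Qed.

Lemma Rintegral_affine (a b : R) (f : R -> R) : a != 0 ->
  leb.-integrable setT (EFin \o f) ->
  \int[leb]_t f t = `|a| * \int[leb]_t f (a * t + b).
Proof.
move=> a0 f_int; have g_int := integrable_affine b a0 f_int.
pose g t := f (a * t + b).
have /integrableP[mf _] := f_int.
apply: EFin_inj; rewrite EFinM /Rintegral !fineK; first last.
- exact: integrable_fin_num f_int.
- exact: integrable_fin_num g_int.
transitivity (\int[leb]_t (EFin \o f)^\+ t - \int[leb]_t (EFin \o f)^\- t)%E.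
  exact: integralE.
rewrite (ge0_integral_affine b a0 (measurable_funepos mf)) //.
rewrite (ge0_integral_affine b a0 (measurable_funeneg mf)) //.
transitivity (`|a|%:E * (\int[leb]_t (EFin \o g)^\+ t - \int[leb]_t (EFin \o g)^\- t))%E;
  last by rewrite [in RHS]integralE.
have -> : (\int[leb]_t (EFin \o f)^\+ (a * t + b)%R = \int[leb]_t (EFin \o g)^\+ t)%E.
  by apply: eq_integral => t _; rewrite !funeposE.
have -> : (\int[leb]_t (EFin \o f)^\- (a * t + b)%R = \int[leb]_t (EFin \o g)^\- t)%E.
  by apply: eq_integral => t _; rewrite !funenegE.
have := integrable_neg_fin_num measurableT g_int.
move: (\int[leb]_t (EFin \o g)^\+ t)%E (\int[leb]_t (EFin \o g)^\- t)%E => P N N_fin.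
by rewrite muleBr // fin_num_adde_defl // fin_numN.
Qed.

Lemma integral_gauss_quadratic (q b : R) : 0 < 1 + q ->
  (\int[leb]_t (gauss t * expR (- (q * (b + t) ^+ 2 / 2)))%:E =
   (s2pi / Num.sqrt (1 + q) * expR (- (q / (1 + q) * b ^+ 2 / 2)))%:E)%E.
Proof.
move=> q0; pose a := Num.sqrt (1 + q).
have a0 : 0 < a by rewrite sqrtr_gt0.
have an : a != 0 by rewrite gt_eqF.
have qn : 1 + q != 0 by rewrite gt_eqF.
have a2 : a ^+ 2 = 1 + q by rewrite sqr_sqrtr // ltW.
have mg : measurable_fun setT (fun t : R => (gauss t)%:E).
  by apply/measurable_EFinP; exact: measurable_gauss.
have ga : (\int[leb]_t (gauss (a * t + q * b / a))%:E = (s2pi / a)%:E)%E.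
  have := ge0_integral_affine (q * b / a) an mg.
  rewrite integral_gauss (gtr0_norm a0) => e.
  rewrite [s2pi / a]mulrC EFinM e; last by move=> t; rewrite lee_fin gauss_ge0.
  by rewrite muleA -EFinM mulVf // mul1e.
(* The square completed: t^2 + q (b+t)^2 equals (a t + q b/a)^2 + q b^2/(1+q), with a^2 = 1+q. *)
have E t : gauss t * expR (- (q * (b + t) ^+ 2 / 2)) =
    expR (- (q / (1 + q) * b ^+ 2 / 2)) * gauss (a * t + q * b / a).
  rewrite /gauss -!expRD; congr expR.
  have -> : (a * t + q * b / a) ^+ 2 =
      a ^+ 2 * t ^+ 2 + 2 * q * b * t + (q * b) ^+ 2 / a ^+ 2 by field.
  by rewrite a2; field.
under eq_integral do rewrite E EFinM.
rewrite ge0_integralZl_EFin ?expR_ge0 //; first last.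
- by apply: (measurableT_comp mg); exact: measurable_affine.
- by move=> t _; rewrite lee_fin gauss_ge0.
by rewrite ga -EFinM mulrC.
Qed.

(** [1 + n c] is the determinant of 1 + cJ. Integrating n coordinates leaves the coefficient
    [c / (1 + n c)] on the squared shift, so one further coordinate is the one-dimensional case with
    this [q]. *)
Lemma total_mass_quadratic (c b : R) n : 0 < 1 + n%:R * c ->
  wgt_mass (fun=> 1) c n b =
  (s2pi ^+ n / Num.sqrt (1 + n%:R * c) *
   expR (- (c / (1 + n%:R * c) * b ^+ 2 / 2)))%:E.
Proof.
elim: n b => [|n IH] b n0.
  by rewrite wgt_mass0 mul0r addr0 sqrtr1 expr0 !divr1 mul1r.
(* For negative [c] the condition at [n.+1] is the stronger one; for nonnegative [c] it always
   holds. *)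
have n1 : 0 < 1 + n%:R * c.
  have [c0|c0] := leP 0 c; first by rewrite ltr_pwDl // mulr_ge0.
  by apply: lt_trans n0 _; rewrite ltrD2l ltr_nM2r // ltr_nat.
have nn : 1 + n%:R * c != 0 by rewrite gt_eqF.
have nS : 1 + n.+1%:R * c = 1 + n%:R * c + c by rewrite -natr1; ring.
have qE : 1 + c / (1 + n%:R * c) = (1 + n.+1%:R * c) / (1 + n%:R * c).
  by rewrite nS; field.
have q0 : 0 < 1 + c / (1 + n%:R * c) by rewrite qE divr_gt0.
have sn : Num.sqrt (1 + n%:R * c) != 0 by rewrite gt_eqF // sqrtr_gt0.
have sn1 : Num.sqrt (1 + n.+1%:R * c) != 0 by rewrite gt_eqF // sqrtr_gt0.
have nSn : 1 + n.+1%:R * c != 0 by rewrite gt_eqF.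
rewrite wgt_massS //.
transitivity (\int[leb]_t ((s2pi ^+ n / Num.sqrt (1 + n%:R * c))%:E *
  (gauss t * expR (- (c / (1 + n%:R * c) * (b + t) ^+ 2 / 2)))%:E))%E.
  apply: eq_integral => t _; rewrite IH // -!EFinM; congr EFin.
  by rewrite mul1r mulrCA.
rewrite ge0_integralZl_EFin //.
- rewrite integral_gauss_quadratic // -EFinM; congr EFin.
  have -> : Num.sqrt (1 + c / (1 + n%:R * c)) =
      Num.sqrt (1 + n.+1%:R * c) / Num.sqrt (1 + n%:R * c).
    by rewrite qE sqrtrM ?(ltW n0) // sqrtrV // ltW.
  have -> : c / (1 + n%:R * c) / (1 + c / (1 + n%:R * c)) = c / (1 + n.+1%:R * c).
    rewrite qE; move: (1 + n.+1%:R * c) (1 + n%:R * c) nSn nn => A B A0 B0.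
    by field; rewrite A0 B0.
  rewrite mulrA [s2pi ^+ n.+1]exprSr; congr (_ * _).
  move: (Num.sqrt (1 + n.+1%:R * c)) (Num.sqrt (1 + n%:R * c)) sn1 sn => A B A0 B0.
  by field; rewrite A0 B0.
- by move=> t _; rewrite lee_fin (mulr_ge0 (gauss_ge0 t) (expR_ge0 _)).
- apply/measurable_EFinP; apply: measurable_funM; first exact: measurable_gauss.
  apply: (measurableT_comp (@measurable_expR R)); apply: measurable_funN.
  apply: measurable_funM => //; apply: measurable_funM => //; apply: measurable_funX.
  exact: measurable_funD.
Qed.
End gaussian_integrals.

(** * Phi on the real and imaginary axes *)

Section Phi_values.
Context {R : realType}.
Local Notation leb := (@lebesgue_measure R).
Local Notation s2pi := (Num.sqrt (2 * pi) : R).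

Lemma cexp_real (r : R) : cexp r%:C%C = (expR r)%:C%C.
Proof. by rewrite /cexp /= cos0 sin0 [RHS]complexE /= mulr0 addr0 mulr1. Qed.

Lemma cintegral_real (D : set R) (f : R -> R) :
  cintegral D (fun s => (f s)%:C%C) = (\int[leb]_(s in D) f s)%:C%C.
Proof. by rewrite /cintegral /Rintegral /= integral0. Qed.

Lemma cintegral_imag (D : set R) (f : R -> R) :
  cintegral D (fun s => (0 +i* f s)%C) = (0 +i* \int[leb]_(s in D) f s)%C.
Proof. by rewrite /cintegral /Rintegral /= integral0. Qed.

(** Identifies the factor of one coordinate: the segment integral subtracts the transform at 0, half
    the Gaussian mass, which cancels the 1/2 in [Phi]. *)
Lemma Phi_real (x : R) : Phi x%:C%C = (transform expR x * gauss x / s2pi)%:C%C.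
Proof.
rewrite /Phi.
have -> : (fun s : R => cexp (- (s%:C%C * x%:C%C) ^+ 2 / 2) * x%:C%C) =
    (fun s => (x * expR (- (s * x) ^+ 2 / 2))%:C%C).
  apply/funext => s.
  have -> : - (s%:C%C * x%:C%C) ^+ 2 / 2 = (- (s * x) ^+ 2 / 2)%:C%C.
    by rewrite !(rmorphM, rmorphN, rmorphXn, fmorphV, rmorph_nat) /=.
  by rewrite cexp_real mulrC -rmorphM.
rewrite cintegral_real /Rintegral integral_segment_expR /=.
have -> : 1 / 2 = (1 / 2 : R)%:C%C by rewrite rmorphM fmorphV rmorph1 rmorph_nat.
rewrite -rmorphM -rmorphD /=; congr (_%:C)%C.
by rewrite /gauss; field; rewrite gt_eqF // s2pi_gt0.
Qed.

(** On the imaginary axis the exponent becomes positive. The segment integral gives the sine part,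
    and the constant 1/2 is the cosine part in disguise, by [transform_cos]. *)
Lemma Phi_imag (x : R) : Phi (0 +i* x)%C =
  (expR (x ^+ 2 / 2) / s2pi)%:C%C * (transform cos x +i* transform sin x)%C.
Proof.
rewrite /Phi.
have -> : (fun s : R => cexp (- (s%:C%C * (0 +i* x)%C) ^+ 2 / 2) * (0 +i* x)%C) =
    (fun s => (0 +i* (x * expR ((s * x) ^+ 2 / 2)))%C).
  apply/funext => s.
  have -> : - (s%:C%C * (0 +i* x)%C) ^+ 2 / 2 = ((s * x) ^+ 2 / 2)%:C%C.
    rewrite !(rmorphM, rmorphXn, fmorphV, rmorph_nat) /=; congr (_ / _).
    by apply/eqP; rewrite eq_complex /=; apply/andP; split; apply/eqP; ring.
  rewrite cexp_real.
  by apply/eqP; rewrite eq_complex /=; apply/andP; split; apply/eqP; ring.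
rewrite cintegral_imag /Rintegral integral_segment_sin /=.
have -> : 1 / 2 = (1 / 2 : R)%:C%C by rewrite rmorphM fmorphV rmorph1 rmorph_nat.
have s0 : s2pi != 0 by rewrite gt_eqF // s2pi_gt0.
rewrite transform_cos.
have E : expR (x ^+ 2 / 2) * expR (- (x ^+ 2 / 2)) = 1 by rewrite -expRD subrr expR0.
apply/eqP; rewrite eq_complex /=; apply/andP; split; apply/eqP; last by ring.
transitivity (expR (x ^+ 2 / 2) * expR (- (x ^+ 2 / 2)) / 2); last by field.
by rewrite E; field.
Qed.

End Phi_values.

(** * The external and internal angle integrals *)

Section angle_integrals.
Context {R : realType}.
Local Notation leb := (@lebesgue_measure R).
Local Notation s2pi := (Num.sqrt (2 * pi) : R).
Local Notation hline := (`[0%R, +oo[%classic : set R).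

Let Phir (x : R) : R := transform expR x * gauss x / s2pi.

Let s2pi_neq0 : s2pi != 0. Proof. by rewrite gt_eqF // s2pi_gt0. Qed.

Let transform_exprE (x : R) :
  (\int[leb]_t (half_line t * gauss t * expR (x * t))%:E = (transform expR x)%:E)%E.
Proof. exact: transformE (integrable_transform_expR x). Qed.

Lemma transform_expR_ge0 (x : R) : 0 <= transform expR x.
Proof.
rewrite -lee_fin -transform_exprE; apply: integral_ge0 => t _; rewrite lee_fin.
exact: mulr_ge0 (mulr_ge0 (half_line_ge0 t) (gauss_ge0 t)) (expR_ge0 _).
Qed.

Lemma transform_expR_le (x : R) : transform expR x <= s2pi * expR (x ^+ 2 / 2).
Proof.
have mge : measurable_fun setT (fun t : R => gauss t * expR (x * t)).
  apply: measurable_funM; first exact: measurable_gauss.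
  by apply: (measurableT_comp (@measurable_expR R)); exact: measurable_funM.
rewrite -lee_fin -transform_exprE -integral_gauss_expR; apply: ge0_le_integral => //.
- move=> t _; rewrite lee_fin.
  exact: mulr_ge0 (mulr_ge0 (half_line_ge0 t) (gauss_ge0 t)) (expR_ge0 _).
- under eq_fun do rewrite -mulrA; apply/measurable_EFinP.
  by apply: measurable_funM => //; exact: measurable_half_line.
- exact/measurable_EFinP.
- move=> t _; rewrite lee_fin -mulrA.
  by apply: ler_piMl; [exact: mulr_ge0 (gauss_ge0 t) (expR_ge0 _)|exact: half_line_le1].
Qed.

Let Phir01 x : 0 <= Phir x <= 1.
Proof.
rewrite /Phir divr_ge0 ?(mulr_ge0 (transform_expR_ge0 x) (gauss_ge0 x)) ?sqrtr_ge0 //=.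
rewrite ler_pdivrMr ?s2pi_gt0 // mul1r.
apply: le_trans (ler_wpM2r (gauss_ge0 x) (transform_expR_le x)) _.
by rewrite /gauss -mulrA -expRD mulNr subrr expR0 mulr1.
Qed.

Let continuous_transform_expR : continuous (@transform R expR).
Proof. by apply: der_continuous => x; eexists; exact: der_transform_expR. Qed.

Let measurable_transform_expR : measurable_fun setT (@transform R expR).
Proof. exact: continuous_measurable. Qed.

Lemma gaussM (a x : R) : gauss (a * x) = expR (- (a ^+ 2 * (x ^+ 2 / 2))).
Proof. by rewrite /gauss; congr expR; field. Qed.

Section dimensions.
Variables k m : nat.
Hypothesis k0 : (0 < k)%N.
Local Notation d := (k + m)%N.

Let kR : 0 < k%:R :> R. Proof. by rewrite ltr0n. Qed.
Let dR : 0 < d%:R :> R. Proof. by rewrite ltr0n addn_gt0 k0. Qed.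
Let kn : k%:R != 0 :> R. Proof. by rewrite gt_eqF. Qed.
Let dn : d%:R != 0 :> R. Proof. by rewrite gt_eqF. Qed.
Let sk0 : Num.sqrt k%:R != 0 :> R. Proof. by rewrite gt_eqF // sqrtr_gt0. Qed.
Let sd0 : Num.sqrt d%:R != 0 :> R. Proof. by rewrite gt_eqF // sqrtr_gt0. Qed.
Let sk2 : Num.sqrt k%:R ^+ 2 = k%:R :> R. Proof. by rewrite sqr_sqrtr // ltW. Qed.
Let sd2 : Num.sqrt d%:R ^+ 2 = d%:R :> R. Proof. by rewrite sqr_sqrtr // ltW. Qed.
Let dkm : d%:R = k%:R + m%:R :> R. Proof. by rewrite natrD. Qed.

Let fext (y : R) := Phir (y / Num.sqrt k%:R) ^+ m * gauss y.

Let external_integrandE : external_integrand k m = (fun y : R => (fext y)%:C%C).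
Proof.
apply/funext => y; rewrite /external_integrand /gauss_integrand Phi_real.
by rewrite -rmorphXn -rmorphM.
Qed.

Let fext_int : leb.-integrable setT (EFin \o fext).
Proof.
apply: (integrable_gauss_bound (c := 1)).
  apply: measurable_funM; last exact: measurable_gauss.
  apply: measurable_funX.
  apply: (@measurableT_comp _ _ _ _ _ _ Phir); last exact: measurable_funM.
  apply: measurable_funM => //; apply: measurable_funM => //.
  exact: measurable_gauss.
move=> y; rewrite /fext normrM (ger0_norm (gauss_ge0 y)) ler_wpM2r ?gauss_ge0 //.
have /andP[P0 P1] := Phir01 (y / Num.sqrt k%:R).
by rewrite ger0_norm ?exprn_ge0 // exprn_ile1.
Qed.

Lemma cintegrable_external : cintegrable setT (@external_integrand R k m).
Proof.
rewrite external_integrandE; split => /=; first exact: fext_int.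
exact: integrable0.
Qed.

(** The scale of the final substitutions. Its square is the determinant 1 - m/d = k/d of I - J/d;
    the inverse square is 1 + m/k = d/k, that of I + J/k. *)
Let r := Num.sqrt k%:R / Num.sqrt d%:R : R.

Let r0 : r != 0. Proof. by rewrite mulf_neq0 // invr_eq0. Qed.
Let rgt0 : 0 < r. Proof. by rewrite divr_gt0 // sqrtr_gt0. Qed.

(** The Laplace variable enters as y / sqrt d. Each factor is exp(y^2/(2d)) times a value of [Phi],
    up to a constant, so m of them leave the weight exp(-(k/d) y^2/2). The substitution by [r]
    restores the standard weight and turns the argument into y / sqrt k. *)
Lemma external_mass : exists2 a : R,
  wgt_mass half_line (- (d%:R)^-1) m 0 = a%:E &
  (a / (s2pi ^+ m / r))%:C%C = gauss_integral (@external_integrand R k m).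
Proof.
pose kap : R := (Num.sqrt d%:R)^-1.
have kap2 : kap ^+ 2 = (d%:R)^-1 by rewrite exprVn sd2.
have fE y : gauss y * expR (kap * y * 0) * transform expR (kap * y) ^+ m =
    s2pi ^+ m * fext (r * y).
  rewrite mulr0 expR0 mulr1 /fext /Phir.
  have -> : r * y / Num.sqrt k%:R = kap * y by rewrite /r /kap; field; rewrite sk0 sd0.
  rewrite !exprMn exprVn.
  have -> : gauss (kap * y) ^+ m = expR (- (m%:R * kap ^+ 2 * (y ^+ 2 / 2))).
    by rewrite gaussM -expRM_natl; congr expR; ring.
  have -> : gauss (r * y) = expR (- (r ^+ 2 * (y ^+ 2 / 2))) by exact: gaussM.
  have -> : gauss y = expR (- (m%:R * kap ^+ 2 * (y ^+ 2 / 2))) * expR (- (r ^+ 2 * (y ^+ 2 / 2))).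
    rewrite -expRD /gauss; congr expR; rewrite kap2 /r exprMn exprVn sk2 sd2.
    by rewrite dkm; field; rewrite -dkm.
  by field; rewrite expf_neq0.
have := @wgt_mass_neg R half_line kap (fun y => transform expR (kap * y))
   measurable_half_line half_line_ge0 _ _ m 0.
rewrite kap2 => H.
have {}H : (s2pi%:E * wgt_mass half_line (- (d%:R)^-1) m 0 =
    (s2pi ^+ m * (\int[leb]_y fext y / r))%:E)%E.
  have mZ : measurable_fun setT (fun y : R => transform expR (kap * y)).
    by apply: (measurableT_comp measurable_transform_expR); exact: measurable_funM.
  rewrite (H mZ (fun y => transform_exprE (kap * y))).
  under eq_integral do rewrite fE EFinM.
  have gi := integrable_affine 0 r0 fext_int.
  have gi' : leb.-integrable setT (fun y => (fext (r * y))%:E).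
    by apply: eq_integrable gi => // y _ /=; rewrite addr0.
  rewrite integralZl // EFinM; congr (_ * _)%E.
  rewrite (Rintegral_affine 0 r0 fext_int) gtr0_norm // mulrC mulKf //.
  rewrite /Rintegral fineK; last exact: integrable_fin_num gi.
  by apply: eq_integral => y _; rewrite addr0.
exists (s2pi ^+ m * (\int[leb]_y fext y / r) / s2pi).
  rewrite mulrC EFinM -H muleA -EFinM mulVf // mul1e //.
rewrite /gauss_integral external_integrandE cintegral_real -rmorphM; congr (_%:C)%C.
by field; rewrite s2pi_neq0 r0 expf_neq0.
Qed.

Let X (y : R) := transform cos y.
Let Y (y : R) := transform sin y.

Let transform_cosE (x : R) :
  (\int[leb]_t (half_line t * gauss t * cos (x * t))%:E = (X x)%:E)%E.
Proof. exact: transformE (integrable_transform_cos x). Qed.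

Let transform_sinE (x : R) :
  (\int[leb]_t (half_line t * gauss t * sin (x * t))%:E = (Y x)%:E)%E.
Proof. exact: transformE (integrable_transform_sin x). Qed.

Let X_bound x : `|X x| <= s2pi.
Proof.
apply: (@cos_moment_bound R half_line 1 X measurable_half_line half_line_ge0 half_line_le1).
by move=> y; rewrite mul1r transform_cosE.
Qed.

Let Y_bound x : `|Y x| <= s2pi.
Proof.
apply: (@sin_moment_bound R half_line 1 Y measurable_half_line half_line_ge0 half_line_le1).
by move=> y; rewrite mul1r transform_sinE.
Qed.

Let measurable_X : measurable_fun setT X.
Proof.
apply: continuous_measurable; apply: der_continuous => x; eexists.
exact: der_transform_cos.
Qed.

Let measurable_Y : measurable_fun setT Y.
Proof.
apply: continuous_measurable; apply: der_continuous => x; eexists.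
exact: der_transform_sin.
Qed.

Let XN x : X (- x) = X x.
Proof. by rewrite /X !transform_cos sqrrN. Qed.

Let YN x : Y (- x) = - Y x.
Proof.
have i := integrable_transform_sin x.
rewrite /Y /transform -[RHS]mulN1r -RintegralZl //.
by apply: eq_Rintegral => t _; rewrite mulNr sinN mulN1r mulrN.
Qed.

(** Conjugate symmetry under a change of sign of the frequency; it makes the imaginary part of the
    internal integrand odd. *)
Let cpowN x : complex.Im (cpow X Y m (- x)) = - complex.Im (cpow X Y m x) /\
  complex.Re (cpow X Y m (- x)) = complex.Re (cpow X Y m x).
Proof.
elim: m => [|n [IHi IHr]]; first by rewrite /cpow !expr0 /= oppr0.
by rewrite !Re_cpowS !Im_cpowS IHi IHr XN YN; split; ring.
Qed.

Let weight (y : R) := gauss y * (expR (y ^+ 2 / d%:R / 2) / s2pi) ^+ m.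
Let fre (y : R) := weight y * complex.Re (cpow X Y m (y / Num.sqrt d%:R)).
Let fim (y : R) := weight y * complex.Im (cpow X Y m (y / Num.sqrt d%:R)).

Let internal_integrandE :
  internal_integrand d m = (fun y : R => (fre y +i* fim y)%C).
Proof.
apply/funext => y; rewrite /internal_integrand /gauss_integrand Phi_imag.
rewrite exprMn -rmorphXn -/(cpow X Y m _) -/(gauss y).
have -> : (y / Num.sqrt d%:R) ^+ 2 = y ^+ 2 / d%:R by rewrite exprMn exprVn sd2.
rewrite /fre /fim /weight.
case: (cpow X Y m _) => p q.
by apply/eqP; rewrite eq_complex /=; apply/andP; split; apply/eqP; ring.
Qed.

(** The m factors exp(y^2/(2d)) from [Phi] at imaginary arguments use up m/d of the Gaussian
    exponent. The remainder k/d is positive and secures integrability. *)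
Let weightE y : weight y = (s2pi ^+ m)^-1 * gauss (r * y).
Proof.
rewrite /weight exprMn exprVn -expRM_natl [LHS]mulrA [RHS]mulrC; congr (_ * _).
rewrite gaussM /gauss -expRD; congr expR; rewrite /r exprMn exprVn sk2 sd2.
by rewrite dkm; field; rewrite -dkm.
Qed.

Let int_bound (f : R -> R) : measurable_fun setT f ->
  (forall y, `|f y| <= (2 * s2pi) ^+ m) ->
  leb.-integrable setT (EFin \o (fun y => weight y * f y)).
Proof.
move=> mf fb.
have gi : leb.-integrable setT (EFin \o (fun y => 2 ^+ m * gauss (r * y))).
  have := integrable_affine 0 r0 integrable_gauss => gi0.
  have gi1 : leb.-integrable setT (EFin \o (fun y => gauss (r * y))).
    by apply: eq_integrable gi0 => // y _ /=; rewrite addr0.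
  exact: (integrableZl _ (2 ^+ m) gi1).
apply: le_integrable gi => //.
  apply/measurable_EFinP; apply: measurable_funM => //.
  rewrite (funext weightE); apply: measurable_funM => //.
  by apply: (measurableT_comp measurable_gauss); exact: measurable_funM.
move=> y _ /=; rewrite lee_fin weightE.
have s0 : 0 < s2pi ^+ m by rewrite exprn_gt0 // s2pi_gt0.
rewrite !normrM (ger0_norm (gauss_ge0 _)) ger0_norm ?invr_ge0 ?(ltW s0) // [`|2 ^+ m|]ger0_norm //.
rewrite mulrAC ler_wpM2r ?gauss_ge0 // mulrC ler_pdivrMr // -exprMn.
exact: fb.
Qed.

Let cpow_args y := cpow_bound m (X_bound y) (Y_bound y).

Let measurable_cpowXY : measurable_fun setT (fun y : R => complex.Re (cpow X Y m
  (y / Num.sqrt d%:R))) /\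
  measurable_fun setT (fun y : R => complex.Im (cpow X Y m (y / Num.sqrt d%:R))).
Proof.
have [mRe mIm] := measurable_cpow m measurable_X measurable_Y.
split; [apply: (measurableT_comp mRe)|apply: (measurableT_comp mIm)];
  exact: measurable_funM.
Qed.

Let fre_int : leb.-integrable setT (EFin \o fre).
Proof.
apply: int_bound; first by have [] := measurable_cpowXY.
by move=> y; have [] := cpow_args (y / Num.sqrt d%:R).
Qed.

Let fim_int : leb.-integrable setT (EFin \o fim).
Proof.
apply: int_bound; first by have [] := measurable_cpowXY.
by move=> y; have [] := cpow_args (y / Num.sqrt d%:R).
Qed.

Lemma cintegrable_internal : cintegrable setT (@internal_integrand R d m).
Proof.
by rewrite internal_integrandE; split => /=; [exact: fre_int|exact: fim_int].
Qed.

Let integral_fim : \int[leb]_y fim y = 0.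
Proof.
have n1 : -1 != 0 :> R by rewrite oppr_eq0 oner_eq0.
have e := Rintegral_affine 0 n1 fim_int.
have : \int[leb]_y fim y = - \int[leb]_y fim y.
  rewrite {1}e normrN1 mul1r -[RHS]mulN1r -RintegralZl //.
  apply: eq_Rintegral => y _; rewrite addr0 !mulN1r /fim !weightE mulrN mulNr.
  by have [-> _] := cpowN (y / Num.sqrt d%:R); rewrite gaussN mulrN.
by move=> /eqP; rewrite -addr_eq0 -mulr2n mulrn_eq0 /= => /eqP.
Qed.

(** The Fourier side has the standard weight and argument y / sqrt k; the substitution by [r^-1]
    matches it with the weight and the argument y / sqrt d of [fre]. The imaginary part vanishes by
    oddness. *)
Lemma internal_mass : exists2 a : R,
  wgt_mass half_line (k%:R)^-1 m 0 = a%:E &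
  (a / (s2pi ^+ m / r^-1))%:C%C = gauss_integral (@internal_integrand R d m).
Proof.
pose kap : R := (Num.sqrt k%:R)^-1.
have kap2 : kap ^+ 2 = (k%:R)^-1 by rewrite exprVn sk2.
have rV0 : r^-1 != 0 by rewrite invr_eq0.
have rVgt0 : 0 < r^-1 by rewrite invr_gt0.
have fE y : gauss y * (cos (kap * y * 0) *
  complex.Re (cpow (fun y => X (kap * y)) (fun y => Y (kap * y)) m y)
    - sin (kap * y * 0) * complex.Im (cpow (fun y => X (kap * y)) (fun y => Y (kap * y)) m y)) =
    s2pi ^+ m * fre (r^-1 * y).
  rewrite mulr0 cos0 sin0 mul0r subr0 mul1r /fre weightE.
  have -> : r^-1 * y / Num.sqrt d%:R = kap * y.
    by rewrite /r /kap; field; rewrite sk0 sd0.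
  by rewrite -[_ * gauss _ * _]mulrA mulVKf ?expf_neq0 // mulVKf.
have mX : measurable_fun setT (fun y : R => X (kap * y)).
  by apply: (measurableT_comp measurable_X); exact: measurable_funM.
have mY : measurable_fun setT (fun y : R => Y (kap * y)).
  by apply: (measurableT_comp measurable_Y); exact: measurable_funM.
have := @wgt_mass_pos R half_line kap _ _
   measurable_half_line half_line_ge0 half_line_le1 mX mY
   (fun y => transform_cosE (kap * y)) (fun y => transform_sinE (kap * y)) m 0.
under eq_integral do rewrite fE EFinM.
have gi := integrable_affine 0 rV0 fre_int.
have gi' : leb.-integrable setT (fun y => (fre (r^-1 * y))%:E).
  by apply: eq_integrable gi => // y _ /=; rewrite addr0.
rewrite integralZl // kap2.
have -> : (\int[leb]_y (fre (r^-1 * y))%:E = (\int[leb]_y fre y / r^-1)%:E)%E.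
  rewrite (Rintegral_affine 0 rV0 fre_int) gtr0_norm // mulrC mulKf //.
  rewrite /Rintegral fineK; last exact: integrable_fin_num gi.
  by apply: eq_integral => y _; rewrite addr0.
rewrite -EFinM => H.
exists (s2pi ^+ m * (\int[leb]_y fre y / r^-1) / s2pi).
  rewrite [_ / s2pi]mulrC EFinM -H muleA -EFinM mulVf // mul1e //.
rewrite /gauss_integral internal_integrandE /cintegral /= integral_fim.
apply/eqP; rewrite eq_complex /=; apply/andP; split; apply/eqP; last by ring.
by field; rewrite s2pi_neq0 r0 expf_neq0.
Qed.

End dimensions.
End angle_integrals.

(** * Cones with prescribed Gram matrix *)

Section model_cones.
Context {R : realType}.
Local Notation s2pi := (Num.sqrt (2 * pi) : R).

(** Since J^2 = mJ, the matrices 1 + aJ are closed under products; inverses and square roots then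
    come from solving for the coefficient. *)
Lemma mul_scalar_const m (a b : R) :
  (1%:M + const_mx a : 'M[R]_m) *m (1%:M + const_mx b) =
  1%:M + const_mx (a + b + m%:R * a * b).
Proof.
rewrite mulmxDl mul1mx mulmxDr mulmx1 -addrA; congr (_ + _).
apply/matrixP => i j; rewrite !mxE.
under eq_bigr do rewrite !mxE.
by rewrite sumr_const card_ord -mulr_natl; ring.
Qed.

Lemma invertible_gram m (c : R) : 0 < 1 + m%:R * c ->
  (1%:M + const_mx c : 'M[R]_m) *m (1%:M + const_mx (- c / (1 + m%:R * c))) = 1%:M.
Proof.
move=> mc; rewrite mul_scalar_const (_ : _ + _ + _ = 0).
  by apply/matrixP => i j; rewrite !mxE addr0.
by field; rewrite gt_eqF.
Qed.

Lemma sqrt_gram m (c : R) : 0 < 1 + m%:R * c -> exists b : R,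
  (1%:M + const_mx b : 'M[R]_m) *m (1%:M + const_mx b) = 1%:M + const_mx c.
Proof.
(* The coefficient [b] solves (1 + m b)^2 = 1 + m c. For m = 0 the division gives 0 and the matrices
   are empty. *)
move=> mc; exists ((Num.sqrt (1 + m%:R * c) - 1) / m%:R).
rewrite mul_scalar_const.
case: m mc => [|m] mc; first by apply/matrixP => -[].
congr (_ + const_mx _).
set q := Num.sqrt _; have q2 : q ^+ 2 = 1 + m.+1%:R * c by rewrite sqr_sqrtr // ltW.
have m0 : m.+1%:R != 0 :> R by rewrite pnatr_eq0.
transitivity ((q ^+ 2 - 1) / m.+1%:R); first by field.
by rewrite q2; field.
Qed.

Lemma tr_gram m (c : R) : (1%:M + const_mx c : 'M[R]_m)^T = 1%:M + const_mx c.
Proof. by rewrite linearD /= trmx1 trmx_const. Qed.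

Definition model_gram l m (c : R) : 'M[R]_(l + m) :=
  block_mx 1%:M 0 0 (1%:M + const_mx c).

Lemma model_gram_unit l m (c : R) : 0 < 1 + m%:R * c -> model_gram l m c \in unitmx.
Proof.
move=> mc; have := invertible_gram mc => /mulmx1_unit[u _].
by rewrite unitmxE det_ublock det1 mul1r -unitmxE.
Qed.

(* [K] is isometric to the orthogonal sum of R^l and a simplicial cone spanned by
   m vectors with Gram matrix [1 + c J]. *)
Definition model_cone l m (c : R) (K : ip_cone R) : Prop :=
  exists (G : 'M[R]_(amb K)) (w : 'M[R]_(l + m, amb K)),
    [/\ forall u v, ip K u v = (u *m G *m v^T) 0 0,
        w *m G *m w^T = model_gram l m c &
        carrier K = [set s *m w | s in @halfspaces R l m]].

Lemma form_rows p q n (A : 'M[R]_(p, n)) (G : 'M[R]_n) (B : 'M[R]_(q, n)) i j :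
  (row i A *m G *m (row j B)^T) 0 0 = (A *m G *m B^T) i j.
Proof. by rewrite -row_mul !mxE; apply: eq_bigr => k _; rewrite !mxE. Qed.

Lemma form_mul p q r n (s : 'M[R]_(r, p)) (t : 'M[R]_(q, p)) (w : 'M[R]_(p, n)) (G : 'M[R]_n) :
  s *m w *m G *m (t *m w)^T = s *m (w *m G *m w^T) *m t^T.
Proof. by rewrite trmx_mul !mulmxA. Qed.

Section one_cone.
Variables (l m : nat) (c : R).
Hypothesis mc : 0 < 1 + m%:R * c.

Lemma gram_right_inverse n (G : 'M[R]_n) (w : 'M[R]_(l + m, n)) :
  w *m G *m w^T = model_gram l m c ->
  w *m (G *m w^T *m invmx (model_gram l m c)) = 1%:M.
Proof. by move=> wG; rewrite !mulmxA wG mulmxV // model_gram_unit. Qed.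

Lemma lin_hull_model n (w : 'M[R]_(l + m, n)) :
  lin_hull [set s *m w | s in @halfspaces R l m] = range (fun s => s *m w).
Proof.
apply/seteqP; split=> [y [q [p [a [pK ->]]]]|_ [s _ <-]].
  have /choice[t tE] : forall i, exists s, s *m w = p i.
    by move=> i; have [s _ <-] := pK i; exists s.
  exists (\sum_i a i *: t i) => //.
  by rewrite mulmx_suml; apply: eq_bigr => i _; rewrite -scalemxAl tE.
exists (l + m)%N, (fun i => row i w), (fun i => s 0 i); split; last exact: mulmx_sum_row.
move=> i; exists (delta_mx 0 i); last by rewrite -rowE.
by move=> j; rewrite !mxE eqxx /= ler0n.
Qed.

(** The isometry has to send [s *m w] to [s *m w']. A matrix on the ambient space doing so comes
    from a right inverse of [w], provided by the invertible Gram matrix. *)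
Lemma model_cone_isometric (K L : ip_cone R) :
  model_cone l m c K -> model_cone l m c L -> isometric K L.
Proof.
move=> [G [w [ipK wG carK]]] [G' [w' [ipL wG' carL]]].
set B := G *m w^T *m invmx (model_gram l m c).
have wB : w *m B = 1%:M := gram_right_inverse wG.
have wM s : s *m w *m (B *m w') = s *m w' by rewrite mulmxA -[_ *m B]mulmxA wB mulmx1.
exists (B *m w'); rewrite carK carL !lin_hull_model; split.
- move=> _ _ [s _ <-] [t _ <-]; rewrite !wM ipK ipL.
  by rewrite !form_mul wG wG'.
- apply/seteqP; split=> [_ [_ [s _ <-] <-]|_ [s _ <-]].
    by exists s => //; rewrite wM.
  by exists (s *m w); [exists s|rewrite wM].
- apply/seteqP; split=> [_ [_ [s hs <-] <-]|_ [s hs <-]].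
    by exists s => //; rewrite wM.
  by exists (s *m w); [exists s|rewrite wM].
Qed.

Lemma model_cone_angle (K : ip_cone R) (a b : R) : model_cone l m c K ->
  wgt_mass half_line c m 0 = a%:E -> wgt_mass (fun=> 1) c m 0 = b%:E ->
  solid_angle K = a / b.
Proof.
move=> [G [w [ipK wG carK]]] ma mb.
(* Two obligations: every orthonormal basis of the hull gives [a / b], and some basis exists, which
   excludes the default value 0. *)
rewrite /solid_angle; case: xgetP => [alpha _ [p [E [[Eon Elin] ->]]]|none]; last first.
  have [q qq] := sqrt_gram mc.
  (* [W] is a square root of the Gram matrix, so the rows of [invmx W *m w] are orthonormal. *)
  pose W : 'M[R]_(l + m) := block_mx 1%:M 0 0 (1%:M + const_mx q).
  have WW : W *m W^T = model_gram l m c.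
    rewrite tr_block_mx mulmx_block !trmx0 !trmx1 tr_gram.
    by rewrite !mulmx0 !mul0mx !mulmx1 addr0 !add0r qq.
  have uW : W \in unitmx by have := model_gram_unit l mc; rewrite -WW unitmx_mul => /andP[].
  exfalso; apply: (none (coord_vol (invmx W *m w) (carrier K `&` @unit_ball R K) /
    coord_vol (invmx W *m w) (lin_hull (carrier K) `&` @unit_ball R K))).
  exists (l + m)%N, (invmx W *m w); split => //; split.
    move=> i j; rewrite ipK form_rows form_mul wG -WW mulmxA.
    by rewrite mulVmx // mul1mx -trmx_mul mulVmx // trmx1 mxE.
  rewrite carK lin_hull_model; apply/seteqP; split=> [_ [s _ <-]|_ [s _ <-]].
    by exists (s *m W) => //; rewrite mulmxA mulmxK.
  by exists (s *m invmx W) => //; rewrite mulmxA.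
have EGE : E *m G *m E^T = 1%:M.
  by apply/matrixP => i j; rewrite -form_rows -ipK Eon mxE.
have range_eq : range (fun s : 'rV_p => s *m E) = range (fun s => s *m w).
  by rewrite -Elin carK lin_hull_model.
have EB : E *m (G *m E^T) = 1%:M by rewrite mulmxA.
have wB := gram_right_inverse wG.
have Erank : \rank E = p.
  apply/eqP; rewrite eqn_leq rank_leq_row /=.
  by have := mxrankM_maxl E (G *m E^T); rewrite EB mxrank1.
have wrank : \rank w = (l + m)%N.
  apply/eqP; rewrite eqn_leq rank_leq_row /=.
  by have := mxrankM_maxl w (G *m w^T *m invmx (model_gram l m c)); rewrite wB mxrank1.
have Ew : (E <= w)%MS.
  apply/row_subP => i; have : range (fun s => s *m w) (row i E).
    by rewrite -range_eq; exists (delta_mx 0 i) => //; rewrite -rowE.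
  by move=> [s _ <-]; exact: submxMl.
have wE : (w <= E)%MS.
  apply/row_subP => i; have : range (fun s : 'rV_p => s *m E) (row i w).
    by rewrite range_eq; exists (delta_mx 0 i) => //; rewrite -rowE.
  by move=> [s _ <-]; exact: submxMl.
(* [E] and [w] are both bases of the hull, which forces their sizes to agree. *)
have pE : p = (l + m)%N.
  by apply/eqP; have := mxrankS Ew; have := mxrankS wE; rewrite Erank wrank eqn_leq => -> ->.
subst p; have /submxP[W WE] := wE.
have WW : W *m W^T = model_gram l m c.
  by rewrite -wG WE form_mul EGE mulmx1.
have uW : W \in unitmx by have := model_gram_unit l mc; rewrite -WW unitmx_mul => /andP[].
rewrite -(solid_angle_gauss uW WW ma mb) /coord_vol.
have ball t : @unit_ball R K (t *m E) = (dot t t <= 1)%R :> Prop.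
  by rewrite /unit_ball /= ipK form_mul EGE mulmx1 -dotE.
have -> : [set t | (carrier K `&` @unit_ball R K) (t *m E)] =
    [set t | @halfspaces R l m (t *m invmx W)] `&` [set t | dot t t <= 1].
  apply/seteqP; split=> t /=; rewrite ball carK => -[ht tt]; split => //.
    move: ht => [s hs sw]; suff -> : t = s *m W by rewrite mulmxK.
    by rewrite -[LHS]mulmx1 -[RHS]mulmx1 -EB !mulmxA -sw WE !mulmxA.
  by exists (t *m invmx W) => //; rewrite WE mulmxA mulmxKV.
have -> // : [set t | (lin_hull (carrier K) `&` @unit_ball R K) (t *m E)] =
    [set t | dot t t <= 1].
apply/seteqP; split=> t /=; first by rewrite ball => -[].
by rewrite ball => tt; split => //; rewrite Elin; exists t.
Qed.

End one_cone.
End model_cones.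

Section orthocentric_models.
Context {R : realType}.

Lemma model_gram0 m (c : R) : model_gram 0 m c = 1%:M + const_mx c.
Proof.
apply/matrixP => i j; rewrite /model_gram.
rewrite -[i in LHS](_ : rshift 0 i = i); last exact/val_inj.
rewrite -[j in LHS](_ : rshift 0 j = j); last exact/val_inj.
by rewrite block_mxEdr.
Qed.

Lemma halfspaces0 m :
  @halfspaces R 0 m = [set s : 'rV[R]_m | forall i, 0 <= s 0 i].
Proof.
apply/seteqP; split=> s /= s0 i; have := s0 i; rewrite mxE (_ : rshift 0 i = i) //;
  exact/val_inj.
Qed.

Let orthocentric_data m (l0 : R) (K : ip_cone R) :
  orthocentric_cone l0 (fun _ : 'I_m => 1) (fun=> 1) K ->
  exists N (V : 'M[R]_(m, N)), V *m V^T = 1%:M + const_mx l0^-1 /\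
    K = IPCone (@dot R N) [set s *m V | s in [set s : 'rV[R]_m | forall i, 0 <= s 0 i]].
Proof.
move=> [_ _ _ [N [v [_ vv ->]]]]; exists N, (\matrix_(i < m) v i); split.
  apply/matrixP => i j; rewrite [in RHS]mxE [1%:M _ _]mxE [const_mx _ _ _]mxE.
  have := vv i j; rewrite /dot divr1 addrC => <-.
  by rewrite mxE; apply: eq_bigr => k _; rewrite !mxE.
congr IPCone; apply/seteqP; split=> [y [c [c0 ->]]|_ [s s0 <-]].
  exists (\row_i c i); first by move=> i; rewrite mxE.
  rewrite mulmx_sum_row; apply: eq_bigr => i _.
  by rewrite mxE rowK scale1r.
exists (fun i => s 0 i); split => //.
rewrite mulmx_sum_row; apply: eq_bigr => i _.
by rewrite rowK scale1r.
Qed.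

Lemma oplus_orthocentric_model l m (l0 : R) (K : ip_cone R) :
  orthocentric_cone l0 (fun _ : 'I_m => 1) (fun=> 1) K ->
  model_cone l m l0^-1 (oplus (euclidean_space l) K).
Proof.
move=> /orthocentric_data[N [V [VV ->]]].
exists 1%:M, (block_mx 1%:M 0 0 V); split => /=.
- move=> u v; rewrite mulmx1 !dotE -[u in RHS]hsubmxK -[v in RHS]hsubmxK.
  by rewrite tr_row_mx mul_row_col [RHS]mxE.
- rewrite mulmx1 tr_block_mx mulmx_block !trmx0 trmx1.
  by rewrite !mulmx0 !mul0mx mulmx1 addr0 !add0r VV.
- apply/seteqP; split=> [u [_ [s s0 su]]|_ [s s0 <-]].
    exists (row_mx (lsubmx u) s).
      by move=> j; rewrite row_mxKr.
    by rewrite mul_row_block !mulmx0 mulmx1 addr0 add0r su hsubmxK.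
  rewrite -[s]hsubmxK mul_row_block !mulmx0 mulmx1 addr0 add0r /= row_mxKr.
  by split => //; exists (rsubmx s).
Qed.

Lemma orthocentric_model m (l0 : R) (K : ip_cone R) :
  orthocentric_cone l0 (fun _ : 'I_m => 1) (fun=> 1) K -> model_cone 0 m l0^-1 K.
Proof.
move=> /orthocentric_data[N [V [VV ->]]].
exists 1%:M, V; split => /=.
- by move=> u v; rewrite mulmx1 dotE.
- by rewrite mulmx1 VV model_gram0.
- by rewrite halfspaces0.
Qed.

(** The rows of a square root of the Gram matrix serve as generators. *)
Lemma orthocentric_exists m (l0 : R) : l0 != 0 -> 0 < 1 + m%:R * l0^-1 ->
  exists K, orthocentric_cone l0 (fun _ : 'I_m => 1) (fun=> 1) K.
Proof.
move=> l0n mc; have [q qq] := sqrt_gram mc.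
pose V : 'M[R]_m := 1%:M + const_mx q.
have VV : V *m V^T = 1%:M + const_mx l0^-1 by rewrite tr_gram.
exists (IPCone (@dot R m) (pos_hull (fun i => 1 *: row i V))); split=> //.
- by move=> i; left.
exists m, (fun i => row i V); split=> //.
- rewrite (_ : \matrix_i row i V = V); last by apply/row_matrixP => i; rewrite rowK.
  rewrite row_free_unit.
  by have := invertible_gram mc; rewrite -qq => /mulmx1_unit[]; rewrite unitmx_mul => /andP[].
- move=> i j; rewrite dotE -[row i V]mulmx1 form_rows mulmx1 VV !mxE divr1.
  by rewrite addrC.
Qed.

End orthocentric_models.

Section cones_of_normals.
Context {R : realType}.

Definition posdef n (S : 'M[R]_n) := forall x : 'rV[R]_n, x != 0 -> 0 < (x *m S *m x^T) 0 0.

(** Gram-Schmidt by blocks: [W1] clears the first row and column beside the pivot, and the Schur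
    complement [D'] is positive definite because it is the form [S] on the vectors
    [row_mx 0 y *m W1]. *)
Lemma posdef_orthonormalize n (S : 'M[R]_n) : S^T = S -> posdef S ->
  exists2 W : 'M[R]_n, W \in unitmx & W *m S *m W^T = 1%:M.
Proof.
elim: n S => [|n IH] S symS posS; first by exists 1%:M; [exact: unitmx1|apply/matrixP => -[]].
change 'M[R]_(1 + n) in S.
set a := S 0 0.
have a0 : 0 < a.
  have /posS : delta_mx 0 0 != 0 :> 'rV[R]_(1 + n).
    by apply/eqP => /matrixP/(_ 0 0); rewrite !mxE !eqxx => /eqP; rewrite oner_eq0.
  by rewrite -rowE trmx_delta -colE !mxE.
pose b := ursubmx S; pose D := drsubmx S.
have Sab : S = block_mx (a%:M : 'rV_1) b b^T D.
  rewrite -[LHS]submxK; congr block_mx.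
    by rewrite [LHS]mx11_scalar; congr (_%:M); rewrite !mxE !lshift0.
  by rewrite -[S in LHS]symS -trmx_ursub.
pose D' := D - a^-1 *: (b^T *m b).
pose W1 : 'M[R]_(1 + n) := block_mx 1%:M 0 (- a^-1 *: b^T) 1%:M.
have an : a != 0 by rewrite gt_eqF.
have W1S : W1 *m S *m W1^T = block_mx (a%:M : 'rV_1) 0 0 D'.
  rewrite Sab /W1 tr_block_mx !mulmx_block !trmx1 !trmx0 linearZ /= trmxK.
  rewrite !mul1mx !mulmx1 !mul0mx !mulmx0 !addr0 -!scalemxAr -!scalemxAl.
  rewrite mul_mx_scalar mul_scalar_mx !scalerA mulNr mulVf // !scaleN1r !addNr.
  by rewrite mul0mx scaler0 add0r scaleNr addrC.
have symD' : D'^T = D'.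
  rewrite /D' linearB linearZ /= trmx_mul trmxK; congr (_ - _).
  by rewrite /D trmx_drsub symS.
have posD' : posdef D'.
  move=> y y0; have : row_mx 0 y *m W1 != 0 :> 'rV[R]_(1 + n).
    apply: contraNneq y0 => /(congr1 rsubmx).
    by rewrite mul_row_block !mul0mx add0r add0r mulmx1 row_mxKr linear0 => ->.
  move=> /posS; rewrite form_mul W1S mul_row_block !mul0mx ?mulmx0 !add0r.
  by rewrite tr_row_mx mul_row_col mul0mx add0r.
have [W2 uW2 W2D] := IH D' symD' posD'.
pose W3 : 'M[R]_(1 + n) := block_mx ((Num.sqrt a)^-1)%:M 0 0 W2.
have sa0 : Num.sqrt a != 0 by rewrite gt_eqF // sqrtr_gt0.
have W3D : W3 *m block_mx (a%:M : 'rV_1) 0 0 D' *m W3^T = 1%:M.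
  rewrite tr_block_mx !mulmx_block !trmx0 tr_scalar_mx.
  rewrite !mulmx0 !mul0mx ?mulmx0 ?mul0mx !addr0 !add0r ?mulmx0 ?mul0mx W2D.
  rewrite mul_scalar_mx scale_scalar_mx mul_scalar_mx scale_scalar_mx.
  rewrite (_ : _^-1 * a * _^-1 = 1); first by rewrite -scalar_mx_block.
  by rewrite -{2}(sqr_sqrtr (ltW a0)); field.
exists (W3 *m W1).
  rewrite unitmx_mul; apply/andP; split; rewrite unitmxE.
    by rewrite (@det_ublock _ 1 n) det_scalar1 unitrM unitfE invr_eq0 sa0 -unitmxE.
  by rewrite (@det_lblock _ 1 n) !det1 mulr1 unitr1.
rewrite form_mul W1S -W3D //.
Qed.

End cones_of_normals.

(** * Normal and tangent cones from the Gram matrix of the normals *)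

Section cones_from_normals.
Context {R : realType}.
Variables (n m l : nat) (G H : 'M[R]_n) (A : 'M[R]_(m, n)) (s c : R).
Hypotheses (symG : G^T = G) (posG : posdef G) (GH : G *m H = 1%:M).
Hypotheses (s0 : 0 < s) (mc : 0 < 1 + m%:R * c) (nlm : n = (l + m)%N).
Hypothesis gramA : A *m H *m A^T = s *: (1%:M + const_mx c).
Variable ip : 'rV[R]_n -> 'rV[R]_n -> R.
Hypothesis ipE : forall u v, ip u v = (u *m G *m v^T) 0 0.

Let T := [set u : 'rV[R]_n | forall i, dot (row i A) u <= 0].

Let c' := - c / (1 + m%:R * c).
(** Inverse of the dual Gram matrix [A *m H *m A^T]; up to a factor, the Gram matrix of the edges of
    the tangent cone modulo its lineality space. *)
Let Delta : 'M[R]_m := s^-1 *: (1%:M + const_mx c').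

Let sn : s != 0. Proof. by rewrite gt_eqF. Qed.

Let HG : H *m G = 1%:M. Proof. exact: mulmx1C. Qed.

Let symH : H^T = H.
Proof.
have e : H^T *m G = 1%:M by rewrite -[in LHS]symG -trmx_mul GH trmx1.
by rewrite -[H^T]mulmx1 -GH mulmxA e mul1mx.
Qed.

Let gramDelta : A *m H *m A^T *m Delta = 1%:M.
Proof.
rewrite gramA -scalemxAl -scalemxAr scalerA mulfV // scale1r.
exact: invertible_gram.
Qed.

Let Deltagram : Delta *m (A *m H *m A^T) = 1%:M. Proof. exact: mulmx1C. Qed.

Let symDelta : Delta^T = Delta.
Proof. by rewrite /Delta linearZ /= tr_gram. Qed.

Let TE u : T u <-> forall i, (u *m A^T) 0 i <= 0.
Proof.
have e i : dot (row i A) u = (u *m A^T) 0 i.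
  by rewrite mxE; apply: eq_bigr => k _; rewrite !mxE mulrC.
by split=> Tu i; [rewrite -e|rewrite e]; exact: Tu.
Qed.

(** The projection, orthogonal for [G], onto the lineality space of [T]. *)
Let proj (u : 'rV[R]_n) := u - u *m A^T *m (Delta *m (A *m H)).

Let projA u : proj u *m A^T = 0.
Proof. by rewrite mulmxBl -!mulmxA (mulmxA A) Deltagram mulmx1 subrr. Qed.

Let sqrt_s : Num.sqrt s ^+ 2 = s. Proof. by rewrite sqr_sqrtr // ltW. Qed.
Let sqrt_s0 : Num.sqrt s != 0. Proof. by rewrite gt_eqF // sqrtr_gt0. Qed.

Let GHA : G *m (A *m H)^T = A^T.
Proof. by rewrite trmx_mul symH mulmxA GH mul1mx. Qed.

Let AHG : A *m H *m G = A. Proof. by rewrite -mulmxA HG mulmx1. Qed.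

(** Farkas for independent normals. The rows of [A *m H] represent the normals in the metric [G]; a
    polar vector is orthogonal to the lineality space, hence a combination of these rows. Division
    by sqrt s normalizes the Gram matrix. *)
Lemma normal_cone_model :
  model_cone 0 m c (IPCone ip [set v | forall u, T u -> ip v u <= 0]).
Proof.
exists G, ((Num.sqrt s)^-1 *: (A *m H)); split=> //=.
- rewrite model_gram0 linearZ /= -!scalemxAl -scalemxAr scalerA.
  rewrite -[A *m H *m G *m _]mulmxA GHA gramA scalerA.
  rewrite (_ : _ * _ * s = 1) ?scale1r //.
  by rewrite -{3}sqrt_s; field.
rewrite halfspaces0; apply/seteqP; split=> [v Nv|_ [r r0 <-] u /TE Tu] /=; last first.
  rewrite ipE -scalemxAr -!scalemxAl mxE mulr_ge0_le0 ?invr_ge0 ?sqrtr_ge0 //.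
  have -> : r *m (A *m H) *m G *m u^T = r *m (u *m A^T)^T.
    by rewrite -[r *m (A *m H) *m G]mulmxA AHG -mulmxA trmx_mul trmxK.
  by rewrite mxE sumr_le0 // => i _; rewrite mulr_ge0_le0 // mxE.
have ipN w : ip v (- w) = - ip v w by rewrite !ipE linearN /= mulmxN mxE.
have ip0 u : v *m G *m (proj u)^T = 0.
  have N1 : ip v (proj u) <= 0.
    by apply: Nv; apply/TE => i; rewrite projA mxE.
  have N2 : ip v (- proj u) <= 0.
    by apply: Nv; apply/TE => i; rewrite mulNmx projA oppr0 mxE.
  apply/matrixP => i j; rewrite !ord1 [RHS]mxE; apply: le_anti.
  by move: N1 N2; rewrite ipN oppr_le0 !ipE => -> ->.
have vGu (u : 'rV_n) : v *m G *m u^T = v *m A^T *m Delta *m A *m u^T.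
  have := ip0 u; rewrite linearB /= mulmxBr => /eqP; rewrite subr_eq0 => /eqP ->.
  rewrite 2!trmx_mul symDelta [(u *m A^T)^T]trmx_mul trmxK.
  by rewrite !mulmxA -(mulmxA v G (A *m H)^T) GHA.
have vG : v *m G = v *m A^T *m Delta *m A.
  apply/matrixP => i j; rewrite (ord1 i); have := vGu (delta_mx 0 j).
  by rewrite trmx_delta -!colE => /matrixP/(_ 0 0); rewrite !mxE.
have vE : v = (v *m A^T *m Delta) *m (A *m H).
  by rewrite mulmxA -vG -mulmxA GH mulmx1.
exists (Num.sqrt s *: (v *m A^T *m Delta)); last first.
  by rewrite -scalemxAl -scalemxAr scalerA mulfV // scale1r -vE.
move=> i; rewrite mxE mulr_ge0 ?sqrtr_ge0 //.
(* This tangent vector has product -1 with the i-th normal and 0 with the others, so it isolates the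
   i-th coefficient. *)
have : ip v (- row i (Delta *m (A *m H))) <= 0.
  apply: Nv; apply/TE => j; rewrite mulNmx -row_mul -!mulmxA (mulmxA A) Deltagram !mxE.
  by rewrite oppr_le0 ler0n.
rewrite ipN oppr_le0 ipE.
set X := Delta *m (A *m H).
have -> : (v *m G *m (row i X)^T) 0 0 = (v *m G *m X^T) 0 i.
  by rewrite !mxE; apply: eq_bigr => k _; rewrite !mxE.
by rewrite trmx_mul symDelta !mulmxA -(mulmxA v G (A *m H)^T) GHA.
Qed.

(** The generators are an orthonormal basis [B] of the lineality space and the edges dual to the
    normals. The edges are orthogonal to [B], and scaling by sqrt s gives them the Gram matrix
    [s *: Delta], which is 1 + c' J. *)
Lemma tangent_cone_model : model_cone l m c' (IPCone ip T).
Proof.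
have rankA : \rank A = m.
  apply/eqP; rewrite eqn_leq rank_leq_row /=.
  have := mxrankM_maxl A (H *m A^T *m Delta).
  by rewrite !mulmxA gramDelta mxrank1.
have rankK : \rank (kermx A^T) = l.
  by rewrite mxrank_ker mxrank_tr rankA nlm addnK.
have [B0 [B0free B0eq]] : exists B : 'M[R]_(l, n), row_free B /\ (B :=: kermx A^T)%MS.
  rewrite -rankK; exists (row_base (kermx A^T)); split.
    exact: row_base_free.
  exact: eq_row_base.
have symB : (B0 *m G *m B0^T)^T = B0 *m G *m B0^T.
  by rewrite !trmx_mul trmxK symG mulmxA.
have posB : posdef (B0 *m G *m B0^T).
  move=> x x0; rewrite -form_mul; apply: posG.
  by apply: contraNneq x0 => /eqP; rewrite (mulmx_free_eq0 _ B0free).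
have [W uW WB] := posdef_orthonormalize symB posB.
pose B := W *m B0.
have BG : B *m G *m B^T = 1%:M by rewrite form_mul.
have BA : B *m A^T = 0.
  by rewrite -mulmxA; have /sub_kermxP -> : (B0 <= kermx A^T)%MS; [rewrite B0eq|rewrite mulmx0].
have spanB u : u *m A^T = 0 -> exists t, u = t *m B :> 'rV_n.
  move=> /sub_kermxP; rewrite -B0eq => /submxP[t ->].
  by exists (t *m invmx W); rewrite mulmxA mulmxKV.
exists G, (col_mx B (- Num.sqrt s *: (Delta *m (A *m H)))); split=> //=.
- rewrite tr_col_mx mul_col_mx mul_col_row BG /model_gram.
  have BX : B *m G *m (Delta *m (A *m H))^T = 0.
    by rewrite trmx_mul symDelta -[B *m G *m _]mulmxA [G *m (_ *m _)]mulmxA GHA mulmxA BA mul0mx.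
  have XB : Delta *m (A *m H) *m G *m B^T = 0.
    have AB : A *m B^T = 0 by rewrite -[A]trmxK -trmx_mul BA trmx0.
    by rewrite -(mulmxA Delta (A *m H) G) AHG -mulmxA AB mulmx0.
  have XX : Delta *m (A *m H) *m G *m (Delta *m (A *m H))^T = Delta.
    rewrite -(mulmxA Delta (A *m H) G) AHG 2!trmx_mul symDelta symH -mulmxA.
    by rewrite !mulmxA -!mulmxA (mulmxA A H) (mulmxA (A *m H)) gramDelta mulmx1.
  set r := - Num.sqrt s; set X := Delta *m (A *m H) in BX XB XX *.
  have -> : (r *: X)^T = r *: X^T by apply/matrixP => i j; rewrite !mxE.
  rewrite -!scalemxAl -!scalemxAr BX XB XX !scaler0 scalerA.
  by rewrite /r mulrNN -expr2 sqrt_s /Delta scalerA mulfV // scale1r.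
apply/seteqP; split=> [u /TE Tu|_ [t t0 <-]].
  have [t tE] := spanB _ (projA u).
  exists (row_mx t (- (Num.sqrt s)^-1 *: (u *m A^T))).
    move=> j; rewrite row_mxKr mxE mulNr oppr_ge0.
    by rewrite mulr_ge0_le0 ?invr_ge0 ?sqrtr_ge0.
  rewrite mul_row_col -tE -scalemxAl -scalemxAr scalerA mulrNN mulVf // scale1r.
  exact: subrK.
apply/TE => i; rewrite -[t]hsubmxK mul_row_col mulmxDl -mulmxA BA mulmx0 add0r.
rewrite -scalemxAr -scalemxAl -!mulmxA (mulmxA A) Deltagram mulmx1 mxE mulNr oppr_le0.
by rewrite mulr_ge0 ?sqrtr_ge0.
Qed.

End cones_from_normals.

(** * Cones at the faces of a polytope in the Klein model *)

Section dot_product.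
Context {R : realType} {n : nat}.
Implicit Types u v x y : 'rV[R]_n.

Lemma dotC u v : dot u v = dot v u.
Proof. by apply: eq_bigr => i _; rewrite mulrC. Qed.

Lemma dotDr x u v : dot x (u + v) = dot x u + dot x v.
Proof. by rewrite /dot -big_split; apply: eq_bigr => i _; rewrite mxE mulrDr. Qed.

Lemma dotZr (a : R) x u : dot x (a *: u) = a * dot x u.
Proof. by rewrite /dot mulr_sumr; apply: eq_bigr => i _; rewrite mxE mulrCA. Qed.

Lemma dotNr x u : dot x (- u) = - dot x u.
Proof. by rewrite -scaleN1r dotZr mulN1r. Qed.

Lemma dotBr x u v : dot x (u - v) = dot x u - dot x v.
Proof. by rewrite dotDr dotNr. Qed.

Lemma dot_sumr (I : Type) (r : seq I) (P : pred I) (F : I -> 'rV[R]_n) x :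
  dot x (\sum_(i <- r | P i) F i) = \sum_(i <- r | P i) dot x (F i).
Proof.
elim/big_rec2: _ => [|i u v _ <-]; last by rewrite dotDr.
by rewrite /dot big1 // => i _; rewrite mxE mulr0.
Qed.

Lemma dot0r u : dot u 0 = 0.
Proof. by rewrite -(scale0r u) dotZr mul0r. Qed.

Lemma dot_polar u v : dot (u - v) (u - v) = dot u u + dot v v - dot u v *+ 2.
Proof. by rewrite dotBr (dotC (u - v) u) (dotC (u - v) v) !dotBr (dotC v u); ring. Qed.

Lemma enorm_ge0 u : 0 <= enorm u. Proof. exact: sqrtr_ge0. Qed.

Lemma enorm_sqr u : enorm u ^+ 2 = dot u u.
Proof. by rewrite sqr_sqrtr // dot_ge0. Qed.

Lemma enormZ (a : R) u : 0 <= a -> enorm (a *: u) = a * enorm u.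
Proof. by move=> a0; rewrite /enorm dotZZ sqrtrM ?sqr_ge0 // sqrtr_sqr ger0_norm. Qed.

Lemma dot_eq0 u : dot u u = 0 -> u = 0.
Proof.
move=> /eqP; rewrite psumr_eq0; last by move=> i _; rewrite -expr2 sqr_ge0.
move=> /allP u0; apply/rowP => i; rewrite mxE.
by have := u0 i (mem_index_enum i); rewrite mulf_eq0 orbb => /eqP.
Qed.

End dot_product.

(** * Feasible directions and relative interiors *)

Section feasible_directions.
Context {R : realType} {n : nat}.

Lemma feasible_direction (I : finType) (a : I -> 'rV[R]_n) (b : I -> R) x u :
  (forall r, dot (a r) x <= b r) ->
  (exists2 t : R, 0 < t & forall r, dot (a r) (x + t *: u) <= b r) <->
  (forall r, dot (a r) x = b r -> dot (a r) u <= 0).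
Proof.
move=> Px; split=> [[t t0 Pxt] r ar|Tu].
  by have := Pxt r; rewrite dotDr dotZr ar gerDl pmulr_rle0.
(* For an inactive constraint with [q r] nonzero, [(q r)^-1] is an admissible step; the sum replaces
   a maximum. For an active one the division by 0 gives 0. *)
pose q r := `|dot (a r) u| / (b r - dot (a r) x).
have q0 r : 0 <= q r by rewrite divr_ge0 // subr_ge0.
have Q0 : 0 < 1 + \sum_r q r by rewrite ltr_pwDl // sumr_ge0.
exists (1 + \sum_r q r)^-1; first by rewrite invr_gt0.
move=> r; rewrite dotDr dotZr -lerBrDl.
have [ar|/eqP ar] := eqVneq (dot (a r) x) (b r).
  by rewrite ar subrr mulr_ge0_le0 ?Tu // invr_ge0 ltW.
have br : 0 < b r - dot (a r) x by rewrite subr_gt0 lt_neqAle Px andbT; apply/eqP.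
rewrite mulrC ler_pdivrMr //; apply: le_trans (ler_norm _) _.
rewrite -ler_pdivrMl // mulrC -/(q r) (bigD1 r) //= addrCA lerDl.
by rewrite addr_ge0 // sumr_ge0.
Qed.

Lemma aff_hull_line (F : set 'rV[R]_n) (x y : 'rV[R]_n) (t : R) :
  F x -> F y -> aff_hull F (x + t *: (x - y)).
Proof.
move=> Fx Fy; exists 2%N, (fun i => if i == 0 then x else y),
  (fun i => if i == 0 then 1 + t else - t); split.
- by move=> i; case: ifP.
- by rewrite !big_ord_recl big_ord0 /= addr0 addrK.
- by rewrite !big_ord_recl big_ord0 /= addr0 scalerBr scaleNr scalerDl scale1r addrA.
Qed.

(** Relative interiority in the form needed: a segment from [y] to [x] can be prolonged beyond [x]
    inside the face. *)
Lemma relint_reflect (F : set 'rV[R]_n) (x y : 'rV[R]_n) : relint F x -> F y ->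
  exists2 t : R, 0 < t & F (x + t *: (x - y)).
Proof.
move=> [Fx [e e0 Fe]] Fy.
have N0 : 0 < enorm (x - y) + 1 by rewrite ltr_pwDr // enorm_ge0.
exists (e / (enorm (x - y) + 1)); first by rewrite divr_gt0.
apply: Fe; first exact: aff_hull_line.
rewrite addrC addKr enormZ ?divr_ge0 ?(ltW e0) ?(ltW N0) //.
by rewrite mulrAC ltr_pdivrMr // ltr_pM2l // ltrDl.
Qed.

End feasible_directions.

Section face_points.
Context {R : realType} {n k : nat} {kappa : R} {P : set 'rV[R]_n}.
Variable f : face_point kappa P k.
Local Notation x := (Defs.point f).

Let relx : relint (face f) x := face_point_relint f.

Let face_x : face f x. Proof. by have [] := relx. Qed.

Let face_sub y : face f y -> P y.
Proof. by have [_ [c [beta [_ ->]]]] := face_point_face f; case. Qed.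

Let Px : P x. Proof. exact: face_sub. Qed.

Let PE y : P y = (forall r : 'I_(ineqs f), dot (normal r) y <= offset r) :> Prop.
Proof. exact: (congr1 (fun S : set 'rV[R]_n => S y) (face_point_polyhedron f)). Qed.

(** If the functional were smaller at [y], it would exceed its maximum beyond [x] on the line from
    [y] through [x]. *)
Lemma tight_on_face (c : 'rV[R]_n) (beta : R) y :
  (forall z, P z -> dot c z <= beta) -> dot c x = beta -> face f y ->
  dot c y = beta.
Proof.
move=> Pc cx Fy; have [t t0 Fz] := relint_reflect relx Fy.
have := Pc _ (face_sub Fz).
rewrite dotDr dotZr dotBr cx gerDl pmulr_rle0 // subr_le0 => yc.
by apply: le_anti; rewrite yc Pc //; exact: face_sub.
Qed.

Lemma active_ineqsP (r : 'I_(ineqs f)) : active_ineqs r <-> dot (normal r) x = offset r.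
Proof.
split=> [ar|ax y Fy]; first exact: ar.
by apply: tight_on_face Fy => // z; rewrite PE.
Qed.

(** Feasibility of a direction depends on [P] and [x] alone, so it carries the tangent cone from the
    inequalities of [f] to any other description of [P]. *)
Lemma tangent_set_feasible u :
  tangent_set f u <-> exists2 t : R, 0 < t & P (x + t *: u).
Proof.
have Px' : forall r : 'I_(ineqs f), dot (normal r) x <= offset r by rewrite -PE.
have H := feasible_direction u Px'.
split=> [Tu|[t t0 Pt] r /active_ineqsP ar].
  have /H[t t0 Pt] : forall r : 'I_(ineqs f), dot (normal r) x = offset r -> dot (normal r) u <= 0.
    by move=> r /active_ineqsP; exact: Tu.
  by exists t; rewrite // PE.
by apply/H: r ar => //; exists t; rewrite // -PE.
Qed.

Section description.
Variables (I : finType) (a : I -> 'rV[R]_n) (b : I -> R).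
Hypothesis P_desc : P = [set y | forall i, dot (a i) y <= b i].

Definition active : {set I} := [set i | dot (a i) x == b i]%SET.

Let P_descE y : P y = (forall i, dot (a i) y <= b i) :> Prop.
Proof. exact: (congr1 (fun S : set 'rV[R]_n => S y) P_desc). Qed.

Lemma tangent_setP u :
  tangent_set f u <-> forall i, i \in active -> dot (a i) u <= 0.
Proof.
have Px' : forall i, dot (a i) x <= b i by rewrite -P_descE.
have H := feasible_direction u Px'.
split=> [/tangent_set_feasible[t t0 Pt] i|Tu].
  by rewrite inE => /eqP; apply/H: i; exists t; rewrite // -P_descE.
apply/tangent_set_feasible.
have /H[t t0 Pt] : forall i, dot (a i) x = b i -> dot (a i) u <= 0.
  by move=> i ai; apply: Tu; rewrite inE; apply/eqP.
by exists t; rewrite // P_descE.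
Qed.

Definition active_mx : 'M[R]_(#|active|, n) := \matrix_(i < #|active|) a (enum_val i).

Lemma tangent_set_rows :
  tangent_set f = [set u | forall i, dot (row i active_mx) u <= 0].
Proof.
apply/seteqP; split=> u.
  by move=> /tangent_setP Tu i; rewrite rowK; apply: Tu; exact: enum_valP.
move=> Tu; apply/tangent_setP => i iJ.
by have := Tu (enum_rank_in iJ i); rewrite rowK enum_rankK_in.
Qed.

(* The lineality space of the tangent cone is the direction space of the face. *)
Lemma card_active : row_free active_mx -> n = (k + #|active|)%N.
Proof.
move=> Afree; have [v [v_indep vF Faff]] := face_point_dim f.
pose D : 'M[R]_(k, n) := \matrix_(i < k) (v (lift ord0 i) - v ord0).
have sumD (t : 'rV[R]_k) : t *m D = \sum_i t 0 i *: v (lift ord0 i) - (\sum_i t 0 i) *: v ord0.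
  rewrite mulmx_sum_row scaler_suml -sumrB; apply: eq_bigr => i _.
  by rewrite rowK scalerBr.
have Dfree : row_free D.
  apply: inj_row_free => t tD.
  pose c (i : 'I_k.+1) := if unlift ord0 i is Some j then t 0 j else - \sum_j t 0 j.
  have cS (j : 'I_k) : c (lift ord0 j) = t 0 j by rewrite /c liftK.
  have c0 : c ord0 = - \sum_j t 0 j by rewrite /c unlift_none.
  have c_eq0 : forall i, c i = 0.
    apply: v_indep; rewrite big_ord_recl c0; under [X in _ + X]eq_bigr => j _ do rewrite cS.
      by rewrite addNr.
    by rewrite scaleNr addrC -sumD.
  by apply/rowP => j; rewrite mxE -cS.
have DK : (D <= kermx active_mx^T)%MS.
  apply/sub_kermxP/matrixP => i j; rewrite [RHS]mxE.
  have tight l : dot (a (enum_val j)) (v l) = b (enum_val j).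
    apply: tight_on_face (vF l) => [z|]; first by rewrite P_descE.
    by have := enum_valP j; rewrite inE => /eqP.
  transitivity (dot (a (enum_val j)) (v (lift ord0 i) - v ord0)).
    by rewrite mxE; apply: eq_bigr => l _; rewrite !mxE mulrC.
  by rewrite dotBr !tight subrr.
have aff_sub y : aff_hull (range v) y -> (y - v ord0 <= D)%MS.
  move=> [q [p [c [pv c1 ->]]]].
  have -> : \sum_i c i *: p i - v ord0 = \sum_i c i *: (p i - v ord0).
    rewrite -[v ord0 in LHS]scale1r -c1 scaler_suml -sumrB.
    by apply: eq_bigr => i _; rewrite scalerBr.
  apply: summx_sub => i _; apply: scalemx_sub; have [j _ <-] := pv i.
  have [l ->|->] := unliftP ord0 j; last by rewrite subrr sub0mx.
  by rewrite -[X in (X <= _)%MS](rowK (fun i => v (lift ord0 i) - v ord0)) row_sub.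
(* A vector orthogonal to the active normals is feasible with both signs, so the functional defining
   the face is constant along it and [x + t1 *: u] stays in the face. *)
have KD : (kermx active_mx^T <= D)%MS.
  apply/row_subP => i; set u := row i _.
  have uA : u *m active_mx^T = 0 by apply/sub_kermxP; exact: row_sub.
  have au j : j \in active -> dot (a j) u = 0.
    move=> jJ; move/matrixP/(_ 0 (enum_rank_in jJ j)): uA.
    rewrite [RHS]mxE => <-; rewrite mxE; apply: eq_bigr => l _.
    by rewrite !mxE enum_rankK_in // mulrC.
  have [t1 t10 P1] : exists2 t : R, 0 < t & P (x + t *: u).
    by apply/tangent_set_feasible/tangent_setP => j jJ; rewrite au.
  have [t2 t20 P2] : exists2 t : R, 0 < t & P (x + t *: - u).
    by apply/tangent_set_feasible/tangent_setP => j jJ; rewrite dotNr au // oppr0.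
  have F1 : face f (x + t1 *: u).
    have [_ [c [beta [Pc Fc]]]] := face_point_face f.
    have cx : dot c x = beta by have := face_x; rewrite Fc => -[].
    rewrite Fc; split => //=; rewrite dotDr dotZr cx.
    suff -> : dot c u = 0 by rewrite mulr0 addr0.
    have := Pc _ P1; have := Pc _ P2; rewrite /= !dotDr !dotZr dotNr cx !gerDl.
    rewrite mulrN oppr_le0 !(pmulr_rge0, pmulr_rle0) // => c1 c2.
    by apply: le_anti; rewrite c1 c2.
  have xD := aff_sub _ (Faff _ face_x); have yD := aff_sub _ (Faff _ F1).
  have -> : u = t1^-1 *: ((x + t1 *: u - v ord0) + (-1) *: (x - v ord0)).
    rewrite scaleN1r opprB addrA subrK [x + _]addrC addrK scalerA mulVf ?scale1r //.
    by rewrite gt_eqF.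
  by apply: scalemx_sub; apply: addmx_sub => //; exact: scalemx_sub.
have : \rank D = \rank (kermx active_mx^T).
  by apply/eqP; rewrite eqn_leq !mxrankS.
rewrite (eqP Dfree) mxrank_ker mxrank_tr (eqP Afree) => ->.
by rewrite subnK // -(eqP Afree) rank_leq_col.
Qed.

End description.
End face_points.

(** * The Klein metric and its inverse *)

Section klein_form.
Context {R : realType} {n : nat}.
Variables (kappa : R) (x : 'rV[R]_n).
Hypotheses (kappa0 : kappa <= 0) (xball : klein_ball kappa x).
Local Notation w := (1 + kappa * enorm x ^+ 2).

(** The case [kappa = 0] is included so that the same lemmas cover the Euclidean simplex: the weight
    is then 1 and the metric the standard one. *)
Lemma klein_weight_gt0 : 0 < w.
Proof.
have [k0|] := ltP kappa 0; last first.
  move=> k0; have -> : kappa = 0 by apply: le_anti; rewrite kappa0.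
  by rewrite mul0r addr0.
have xk := xball k0.
have Nk : 0 < - kappa by rewrite oppr_gt0.
have : enorm x ^+ 2 < (- kappa)^-1.
  rewrite -[ltRHS](sqr_sqrtr (_ : 0 <= (- kappa)^-1)) ?invr_ge0 ?(ltW Nk) //.
  by rewrite sqrtrV ?(ltW Nk) // ltr_pXn2r // nnegrE ?enorm_ge0 // invr_ge0 sqrtr_ge0.
by rewrite -[(- kappa)^-1]mul1r ltr_pdivlMr // => h; lra.
Qed.

Let w0 := klein_weight_gt0.
Let wn : w != 0. Proof. by rewrite gt_eqF. Qed.

Definition klein_mx : 'M[R]_n := w^-1 *: (1%:M - (kappa / w) *: (x^T *m x)).
Definition klein_inv : 'M[R]_n := w *: (1%:M + kappa *: (x^T *m x)).

Let outer_form (u v : 'rV[R]_n) : (u *m (x^T *m x) *m v^T) 0 0 = dot x u * dot x v.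
Proof.
rewrite mulmxA -mulmxA mxE big_ord1.
by rewrite -!dotE (dotC u).
Qed.

Lemma klein_metricE u v : klein_metric kappa x u v = (u *m klein_mx *m v^T) 0 0.
Proof.
rewrite /klein_metric /klein_mx -scalemxAr -scalemxAl mulmxBr mulmx1 mulmxBl.
rewrite -scalemxAr -scalemxAl !mxE.
have := outer_form u v; rewrite mxE => ->.
have := dotE u v; rewrite mxE => <-.
by field.
Qed.

Lemma klein_inv_form (u v : 'rV[R]_n) :
  (u *m klein_inv *m v^T) 0 0 = w * (dot u v + kappa * (dot x u * dot x v)).
Proof.
rewrite /klein_inv -scalemxAr -scalemxAl mulmxDr mulmx1 mulmxDl.
rewrite -scalemxAr -scalemxAl !mxE.
have := outer_form u v; rewrite mxE => ->.
by have := dotE u v; rewrite mxE => <-.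
Qed.

Lemma klein_mx_sym : klein_mx^T = klein_mx.
Proof.
rewrite /klein_mx linearZ /= linearB /= trmx1 linearZ /= trmx_mul trmxK //.
Qed.

(** Sherman-Morrison: the rank-one matrix [x^T *m x] squares to |x|^2 times itself. *)
Lemma klein_mxK : klein_mx *m klein_inv = 1%:M.
Proof.
rewrite /klein_mx /klein_inv -scalemxAl -scalemxAr scalerA mulVf // scale1r.
rewrite mulmxBl mul1mx mulmxDr mulmx1 -!scalemxAl -!scalemxAr.
have -> : x^T *m x *m (x^T *m x) = enorm x ^+ 2 *: (x^T *m x).
  rewrite mulmxA -[x^T *m x *m x^T]mulmxA [x *m x^T]mx11_scalar -dotE.
  by rewrite mul_mx_scalar -scalemxAl enorm_sqr.
rewrite scalerA -addrA -[RHS]addr0; congr (_ + _); apply/matrixP => i j; rewrite !mxE.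
by field.
Qed.

Lemma klein_mx_posdef : posdef klein_mx.
Proof.
move=> u u0; rewrite -klein_metricE.
have uu : 0 < dot u u.
  rewrite lt_neqAle dot_ge0 andbT eq_sym; apply: contraNneq u0 => e.
  by apply/eqP/dot_eq0.
rewrite /klein_metric ltr_pwDl ?divr_gt0 //.
rewrite -(mulrA kappa) -expr2 -!mulNr mulr_ge0 ?invr_ge0 ?sqr_ge0 //.
by rewrite mulr_ge0 ?sqr_ge0 // oppr_ge0.
Qed.

End klein_form.

Section cones_at_faces.
Context {R : realType} {n k : nat} {kappa : R} {P : set 'rV[R]_n}.
Hypothesis kappa0 : kappa <= 0.
Variable f : face_point kappa P k.
Local Notation x := (Defs.point f).
Variables (I : finType) (a : I -> 'rV[R]_n) (b : I -> R) (m : nat) (s c : R).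
Hypothesis P_desc : P = [set y | forall i, dot (a i) y <= b i].
Hypothesis s0 : 0 < s.
Local Notation w := (1 + kappa * enorm x ^+ 2).
Hypothesis gram : forall i j, i \in active f a b -> j \in active f a b ->
  w * (dot (a i) (a j) + kappa * (dot x (a i) * dot x (a j))) = s * ((i == j)%:R + c).
Hypothesis free : row_free (active_mx f a b).
Hypothesis mc : 0 < 1 + m%:R * c.
Hypothesis nkm : n = (k + m)%N.

Let cardJ : #|active f a b| = m.
Proof. exact: addnI (etrans (esym (card_active P_desc free)) nkm). Qed.

Let xball := face_point_ball f.

Let gramA : active_mx f a b *m klein_inv kappa x *m (active_mx f a b)^T =
  s *: (1%:M + const_mx c).
Proof.
apply/matrixP => i j; rewrite -form_rows klein_inv_form !rowK gram ?enum_valP //.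
by rewrite !mxE (inj_eq enum_val_inj).
Qed.

Lemma normal_cone_face : model_cone 0 m c (normal_cone f).
Proof.
rewrite /normal_cone /normal_set (tangent_set_rows f P_desc).
move: mc; rewrite -cardJ => mc'.
exact: (normal_cone_model (klein_mx_sym kappa x) (klein_mxK kappa0 xball) s0 mc'
  gramA (klein_metricE kappa0 xball)).
Qed.

Lemma tangent_cone_face : model_cone k m (- c / (1 + m%:R * c)) (tangent_cone f).
Proof.
rewrite /tangent_cone (tangent_set_rows f P_desc).
move: mc nkm; rewrite -cardJ => mc' nkm'.
exact: (tangent_cone_model (klein_mx_sym kappa x) (klein_mx_posdef kappa0 xball)
  (klein_mxK kappa0 xball) s0 mc' nkm' gramA (klein_metricE kappa0 xball)).
Qed.

End cones_at_faces.

(** * Cube and simplex *)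

Section gram_constants.
Context {R : realType}.
Variables (k m : nat).
Hypothesis k0 : (0 < k)%N.
Local Notation c := ((- (k + m)%:R)^-1 : R).

Let kn : k%:R != 0 :> R. Proof. by rewrite pnatr_eq0 -lt0n. Qed.
Let kmn : k%:R + m%:R != 0 :> R. Proof. by rewrite -natrD pnatr_eq0 addn_eq0 negb_and -lt0n k0. Qed.

Lemma gram_constantE : 1 + m%:R * c = k%:R / (k + m)%:R.
Proof. by rewrite natrD; field. Qed.

(** The value is k / (k + m). For k = 0, the case of ideal vertices, it would vanish and the Gram
    matrix would be singular. *)
Lemma gram_constant_gt0 : 0 < 1 + m%:R * c.
Proof. by rewrite gram_constantE divr_gt0 ?ltr0n ?addn_gt0 ?k0. Qed.

Lemma dual_gram_constant : - c / (1 + m%:R * c) = k%:R^-1.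
Proof. by rewrite gram_constantE natrD; field; rewrite kn. Qed.

End gram_constants.

Lemma row_free_gram (R : realType) (m n : nat) (A : 'M[R]_(m, n)) (t c : R) :
  0 < t -> 0 < 1 + m%:R * c -> A *m A^T = t *: (1%:M + const_mx c) -> row_free A.
Proof.
move=> t0 mc AA; rewrite /row_free eqn_leq rank_leq_row /=.
have : A *m (A^T *m (t^-1 *: (1%:M + const_mx (- c / (1 + m%:R * c))))) = 1%:M.
  rewrite mulmxA AA -scalemxAl -scalemxAr scalerA mulfV ?gt_eqF // scale1r.
  exact: invertible_gram.
by move=> E; have := mxrankM_maxl A (A^T *m (t^-1 *: (1%:M + const_mx (- c / (1 + m%:R * c)))));
  rewrite E mxrank1.
Qed.

Lemma active_mx_free (R : realType) (n k : nat) (kappa : R) (P : set 'rV[R]_n)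
    (f : face_point kappa P k) (I : finType) (a : I -> 'rV[R]_n) (b : I -> R) (t c : R) :
  0 < t -> 0 < 1 + #|active f a b|%:R * c ->
  (forall i j, i \in active f a b -> j \in active f a b ->
    dot (a i) (a j) = t * ((i == j)%:R + c)) ->
  row_free (active_mx f a b).
Proof.
move=> t0 mc gram; apply: row_free_gram t0 mc _.
apply/matrixP => i j; rewrite -{1}[active_mx f a b]mulmx1 -form_rows mulmx1.
by rewrite -dotE !rowK gram ?enum_valP // !mxE (inj_eq enum_val_inj).
Qed.

(** * The ideal cube *)

Section cube.
Context {R : realType} {n : nat} {kappa : R}.
Hypothesis kappa0 : kappa < 0.
Variables (P : set 'rV[R]_n) (k m : nat) (f : face_point kappa P k).
Hypotheses (Pcube : P = ideal_cube kappa) (k0 : (0 < k)%N) (nkm : n = (k + m)%N).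
Local Notation x := (Defs.point f).

Let beta : R := (Num.sqrt (- kappa * n%:R))^-1.
Let a (i : 'I_n * bool) : 'rV[R]_n := (-1) ^+ i.2 *: delta_mx 0 i.1.
Let b (i : 'I_n * bool) := beta.

Let n0 : 0 < n%:R :> R. Proof. by rewrite ltr0n [X in (_ < X)%N]nkm addn_gt0 k0. Qed.

Let beta0 : 0 < beta.
Proof. by rewrite invr_gt0 sqrtr_gt0 mulr_gt0 // oppr_gt0. Qed.

(** All active facets have offset [beta], so this constant is the whole contribution of the metric:
    it is the -1/d of the Gram matrix. *)
Let kappa_beta : kappa * (beta * beta) = (- (k + m)%:R)^-1.
Proof.
rewrite -nkm -expr2 exprVn sqr_sqrtr ?mulr_ge0 ?(ltW n0) //; last by rewrite oppr_ge0 ltW.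
by field; rewrite gt_eqF // lt_eqF.
Qed.

Let dot_a i y : dot (a i) y = (-1) ^+ i.2 * y 0 i.1.
Proof.
rewrite /dot (bigD1 i.1) //= big1 => [|j ji]; last first.
  by rewrite !mxE (negbTE ji) mulr0 mul0r.
by rewrite !mxE !eqxx mulr1 addr0.
Qed.

Let P_desc : P = [set y | forall i, dot (a i) y <= b i].
Proof.
rewrite Pcube; apply/seteqP; split=> y /= Py i.
  by rewrite dot_a; case: i => i [] /=; have /andP[lo hi] := Py i;
    rewrite ?expr1 ?mulN1r ?expr0 ?mul1r // lerNl.
have := Py (i, true); have := Py (i, false); rewrite !dot_a /= expr0 expr1 mul1r mulN1r lerNl.
by move=> -> ->.
Qed.

(** Opposite facets cannot both contain [x], since this would give [beta = - beta]; all other pairs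
    of normals are orthogonal. *)
Let dot_aa i j : i \in active f a b -> j \in active f a b -> dot (a i) (a j) = (i == j)%:R.
Proof.
rewrite !inE !dot_a => /eqP xi /eqP xj; rewrite !mxE eqxx /=.
have [eij|] := eqVneq i.1 j.1; last first.
  by case: i j {xi xj} => i p [j q] /= ij; rewrite xpair_eqE (negbTE ij) !mulr0.
case: i j xi xj eij => i p [j q] /= xi + eij; rewrite -eij xpair_eqE eqxx /= mulr1 => xj.
have [<-|pq] := eqVneq p q; first by rewrite -expr2 sqrr_sign.
have : b (i, p) = - b (i, q).
  by rewrite -xi -xj -mulNr; case: p q pq {xi xj} => -[] //= _; rewrite ?opprK.
by move: beta0; rewrite /b => /[swap] e; lra.
Qed.

Let free : row_free (active_mx f a b).
Proof.
apply: (@active_mx_free _ _ _ _ _ _ _ _ _ 1 0); rewrite ?mulr0 ?addr0 //.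
by move=> i j ai aj; rewrite mul1r addr0; exact: dot_aa.
Qed.

Let gram i j : i \in active f a b -> j \in active f a b ->
  (1 + kappa * enorm x ^+ 2) * (dot (a i) (a j) + kappa * (dot x (a i) * dot x (a j))) =
  (1 + kappa * enorm x ^+ 2) * ((i == j)%:R + (- (k + m)%:R)^-1).
Proof.
move=> ai aj; rewrite dot_aa // ![dot x _]dotC.
by move: ai aj; rewrite !inE => /eqP -> /eqP ->; rewrite kappa_beta.
Qed.

Lemma cube_normal_cone : model_cone 0 m (- (k + m)%:R)^-1 (normal_cone f).
Proof.
exact: (normal_cone_face (ltW kappa0) P_desc (klein_weight_gt0 (ltW kappa0) (face_point_ball f))
  gram free (gram_constant_gt0 m k0) nkm).
Qed.

Lemma cube_tangent_cone : model_cone k m k%:R^-1 (tangent_cone f).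
Proof.
rewrite -(dual_gram_constant m k0).
exact: (tangent_cone_face (ltW kappa0) P_desc (klein_weight_gt0 (ltW kappa0) (face_point_ball f))
  gram free (gram_constant_gt0 m k0) nkm).
Qed.

End cube.

(** * Regular simplices through their radial vectors *)

Section regular_simplex_geometry.
Context {R : realType} {n : nat} (v : 'I_n.+1 -> 'rV[R]_n).
Hypotheses (n0 : (0 < n)%N) (vreg : regular_simplex_vertices v).

Definition centroid : 'rV[R]_n := n.+1%:R^-1 *: \sum_i v i.
Definition radial i : 'rV[R]_n := v i - centroid.

Let Nn : n.+1%:R != 0 :> R. Proof. by rewrite pnatr_eq0. Qed.

Lemma sum_radial : \sum_i radial i = 0.
Proof.
rewrite sumrB sumr_const card_ord /centroid -scaler_nat scalerA mulfV //.
by rewrite scale1r subrr.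
Qed.

(** Polarization expresses the products by the squared lengths and the edge length s. As the radial
    vectors sum to 0, summing over one index and then over both determines the lengths, and t =
    s^2/2. *)
Lemma radial_gram : exists2 t : R, 0 < t &
  forall i j, dot (radial i) (radial j) = t * ((i == j)%:R - n.+1%:R^-1).
Proof.
have [v_indep [s vs]] := vreg.
pose j1 : 'I_n.+1 := lift ord0 (Ordinal n0).
(* A vanishing edge would make two vertices coincide, against affine independence. *)
have s0 : s ^+ 2 != 0.
  apply/eqP => s2.
  have v01 : v ord0 - v j1 = 0.
    by apply: dot_eq0; rewrite -enorm_sqr (vs _ _ (neq_lift _ _)).
  pose c i : R := (i == ord0)%:R - (i == j1)%:R.
  have sumc (F : 'I_n.+1 -> 'rV[R]_n) : \sum_i c i *: F i = F ord0 - F j1.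
    rewrite /c; under eq_bigr do rewrite scalerBl.
    rewrite sumrB (bigD1 ord0) //= big1 => [|i /negbTE ->]; last by rewrite scale0r.
    rewrite [X in _ - X](bigD1 j1) //= big1 => [|i /negbTE ->]; last by rewrite scale0r.
    by rewrite !scale1r !addr0.
  have c1 : \sum_i c i = 0.
    rewrite /c sumrB (bigD1 ord0) //= big1 => [|i /negbTE -> //].
    rewrite [X in _ - X](bigD1 j1) //= big1 => [|i /negbTE -> //].
    by rewrite !addr0 subrr.
  have := v_indep c c1; rewrite sumc v01 => /(_ erefl ord0).
  by rewrite /c eqxx subr0 => /eqP; rewrite oner_eq0.
pose q i := dot (radial i) (radial i).
have polar i j : dot (radial i) (radial j) *+ 2 = q i + q j - (i != j)%:R * s ^+ 2.
  have [<-|ij] /= := eqVneq i j; first by rewrite mul0r subr0 mulr2n.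
  rewrite mul1r -(vs _ _ ij) enorm_sqr.
  have -> : v i - v j = radial i - radial j by rewrite /radial opprB addrA subrK.
  by rewrite dot_polar -/(q i) -/(q j); ring.
have sum_neq i : \sum_(j < n.+1) (i != j)%:R * s ^+ 2 = n%:R * s ^+ 2.
  rewrite -mulr_suml; congr (_ * _).
  transitivity (\sum_(j < n.+1) (1 - (i == j)%:R) : R).
    by apply: eq_bigr => j _; case: eqP; rewrite ?subrr ?subr0.
  rewrite sumrB sumr_const card_ord (bigD1 i) //= big1 => [|j ji].
    by rewrite eqxx addr0 -natrB // subSS subn0.
  by rewrite eq_sym (negbTE ji).
have q_sum i : n.+1%:R * q i + \sum_j q j = n%:R * s ^+ 2.
  have : \sum_j dot (radial i) (radial j) *+ 2 = 0.
    by rewrite sumrMnl -dot_sumr sum_radial dot0r mul0rn.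
  under eq_bigr do rewrite polar.
  rewrite sumrB big_split /= sumr_const card_ord sum_neq => /eqP.
  by rewrite subr_eq0 => /eqP <-; rewrite mulr_natl.
have Q : \sum_j q j = n%:R * s ^+ 2 / 2.
  have : \sum_i (n.+1%:R * q i + \sum_j q j) = \sum_(i < n.+1) n%:R * s ^+ 2.
    by apply: eq_bigr => i _; exact: q_sum.
  rewrite big_split /= -mulr_sumr !sumr_const card_ord.
  by rewrite -[X in _ + X]mulr_natl -[RHS]mulr_natl -mulrDr => /(mulfI Nn) <-; field.
exists (s ^+ 2 / 2); first by rewrite divr_gt0 // lt_neqAle eq_sym s0 sqr_ge0.
have qE i : q i = s ^+ 2 / 2 * (1 - n.+1%:R^-1).
  apply: (mulfI Nn); have := q_sum i; rewrite Q => /(canRL (addrK _)) ->.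
  by field; rewrite nat1r.
move=> i j; have := polar i j; rewrite !qE.
have two : (2 : R) != 0 by [].
move=> e; apply: (mulIf two); rewrite mulr_natr e.
by case: eqP => _ /=; field.
Qed.

Variable t : R.
Hypotheses (t0 : 0 < t) (gram : forall i j,
  dot (radial i) (radial j) = t * ((i == j)%:R - n.+1%:R^-1)).

(** All radial vectors but one are independent by their Gram matrix, hence span the space. *)
Lemma radial_orthogonal y : (forall i, dot (radial i) y = 0) -> y = 0.
Proof.
move=> uy; pose U : 'M[R]_n := \matrix_(i < n) radial (lift ord0 i).
have /row_freeP[B UB] : row_free U.
  apply: (@row_free_gram _ _ _ _ t (- n.+1%:R^-1)) => //.
    by rewrite mulrN subr_gt0 ltr_pdivrMr ?ltr0n // mul1r ltr_nat.
  apply/matrixP => i j; rewrite -{1}[U]mulmx1 -form_rows mulmx1 -dotE !rowK gram.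
  by rewrite !mxE (inj_eq lift_inj).
have Uy : U *m y^T = 0.
  apply/matrixP => i j; rewrite [RHS]mxE -(uy (lift ord0 i)) mxE.
  by apply: eq_bigr => l _; rewrite !mxE ord1.
apply: trmx_inj; rewrite -[y^T]mul1mx -(mulmx1C UB) -mulmxA Uy mulmx0.
by rewrite linear0.
Qed.

(** Products with the radial vectors read off barycentric coordinates. *)
Let sumM (c : 'I_n.+1 -> R) i :
  \sum_i c i = 1 -> dot (radial i) (\sum_j c j *: v j - centroid) = t * (c i - n.+1%:R^-1).
Proof.
move=> c1; have -> : \sum_j c j *: v j - centroid = \sum_j c j *: radial j.
  rewrite -[centroid in LHS]scale1r -c1 scaler_suml -sumrB.
  by apply: eq_bigr => j _; rewrite scalerBr.
rewrite dot_sumr.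
under eq_bigr do rewrite dotZr gram mulrCA mulrBr.
rewrite -mulr_sumr sumrB -mulr_suml c1 mul1r (bigD1 i) //= big1 => [|j ji].
  by rewrite eqxx mulr1 addr0.
by rewrite eq_sym (negbTE ji) mulr0.
Qed.

(** The i-th inequality says that the i-th barycentric coordinate is nonnegative; [- radial i] is
    the outer normal of the facet opposite to [v i]. *)
Lemma conv_hull_radial : conv_hull v =
  [set y | forall i, dot (- radial i) y <= t / n.+1%:R - dot (radial i) centroid].
Proof.
have E i y : (dot (- radial i) y <= t / n.+1%:R - dot (radial i) centroid) =
    (0 <= dot (radial i) (y - centroid) / t + n.+1%:R^-1).
  rewrite dotC dotNr (dotC y) -subr_ge0 -[in RHS](pmulr_rge0 _ t0) mulrDr dotBr.
  rewrite mulrCA mulfV ?gt_eqF // mulr1; congr (_ <= _); ring.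
apply/seteqP; split=> [y [c [c0 c1 ->]] i|y /= Py].
  rewrite E sumM // mulrAC mulfV ?gt_eqF // mul1r subrK //.
pose c i := dot (radial i) (y - centroid) / t + n.+1%:R^-1.
have c1 : \sum_i c i = 1.
  rewrite big_split /= -mulr_suml.
  have -> : \sum_i dot (radial i) (y - centroid) = 0.
    under eq_bigr do rewrite dotC.
    by rewrite -dot_sumr sum_radial dot0r.
  by rewrite mul0r add0r sumr_const card_ord -[LHS]mulr_natr mulVf.
exists c; split=> // [i|]; first by rewrite -E.
apply/eqP; rewrite -subr_eq0; apply/eqP/radial_orthogonal => i.
have -> : y - \sum_j c j *: v j = (y - centroid) - (\sum_j c j *: v j - centroid).
  by rewrite opprB addrA subrK.
by rewrite dotBr sumM // /c addrK mulrCA mulfV ?gt_eqF // mulr1 subrr.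
Qed.

Section faces.
Variables (kappa : R) (P : set 'rV[R]_n) (k : nat) (f : face_point kappa P k).
Hypothesis PS : P = conv_hull v.
Local Notation x := (Defs.point f).
Definition simplex_normal i := - radial i.
Definition simplex_offset i := t / n.+1%:R - dot (radial i) centroid.

Lemma simplex_desc : P = [set y | forall i, dot (simplex_normal i) y <= simplex_offset i].
Proof. exact: etrans PS conv_hull_radial. Qed.

Lemma simplex_normal_gram i j :
  dot (simplex_normal i) (simplex_normal j) = t * ((i == j)%:R + (- n.+1%:R)^-1).
Proof. by rewrite dotNr dotC dotNr opprK dotC gram invrN. Qed.

(** With all n+1 inequalities active, the products of the radial vectors with [x - centroid] would
    add up to -t, although these vectors sum to 0. With at most n active, the Gram matrix is
    invertible. *)
Lemma simplex_active_free : row_free (active_mx f simplex_normal simplex_offset).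
Proof.
apply: (@active_mx_free _ _ _ _ _ _ _ _ _ t (- n.+1%:R)^-1) => // [|i j _ _]; last first.
  exact: simplex_normal_gram.
rewrite invrN mulrN subr_gt0 ltr_pdivrMr ?ltr0n // mul1r ltr_nat.
rewrite -[X in (_ < X)%N](card_ord n.+1) -cardsT; apply: proper_card.
rewrite properT; apply/eqP => aT.
have au i : dot (radial i) (x - centroid) = - (t / n.+1%:R).
  have : i \in active f simplex_normal simplex_offset by rewrite aT inE.
  rewrite inE dotC dotNr dotC dotBr => /eqP e.
  by rewrite -[dot (radial i) x]opprK e /simplex_offset; ring.
have : \sum_i dot (radial i) (x - centroid) = - t.
  under eq_bigr do rewrite au.
  by rewrite sumr_const card_ord -[LHS]mulr_natr mulNr divfK.
under eq_bigr do rewrite dotC.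
rewrite -dot_sumr sum_radial dot0r => e.
by move: t0; lra.
Qed.

End faces.
End regular_simplex_geometry.

(** * The ideal and the Euclidean simplex *)

Section ideal_simplex.
Context {R : realType} {n : nat} {kappa : R}.
Hypothesis kappa0 : kappa < 0.
Variables (P : set 'rV[R]_n) (k m : nat) (f : face_point kappa P k).
Hypotheses (Pideal : ideal_regular_simplex kappa P) (k0 : (0 < k)%N) (nkm : n = (k + m)%N).
Local Notation x := (Defs.point f).

Lemma ideal_simplex_cones :
  model_cone 0 m (- (k + m)%:R)^-1 (normal_cone f) /\
  model_cone k m k%:R^-1 (tangent_cone f).
Proof.
have [v [vreg v0 vnorm PE]] := Pideal.
have n0 : (0 < n)%N by rewrite [X in (_ < X)%N]nkm addn_gt0 k0.
have [t t0 gram] := radial_gram n0 vreg.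
have c0 : centroid v = 0 by rewrite /centroid v0 scaler0.
have nn : n%:R != 0 :> R by rewrite pnatr_eq0 -lt0n.
have n1n : 1 + n%:R != 0 :> R by rewrite nat1r pnatr_eq0.
have kappaN : kappa != 0 by rewrite lt_eqF.
(* The squared circumradius is t (1 - 1/(n+1)) by the Gram matrix and -1/kappa because the vertices
   are ideal. *)
have tE : kappa * t = - (n.+1%:R / n%:R).
  have : t * (1 - n.+1%:R^-1) = - kappa^-1.
    have := gram ord0 ord0; rewrite eqxx => <-; rewrite /radial c0 subr0.
    by rewrite -enorm_sqr vnorm exprVn sqr_sqrtr ?invrN // oppr_ge0 ltW.
  move=> e; have -> : t = t * (1 - n.+1%:R^-1) * n.+1%:R / n%:R by field; rewrite nn n1n.
  by rewrite e; field; rewrite ?nn ?n1n ?kappaN.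
have w0 := klein_weight_gt0 (ltW kappa0) (face_point_ball f).
set w := 1 + _ in w0.
have desc := simplex_desc t0 gram PE.
have free := simplex_active_free t0 gram f.
have gram' i j :
    i \in active f (simplex_normal v) (simplex_offset v t) ->
    j \in active f (simplex_normal v) (simplex_offset v t) ->
    w * (dot (simplex_normal v i) (simplex_normal v j)
         + kappa * (dot x (simplex_normal v i) * dot x (simplex_normal v j))) =
    w * t * ((i == j)%:R + (- (k + m)%:R)^-1).
  rewrite !inE => /eqP xi /eqP xj; rewrite (simplex_normal_gram gram) ![dot x _]dotC xi xj.
  rewrite /simplex_offset c0 !dot0r !subr0 -[RHS]mulrA; congr (_ * _).
  (* By [tE] the metric contributes -1/(n(n+1)) off the diagonal, which completes -1/(n+1) to
     -1/n. *)
  have -> : kappa * (t / n.+1%:R * (t / n.+1%:R)) = kappa * t * t / n.+1%:R ^+ 2.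
    by field.
  rewrite tE -nkm; field.
  by rewrite nn n1n.
have wt0 : 0 < w * t by rewrite mulr_gt0.
split.
  exact: (normal_cone_face (ltW kappa0) desc wt0 gram' free (gram_constant_gt0 m k0) nkm).
rewrite -(dual_gram_constant m k0).
exact: (tangent_cone_face (ltW kappa0) desc wt0 gram' free (gram_constant_gt0 m k0) nkm).
Qed.

End ideal_simplex.

Lemma ideal_cones (R : realType) (n k m : nat) (kappa : R) (P : set 'rV[R]_n)
    (f : face_point kappa P k) :
  kappa < 0 -> (0 < k)%N -> n = (k + m)%N -> ideal_regular_cube_or_simplex kappa P ->
  model_cone 0 m (- (k + m)%:R)^-1 (normal_cone f) /\
  model_cone k m k%:R^-1 (tangent_cone f).
Proof.
move=> kappa0 k0 nkm [Pcube|Psimplex]; last exact: ideal_simplex_cones.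
by split; [exact: cube_normal_cone|exact: cube_tangent_cone].
Qed.

(** The ambient dimension n plays the role of d-1: the off-diagonal constant -1/(n+1) is already
    -1/d, without metric correction. Hence [k.+1] in place of k, at the same codimension m. *)
Lemma euclidean_simplex_cones (R : realType) (n k m : nat) (P : set 'rV[R]_n)
    (f : face_point 0 P k) :
  (0 < n)%N -> n = (k + m)%N -> regular_simplex P ->
  model_cone 0 m (- (k.+1 + m)%:R)^-1 (normal_cone f) /\
  model_cone k m k.+1%:R^-1 (tangent_cone f).
Proof.
move=> n0 nkm [v [vreg PE]].
have [t t0 gram] := radial_gram n0 vreg.
have desc := simplex_desc t0 gram PE.
have free := simplex_active_free t0 gram f.
have gram' i j :
    i \in active f (simplex_normal v) (simplex_offset v t) ->
    j \in active f (simplex_normal v) (simplex_offset v t) ->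
    (1 + 0 * enorm (Defs.point f) ^+ 2) *
    (dot (simplex_normal v i) (simplex_normal v j)
         + 0 * (dot (Defs.point f) (simplex_normal v i) * dot (Defs.point f) (simplex_normal v j))) =
    t * ((i == j)%:R + (- (k.+1 + m)%:R)^-1).
  move=> _ _; rewrite !mul0r !addr0 mul1r (simplex_normal_gram gram).
  by rewrite [(k.+1 + m)%N]addSn -nkm.
split.
  exact: (normal_cone_face (lexx 0) desc t0 gram' free (gram_constant_gt0 m (ltn0Sn k)) nkm).
rewrite -(dual_gram_constant m (ltn0Sn k)).
exact: (tangent_cone_face (lexx 0) desc t0 gram' free (gram_constant_gt0 m (ltn0Sn k)) nkm).
Qed.

(** * From model cones to the angle formulas *)

Lemma solid_angle_external (R : realType) (l k m : nat) (K : ip_cone R) : (0 < k)%N ->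
  model_cone l m (- (k + m)%:R)^-1 K ->
  (solid_angle K)%:C%C = gauss_integral (@external_integrand R k m).
Proof.
move=> k0 modK; have [a ma <-] := @external_mass R k m k0.
have mc := gram_constant_gt0 m k0 : (0 < 1 + m%:R * _ :> R).
have mb := total_mass_quadratic 0 mc.
rewrite invrN in mc mb modK.
rewrite (model_cone_angle mc modK ma mb); congr (_%:C%C); congr (_ / _).
(* At shift 0 the total mass is (2 pi)^(m/2) over the square root of k/d, which is the normalization
   in [external_mass]. *)
rewrite expr0n mulr0 mul0r oppr0 expR0 mulr1; congr (_ / _).
by rewrite -invrN gram_constantE // sqrtrM ?ler0n // sqrtrV.
Qed.

Lemma solid_angle_internal (R : realType) (l k m : nat) (K : ip_cone R) : (0 < k)%N ->
  model_cone l m k%:R^-1 K ->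
  (solid_angle K)%:C%C = gauss_integral (@internal_integrand R (k + m) m).
Proof.
move=> k0 modK; have [a ma <-] := @internal_mass R k m k0.
have kn : (k%:R : R) != 0 by rewrite pnatr_eq0 -lt0n.
have e : 1 + m%:R * k%:R^-1 = (k + m)%:R / k%:R :> R.
  by rewrite natrD; field.
have mc : 0 < 1 + m%:R * k%:R^-1 :> R by rewrite e divr_gt0 ?ltr0n ?addn_gt0 ?k0.
have mb := total_mass_quadratic 0 mc.
rewrite (model_cone_angle mc modK ma mb); congr (_%:C%C); congr (_ / _).
rewrite expr0n mulr0 mul0r oppr0 expR0 mulr1; congr (_ / _).
by rewrite e sqrtrM ?ler0n // sqrtrV // invf_div.
Qed.

Theorem proposition5p4 (R : realType) (d : nat) (kappa : R)
    (hd : (2 <= d)%N) (hkappa : kappa < 0)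
    (k : nat) (hk : (1 <= k <= d - 1)%N) :
  let CN := orthocentric_cone (- d%:R : R)
              (fun _ : 'I_(d - k) => 1) (fun _ => 1) in
  let CT := orthocentric_cone (k%:R : R)
              (fun _ : 'I_(d - k) => 1) (fun _ => 1) in
  let ideal := @ideal_regular_cube_or_simplex R d kappa in
  let ext_angle := gauss_integral (@external_integrand R k (d - k)) in
  let int_angle := gauss_integral (@internal_integrand R d (d - k)) in
  (* the orthocentric cones exist *)
  ((exists C, CN C) /\ (exists C, CT C)) /\
  (* (a) *)
  ((forall P Q, ideal P -> ideal Q ->
      forall (f : face_point kappa P k) (g : face_point kappa Q k),
        isometric (normal_cone f) (normal_cone g)) /\
   (forall P, ideal P -> forall (f : face_point kappa P k) (C : ip_cone R),
      CN C -> isometric (normal_cone f) C)) /\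
  (* (b) *)
  ((forall P Q, ideal P -> ideal Q ->
      forall (f : face_point kappa P k) (g : face_point kappa Q k),
        isometric (tangent_cone f) (tangent_cone g)) /\
   (forall P, ideal P -> forall (f : face_point kappa P k) (C : ip_cone R),
      CT C -> isometric (tangent_cone f) (oplus (euclidean_space k) C))) /\
  (* (c) *)
  (forall E : set 'rV[R]_(d - 1), regular_simplex E ->
     forall (e : face_point 0 E (k - 1)) (C : ip_cone R),
       (CN C -> isometric (normal_cone e) C) /\
       (CT C ->
          isometric (tangent_cone e) (oplus (euclidean_space (k - 1)) C))) /\
  (* (d) *)
  ((forall P, ideal P -> forall E : set 'rV[R]_(d - 1), regular_simplex E ->
      forall (f : face_point kappa P k) (e : face_point 0 E (k - 1)),
        external_angle f = external_angle e /\
        internal_angle f = internal_angle e) /\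
   (cintegrable setT (@external_integrand R k (d - k)) /\
    cintegrable setT (@internal_integrand R d (d - k))) /\
   (forall P, ideal P -> forall f : face_point kappa P k,
      (external_angle f)%:C%C = ext_angle /\
      (internal_angle f)%:C%C = int_angle) /\
   (forall E : set 'rV[R]_(d - 1), regular_simplex E ->
      forall e : face_point 0 E (k - 1),
        (external_angle e)%:C%C = ext_angle /\
        (internal_angle e)%:C%C = int_angle)).
Proof.
move=> CN CT ideal ext_angle int_angle.
have /andP[k0 kd] := hk.
have [m dE] : exists m, d = (k + m)%N.
  by exists (d - k)%N; rewrite subnKC // (leq_trans kd) // leq_subr.
have mE : (d - k)%N = m by rewrite dE addKn.
(* Faces of dimension k in dimension d and of dimension k - 1 in dimension d - 1 have the same
   codimension m. *)
have ddE : (d - 1)%N = (k - 1 + m)%N by rewrite dE addnC -addnBA // addnC.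
have kE : (k - 1).+1 = k by rewrite subn1 prednK.
have dn1 : (0 < d - 1)%N by rewrite subn_gt0.
have mcN := gram_constant_gt0 m k0 : (0 < 1 + m%:R * _ :> R).
have mcT : 0 < 1 + m%:R * k%:R^-1 :> R by rewrite ltr_pwDl // mulr_ge0 ?invr_ge0 ?ler0n.
rewrite /CN /CT /ext_angle /int_angle {CN CT ext_angle int_angle} mE.
have dI : @internal_integrand R d m = @internal_integrand R (k + m) m by rewrite dE.
have idealM P (f : face_point kappa P k) : ideal P ->
    model_cone 0 m (- (k + m)%:R)^-1 (normal_cone f) /\
    model_cone k m k%:R^-1 (tangent_cone f).
  exact: ideal_cones.
have simplexM E (e : face_point 0 E (k - 1)) : @regular_simplex R (d - 1) E ->
    model_cone 0 m (- (k + m)%:R)^-1 (normal_cone e) /\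
    model_cone (k - 1) m k%:R^-1 (tangent_cone e).
  by move=> /(euclidean_simplex_cones e dn1 ddE); rewrite kE.
have cN C : orthocentric_cone (- d%:R : R) (fun _ : 'I_m => 1) (fun=> 1) C ->
    model_cone 0 m (- (k + m)%:R)^-1 C.
  by rewrite -dE; exact: orthocentric_model.
have cT l C : orthocentric_cone (k%:R : R) (fun _ : 'I_m => 1) (fun=> 1) C ->
    model_cone l m k%:R^-1 (oplus (euclidean_space l) C).
  exact: oplus_orthocentric_model.
have idealA P (f : face_point kappa P k) : ideal P ->
    (external_angle f)%:C%C = gauss_integral (@external_integrand R k m) /\
    (internal_angle f)%:C%C = gauss_integral (@internal_integrand R d m).
  move=> /(idealM _ f)[fN fT].
  by split; [exact: solid_angle_external fN|rewrite dI; exact: solid_angle_internal fT].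
have simplexA E (e : face_point 0 E (k - 1)) : @regular_simplex R (d - 1) E ->
    (external_angle e)%:C%C = gauss_integral (@external_integrand R k m) /\
    (internal_angle e)%:C%C = gauss_integral (@internal_integrand R d m).
  move=> /(simplexM _ e)[eN eT].
  by split; [exact: solid_angle_external eN|rewrite dI; exact: solid_angle_internal eT].
split; [split|split; [split|split; [split|split; [|split; [|split; [split|split]]]]]].
- apply: (@orthocentric_exists R m (- d%:R)); last by rewrite dE.
  by rewrite oppr_eq0 pnatr_eq0 -lt0n (leq_trans _ hd).
- by apply: (@orthocentric_exists R m k%:R) mcT; rewrite pnatr_eq0 -lt0n.
- move=> P Q /idealM Pi /idealM Qi f g.
  exact: (model_cone_isometric mcN (proj1 (Pi f)) (proj1 (Qi g))).
- move=> P /idealM Pi f C /cN; exact: (model_cone_isometric mcN (proj1 (Pi f))).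
- move=> P Q /idealM Pi /idealM Qi f g.
  exact: (model_cone_isometric mcT (proj2 (Pi f)) (proj2 (Qi g))).
- move=> P /idealM Pi f C CC; exact: (model_cone_isometric mcT (proj2 (Pi f)) (cT _ _ CC)).
- move=> E /simplexM Es e C; split=> CC.
    exact: (model_cone_isometric mcN (proj1 (Es e)) (cN _ CC)).
  exact: (model_cone_isometric mcT (proj2 (Es e)) (cT _ _ CC)).
- move=> P /idealA Pi E /simplexA Es f e.
  (* Both angles have the same complex integral as value; equality of the real parts gives equality
     in [R]. *)
  have [fe fi] := Pi f; have [ee ei] := Es e.
  by split; [have [] := etrans fe (esym ee)|have [] := etrans fi (esym ei)].
- exact: cintegrable_external.
- by rewrite dI; exact: cintegrable_internal.
- by move=> P /idealA.
- by move=> E /simplexA.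
Qed.
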